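(* Let $X^{(1)},X^{(2)}$ be the finite-activity jump-diffusion processes described in the context, observed at the equally spaced synchronous times $t_j=jh$, $j=0,\dots,n$, $h=T/n$, and let $r_h=r(h)$ be a deterministic threshold with $\lim_{h\to0}r(h)=0$ and $\lim_{h\to 0}\frac{h\log(1/h)}{r(h)}=0$. Then, as $n\to\infty$, for all $t\in[0,T]$: (i) $\hat{IC}_{t,n}\stackrel{P}{\longrightarrow}IC_t$; (ii) for $(i,j)=(1,2)$ or $(2,1)$, if a.s. $IV^{(j)}_t\ne0$, then $$\hat\beta^{(i,j)}_{t,n}:=\frac{\hat{IC}_{t,n}}{\hat{IV}^{(j)}_{t,n}}\stackrel{P}{\longrightarrow}\beta^{(i,j)}_t:=\frac{IC_t}{IV^{(j)}_t};$$ (iii) if a.s. $IV^{(1)}_tIV^{(2)}_t\neq0$, then $$\hat\rho^{(1,2)}_{t,n}:=\frac{\hat{IC}_{t,n}}{\sqrt{\hat{IV}^{(1)}_{t,n}\hat{IV}^{(2)}_{t,n}}}\stackrel{P}{\longrightarrow}\rho^{(1,2)}_t:=\frac{IC_t}{\sqrt{IV^{(1)}_tIV^{(2)}_t}}.$$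
   Context: Setting. $T<\infty$ is fixed and $(\Omega,\mathcal F,(\mathcal F_t)_{t\in[0,T]},P)$ is a filtered probability space. For $q=1,2$, $$X^{(q)}_t=\int_0^ta^{(q)}_s\,ds+\int_0^t\sigma^{(q)}_s\,dW^{(q)}_s+J^{(q)}_t,\qquad t\in[0,T],$$ where: (A1) $W^{(1)},W^{(2)}$ are Wiener processes with $d\langle W^{(1)},W^{(2)}\rangle_t=\rho_t\,dt$; one can write $dW^{(2)}_t=\rho_t\,dW^{(1)}_t+\sqrt{1-\rho_t^2}\,dW^{(3)}_t$ with $W^{(1)},W^{(3)}$ independent standard Brownian motions. (A2) $a^{(q)},\sigma^{(q)}$ ($q=1,2$) and $\rho$ are càdlàg adapted processes. (A4, finite activity jumps) $J^{(q)}_t=\sum_{k=1}^{N^{(q)}_t}\gamma_{\tau^{(q)}_k}$, where $N^{(q)}$ is a counting process with $E[N^{(q)}_T]<\infty$, $\tau^{(q)}_k$ are its jump times, $\gamma_{\tau^{(q)}_k}$ is the size of the jump at $\tau^{(q)}_k$, and $P(\gamma_{\tau^{(q)}_k}=0)=0$ for all $k=1,\dots,N^{(q)}_T$. No further assumption (law, independence) is made on the jump sizes or on $N^{(q)}$. Notation. $\Delta_jZ=Z_{t_j}-Z_{t_{j-1}}$. $IC_t=\int_0^t\rho_s\sigma^{(1)}_s\sigma^{(2)}_s\,ds$, $IV^{(q)}_t=\int_0^t(\sigma^{(q)}_s)^2\,ds$, $$\hat{IC}_{t,n}=\sum_{j:\,t_j\le t}\Delta_jX^{(1)}1_{\{(\Delta_jX^{(1)})^2\le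 r_h\}}\,\Delta_jX^{(2)}1_{\{(\Delta_jX^{(2)})^2\le r_h\}},\qquad \hat{IV}^{(q)}_{t,n}=\sum_{j:\,t_j\le t}(\Delta_jX^{(q)})^21_{\{(\Delta_jX^{(q)})^2\le r_h\}}.$$ Ratios with vanishing denominator are assigned an arbitrary value (say $0$). *)

(* Defs.v *)
From HB Require Import structures.
From mathcomp Require Import all_boot all_order all_algebra.
From mathcomp Require Import all_classical all_reals all_analysis.

Set Implicit Arguments.
Unset Strict Implicit.
Unset Printing Implicit Defensive.

Import Order.TTheory GRing.Theory Num.Theory.
Import numFieldNormedType.Exports.

Local Open Scope classical_set_scope.
Local Open Scope ring_scope.

Section processes.
Context {d : measure_display} {Omega : measurableType d} {R : realType}.
Implicit Types (P : probability Omega R) (T s t : R).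
Implicit Types (X Y W H I J M N A : R -> Omega -> R) (U V : Omega -> R).

(* A process is a map R -> Omega -> R of which only the values at times
   0 <= t <= T are relevant. *)

Definition cvg_in_prob P (Un : nat -> Omega -> R) U : Prop :=
  forall eps : R, 0 < eps ->
    P [set w | eps < `|Un n w - U w|] @[n --> \oo] --> 0%E.

(* The usual conditions (completeness, right-continuity) are not imposed. *)
Record is_filtration T (F : R -> set (set Omega)) : Prop := IsFiltration {
  filtration_sigma : forall t, 0 <= t <= T -> sigma_algebra setT (F t) ;
  filtration_sub : forall t, 0 <= t <= T -> F t `<=` measurable ;
  filtration_mono : forall s t, 0 <= s -> s <= t -> t <= T -> F s `<=` F t }.

Definition measurable_wrt (G : set (set Omega)) U : Prop :=
  forall B : set R, measurable B -> G (U @^-1` B).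

Definition adapted T (F : R -> set (set Omega)) X : Prop :=
  forall t, 0 <= t <= T -> measurable_wrt (F t) (X t).

Definition continuous_paths T X : Prop :=
  forall w, {within `[0, T], continuous (fun t => X t w)}.

Definition cadlag_paths T X : Prop :=
  forall w,
    (forall t, 0 <= t < T -> X s w @[s --> t^'+] --> X t w) /\
    (forall t, 0 < t <= T -> cvg (X s w @[s --> t^'-])).

Definition indistinguishable P T X Y : Prop :=
  {ae P, forall w, forall t, 0 <= t <= T -> X t w = Y t w}.

Record is_brownian P T (F : R -> set (set Omega)) W : Prop := IsBrownian {
  brownian_adapted : adapted T F W ;
  brownian_continuous : continuous_paths T W ;
  brownian_0 : {ae P, forall w, W 0 w = 0} ;
  brownian_normal : forall s t, 0 <= s -> s < t -> t <= T ->
    forall B : set R, measurable B ->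
      P ((W t \- W s) @^-1` B) = normal_prob 0 (Num.sqrt (t - s)) B ;
  brownian_indep : forall s t, 0 <= s -> s < t -> t <= T ->
    forall (A : set Omega) (B : set R), F s A -> measurable B ->
      P (A `&` (W t \- W s) @^-1` B) = (P A * P ((W t \- W s)%R @^-1` B))%E }.

Definition sigma_process T X : set (set Omega) :=
  <<s [set A : set Omega | exists t (B : set R),
         [/\ 0 <= t <= T, measurable B & A = X t @^-1` B] ] >>.

Definition independent_processes P T X Y : Prop :=
  forall A B : set Omega, sigma_process T X A -> sigma_process T Y B ->
    P (A `&` B) = (P A * P B)%E.

(* The last field is E[M t | F s] = M s, written out through the defining
   property of the conditional expectation. *)
Record is_martingale P T (F : R -> set (set Omega)) M : Prop := IsMartingale {
  martingale_adapted : adapted T F M ;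
  martingale_integrable : forall t, 0 <= t <= T ->
    P.-integrable setT (EFin \o M t) ;
  martingale_cond : forall s t, 0 <= s -> s <= t -> t <= T ->
    forall A : set Omega, F s A ->
      (\int[P]_(w in A) (M t w)%:E = \int[P]_(w in A) (M s w)%:E)%E }.

(* A = <M, N> for continuous square-integrable martingales M and N. *)
Record is_bracket P T (F : R -> set (set Omega)) M N A : Prop := IsBracket {
  bracket_adapted : adapted T F A ;
  bracket_continuous : continuous_paths T A ;
  bracket_BV : forall w, bounded_variation 0 T (fun t => A t w) ;
  bracket_0 : forall w, A 0 w = 0 ;
  bracket_martingale :
    is_martingale P T F (fun t w => M t w * N t w - A t w) }.

Definition time_integral H : R -> Omega -> R :=
  fun t w => \int[lebesgue_measure]_(s in `[0, t]) H s w.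

(* The process \sum_(i < sp_size) sp_coef i * \1_(]sp_time i, sp_time i.+1]). *)
Record simple_process T (F : R -> set (set Omega)) := SimpleProcess {
  sp_size : nat ;
  sp_time : nat -> R ;
  sp_coef : nat -> Omega -> R ;
  sp_time_range : forall i, (i <= sp_size)%N -> 0 <= sp_time i <= T ;
  sp_time_mono : forall i, (i < sp_size)%N -> sp_time i <= sp_time i.+1 ;
  sp_coef_measurable : forall i, (i < sp_size)%N ->
    measurable_wrt (F (sp_time i)) (sp_coef i) ;
  sp_coef_bounded : forall i, (i < sp_size)%N ->
    exists C : R, forall w, `|sp_coef i w| <= C }.

Definition sp_value T F (H : simple_process T F) : R -> Omega -> R :=
  fun t w => \sum_(i < sp_size H)
    sp_coef H i w * \1_(`]sp_time H i, sp_time H i.+1]) t.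

Definition sp_integral T F (H : simple_process T F) W : R -> Omega -> R :=
  fun t w => \sum_(i < sp_size H)
    sp_coef H i w *
      (W (Num.min t (sp_time H i.+1)) w - W (Num.min t (sp_time H i)) w).

Definition approximates P T F (Hn : nat -> simple_process T F) H t : Prop :=
  cvg_in_prob P
    (fun n => time_integral (fun s w => (sp_value (Hn n) s w - H s w) ^+ 2) t)
    (cst 0).

(* I = \int_0^. H dW in the sense of Ito: at each time t, the common limit in
   probability of the elementary integrals of all sequences of simple processes
   tending to H in L^2([0, t]) in probability (such sequences being required
   to exist), taken in a version with continuous paths. *)
Record is_ito_integral P T (F : R -> set (set Omega)) W H I : Prop :=
  IsItoIntegral {
  ito_continuous : continuous_paths T I ;
  ito_measurable : forall t, 0 <= t <= T -> measurable_fun setT (I t) ;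
  ito_approx : forall t, 0 <= t <= T ->
    exists Hn : nat -> simple_process T F, approximates P Hn H t ;
  ito_cvg : forall t, 0 <= t <= T ->
    forall Hn : nat -> simple_process T F, approximates P Hn H t ->
      cvg_in_prob P (fun n => sp_integral (Hn n) W t) (I t) }.

(* W1 and W2 are Wiener processes with d<W1, W2> = rho dt and
   dW2 = rho dW1 + sqrt(1 - rho^2) dW3 for a Brownian motion W3 independent
   of W1.  |rho| <= 1 is not required separately: up to null sets of (w, t) it
   follows from the bracket. *)
Record correlated_brownian P T (F : R -> set (set Omega)) W1 W2
  (rho : R -> Omega -> R) : Prop := CorrelatedBrownian {
  corr_brownian1 : is_brownian P T F W1 ;
  corr_brownian2 : is_brownian P T F W2 ;
  corr_bracket : is_bracket P T F W1 W2 (time_integral rho) ;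
  corr_decomp : exists W3 I1 I3,
    [/\ is_brownian P T F W3, independent_processes P T W1 W3,
        is_ito_integral P T F W1 rho I1,
        is_ito_integral P T F W3 (fun t w => Num.sqrt (1 - rho t w ^+ 2)) I3 &
        indistinguishable P T W2 (fun t w => I1 t w + I3 t w)] }.

(* counting_unit bounds the jump N t - N t^- by 1, so that the jump times
   below are pairwise distinct. *)
Record is_counting_process T (N : R -> Omega -> nat) : Prop := IsCounting {
  counting_measurable : forall t, 0 <= t <= T -> measurable_fun setT (N t) ;
  counting_0 : forall w, N 0 w = 0%N ;
  counting_mono : forall w s t, 0 <= s -> s <= t -> t <= T ->
    (N s w <= N t w)%N ;
  counting_right : forall w t, 0 <= t < T ->
    \forall s \near t^'+, N s w = N t w ;
  counting_unit : forall w t, 0 < t <= T ->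
    \forall s \near t^'-, (N t w <= (N s w).+1)%N }.

(* The k-th jump time; relevant only for 1 <= k <= N T w. *)
Definition jump_time T (N : R -> Omega -> nat) (k : nat) (w : Omega) : R :=
  inf [set t | 0 <= t <= T /\ (k <= N t w)%N].

(* gamma t w is the size of the jump at t if N jumps at t, and is otherwise
   unused; no law, independence or adaptedness is required of gamma and N. *)
Record finite_activity_jumps P T (N : R -> Omega -> nat)
  (gamma : R -> Omega -> R) J : Prop := FiniteActivityJumps {
  jumps_counting : is_counting_process T N ;
  jumps_finite_mean : ('E_P[fun w => (N T w)%:R] < +oo)%E ;
  jumps_size_measurable : forall k, (0 < k)%N ->
    measurable_fun [set w | (k <= N T w)%N]
      (fun w => gamma (jump_time T N k w) w) ;
  jumps_size_neq0 : forall k, (0 < k)%N ->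
    P [set w | (k <= N T w)%N /\ gamma (jump_time T N k w) w = 0] = 0%E ;
  jumps_def : forall t w, 0 <= t <= T ->
    J t w = \sum_(1 <= k < (N t w).+1) gamma (jump_time T N k w) w }.

Record jump_diffusion P T (F : R -> set (set Omega)) W (a sigma : R -> Omega -> R)
  (N : R -> Omega -> nat) (gamma : R -> Omega -> R) X : Prop := JumpDiffusion {
  jd_measurable : forall t, 0 <= t <= T -> measurable_fun setT (X t) ;
  jd_drift : adapted T F a /\ cadlag_paths T a ;
  jd_diffusion : adapted T F sigma /\ cadlag_paths T sigma ;
  jd_decomp : exists I J,
    [/\ is_ito_integral P T F W sigma I,
        finite_activity_jumps P T N gamma J &
        indistinguishable P T X
          (fun t w => time_integral a t w + I t w + J t w)] }.

(* Observation times j * h with mesh h = T / n. *)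
Definition increment T (n j : nat) X (w : Omega) : R :=
  X (j%:R * (T / n%:R)) w - X (j.-1%:R * (T / n%:R)) w.

Definition truncated_increment T (r : R -> R) (n j : nat) X (w : Omega) : R :=
  if increment T n j X w ^+ 2 <= r (T / n%:R) then increment T n j X w else 0.

Definition IC_hat T (r : R -> R) X1 X2 t (n : nat) (w : Omega) : R :=
  \sum_(1 <= j < n.+1 | j%:R * (T / n%:R) <= t)
    truncated_increment T r n j X1 w * truncated_increment T r n j X2 w.

Definition IV_hat T (r : R -> R) X t (n : nat) (w : Omega) : R :=
  \sum_(1 <= j < n.+1 | j%:R * (T / n%:R) <= t)
    truncated_increment T r n j X w ^+ 2.

Definition IC (rho sigma1 sigma2 : R -> Omega -> R) t : Omega -> R :=
  time_integral (fun s w => rho s w * sigma1 s w * sigma2 s w) t.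

Definition IV (sigma : R -> Omega -> R) t : Omega -> R :=
  time_integral (fun s w => sigma s w ^+ 2) t.

End processes.

(* Main.v *)
(* On the event that the continuous parts Y of X have all increments below
   sqrt (r_h), an increment of X containing no jump passes the threshold, while
   one containing a jump contributes at most r_h in absolute value to the
   estimator, whatever the size of the jump.  There are at most N1_T + N2_T of
   the latter and r_h -> 0, so the estimator is asymptotically the sum of
   products of the increments of Y1 and Y2.  No modulus of continuity is needed
   for the first point: for a simple process with bounded coefficients, the Ito
   integral has sub-Gaussian increments, and a union bound over the n intervals
   is absorbed by h log (1 / h) = o(r_h).

   In probability, the sum of squares of Delta_j Y - sigma_{t_{j-1}} Delta_j W
   tends to 0 (an L^2 estimate after clipping sigma), so that Y1 and Y2 may be
   replaced by these linearizations.  The same estimate for the decomposition of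
   W2 yields Delta_j W2 = rho Delta_j W1 + sqrt (1 - rho^2) Delta_j W3 up to
   negligible terms.  The sums of c (Delta_j W1)^2 tend to int c ds by the
   quadratic variation of W1, and those of c Delta_j W1 Delta_j W3 to 0 by
   independence.  The ratios follow by the continuous mapping theorem. *)
Require Import Defs.
From HB Require Import structures.
From mathcomp Require Import all_boot all_order all_algebra.
From mathcomp Require Import all_classical all_reals all_analysis.
From mathcomp Require Import measurable_realfun.
From mathcomp Require Import ring lra zify.

Import Order.TTheory GRing.Theory Num.Theory.
Import numFieldNormedType.Exports.

Local Open Scope classical_set_scope.
Local Open Scope ring_scope.

(** * Càdlàg functions and Riemann sums *)

Section cadlag.
Context {R : realType}.
Implicit Types (T x y e M : R) (f g : R -> R) (S : seq R).

(** An Itô integral is given here only as a limit in probability of integrals of simple processes,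
    at each fixed time. Neither an isometry nor a tail bound nor locality comes with it, so every
    estimate is made on simple integrals over a grid of mesh [T / (n * m)] and transferred to the
    [n] observation intervals by letting [m] grow for fixed [n]. Locality is replaced by a pathwise
    identity: where [H] is bounded by [M] on all grids, clipping [H] at [M] changes nothing.

    Independence of the past is assumed of the increments of [W1] and of [W3] separately; for pairs
    it would take Lévy's characterization. A random weight [c] is therefore not carried through an
    L2 orthogonality computation: it is frozen on a coarse grid, where only sums with deterministic
    weights remain.

    The oscillation of càdlàg coefficients is controlled by finitely many breakpoints, each of which
    spoils a part of [[0, T]] of length proportional to the mesh. *)

Definition cadlag T f :=
  (forall t, 0 <= t < T -> f s @[s --> t^'+] --> f t) /\
  (forall t, 0 < t <= T -> cvg (f s @[s --> t^'-])).

(** For [x <= y], both points lie in one cell that is closed on the left and open on the right, the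
    shape of the intervals on which a càdlàg path can be nearly constant. *)
Definition free_left S x y := forall p, p \in S -> ~ (x < p <= y).

(** Supremum argument over the [b] for which finitely many breakpoints serve [[0, b[]. The left
    limit at the supremum [s] shows that [s] itself is served, after adding a breakpoint below [s];
    right-continuity at [s], with [s] as a new breakpoint, would go beyond [s] if [s < T]. *)
Lemma cadlag_break T f e : 0 < T -> cadlag T f -> 0 < e ->
  exists S, forall x y, 0 <= x -> x <= y -> y <= T -> free_left S x y ->
    `|f x - f y| <= e.
Proof.
move=> T0 [fr fl] e0; have e20 : 0 < e / 2 by rewrite divr_gt0.
pose ok b S := forall x y, 0 <= x -> x <= y -> y < b -> free_left S x y ->
    `|f x - f y| <= e.
pose B := [set b | 0 <= b <= T /\ exists S, ok b S].
have B0 : B 0.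
  split; first by rewrite lexx ltW.
  by exists [::] => x y x0 xy y0; lra.
have supB : has_sup B by split; [exists 0 | exists T => b [/andP[]]].
set s := sup B.
have s0 : 0 <= s by apply: ub_le_sup => //; exact: supB.2.
have sT : s <= T by apply: ge_sup; [exact: supB.1 | move=> b [/andP[]]].
have [Ss okS] : exists S, ok s S.
  have [s_gt0|] := ltP 0 s; last first.
    by move=> s_le0; exists [::] => x y x0 xy ys; lra.
  have /fl/cvg_ex[l fsl] : 0 < s <= T by rewrite s_gt0.
  have /cvgrPdist_lt/(_ _ e20) := fsl; rewrite /at_left near_withinE => /nbhs_ballP[r /= r0 rf].
  have [b [_ [S okb]]] := sup_adherent r0 supB; rewrite -/s => sb.
  exists (b :: S) => x y x0 xy ys fS.
  have nfS : free_left S x y by move=> p pS; apply: fS; rewrite in_cons pS orbT.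
  have [yb|cy] := ltP y b; first exact: okb.
  have bx : b <= x.
    have := fS b; rewrite in_cons eqxx cy andbT => /(_ isT)/negP.
    by rewrite -leNgt.
  have near_s z : b <= z -> z < s -> `|l - f z| < e / 2.
    by move=> bz zs; apply: rf => //; rewrite /ball /= ger0_norm; lra.
  have h1 := near_s x bx (le_lt_trans xy ys).
  have h2 := near_s y cy ys.
  rewrite -(subrKA l) [leRHS]splitr.
  by apply: (le_trans (ler_normD _ _)); rewrite lerD ?ltW// distrC.
have sTE : s = T.
  apply/eqP; rewrite eq_le sT leNgt; apply/negP => ltsT.
  have /fr fs : 0 <= s < T by rewrite s0.
  have /cvgrPdist_lt/(_ _ e20) := fs; rewrite /at_right near_withinE => /nbhs_ballP[r /= r0 rf].
  pose b := Num.min T (s + r).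
  have sb : s < b by rewrite /b lt_min ltsT ltrDl.
  suff /(ub_le_sup supB.2) : B b by rewrite -/s leNgt sb.
  have bT : b <= T by rewrite /b ge_min lexx.
  have bsr : b <= s + r by rewrite /b ge_min lexx orbT.
  split; first by rewrite bT (le_trans s0 (ltW sb)).
  exists (s :: Ss) => x y x0 xy yb fS.
  have nfS : free_left Ss x y by move=> p pS; apply: fS; rewrite in_cons pS orbT.
  have [ys|sy] := ltP y s; first exact: okS.
  have sx : s <= x.
    have := fS s; rewrite in_cons eqxx sy andbT => /(_ isT).
    by move/negP; rewrite -leNgt.
  have near_s z : s <= z -> z < b -> `|f s - f z| < e / 2.
    rewrite le_eqVlt => /predU1P[<- _|sz zb]; first by rewrite subrr normr0.
    apply: rf => //.
    by rewrite /ball /= ltr0_norm; lra.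
  have h1 := near_s x sx (le_lt_trans xy yb).
  have h2 := near_s y sy yb.
  rewrite -(subrKA (f s)) [leRHS]splitr.
  by apply: (le_trans (ler_normD _ _)); rewrite lerD ?ltW// distrC.
exists (T :: Ss) => x y x0 xy yT fS.
have nfS : free_left Ss x y by move=> p pS; apply: fS; rewrite in_cons pS orbT.
have [yltT|Ty] := ltP y T; first by apply: okS => //; rewrite sTE.
have yE : y = T by apply/eqP; rewrite eq_le yT Ty.
have := fS T; rewrite in_cons eqxx Ty andbT => /(_ isT)/negP.
rewrite -leNgt => Tx; have -> : x = y by apply/eqP; rewrite eq_le xy; lra.
by rewrite subrr normr0 ltW.
Qed.

Lemma free_left_max S x y : x <= y ->
  exists2 p, p \in x :: S & (x <= p <= y) /\ free_left S p y.
Proof.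
move=> xy; elim: S => [|q S [p pS [/andP[xp py] fp]]].
  by exists x; rewrite ?mem_head// lexx xy.
have [/andP[pq qy]|] := boolP (p < q <= y).
  exists q; first by rewrite !in_cons eqxx orbT.
  split; first by rewrite qy (le_trans xp (ltW pq)).
  move=> r; rewrite in_cons => /predU1P[->|rS]; first by rewrite ltxx.
  by move=> /andP[qr ry]; apply: (fp r rS); rewrite ry (lt_trans pq qr).
move=> /negP npq; exists p.
  by move: pS; rewrite !in_cons => /orP[->//|->]; rewrite !orbT.
split; first by rewrite xp.
by move=> r; rewrite in_cons => /predU1P[->|/fp].
Qed.

(** The value at [x] is within 1 of the value at the last breakpoint before [x], which is one of
    finitely many. *)
Lemma cadlag_bounded T f : 0 < T -> cadlag T f ->
  exists M, forall x, 0 <= x <= T -> `|f x| <= M.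
Proof.
move=> T0 cf; have [S fS] := cadlag_break T f 1 T0 cf ltr01.
exists (1 + \sum_(p <- 0 :: S) `|f p|) => x /andP[x0 xT].
have [p pS [/andP[p0 px] /(fS _ _ p0 px xT) fpx]] := free_left_max S 0 x x0.
rewrite -(subrK (f p) (f x)); apply: (le_trans (ler_normD _ _)).
apply: lerD; first by rewrite distrC.
rewrite (big_rem _ pS)/= lerDl sumr_ge0// => i _.
Qed.

Lemma cadlag_comp T f (g : R -> R) : continuous g -> cadlag T f ->
  cadlag T (g \o f).
Proof.
move=> cg [fr fl]; split=> t tT.
  by apply: (cvg_comp _ g (fr t tT)); exact: cg.
have /cvg_ex[l fl'] := fl t tT.
by apply/cvg_ex; exists (g l); apply: (cvg_comp _ g fl'); exact: cg.
Qed.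

Lemma cadlagM T f g : cadlag T f -> cadlag T g -> cadlag T (fun x => f x * g x).
Proof.
move=> [fr fl] [gr gl]; split=> t tT; first by apply: cvgM; [exact: fr|exact: gr].
by apply: is_cvgM; [exact: fl|exact: gl].
Qed.

End cadlag.

(** * Equally spaced grids *)

Section ticks.
Context {R : realType}.
Implicit Types (T s : R).

Definition tick T (N k : nat) : R := k%:R * (T / N%:R).

Lemma tick0 T N : tick T N 0 = 0. Proof. by rewrite /tick mul0r. Qed.

Lemma tick_max T N : (0 < N)%N -> tick T N N = T.
Proof. by move=> N0; rewrite /tick mulrC divfK// pnatr_eq0 -lt0n. Qed.

Lemma mesh_gt0 T N : 0 < T -> (0 < N)%N -> 0 < T / N%:R.
Proof. by move=> T0 N0; rewrite divr_gt0// ltr0n. Qed.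

Lemma mesh_ge0 T N : 0 < T -> 0 <= T / N%:R.
Proof. by move=> T0; rewrite divr_ge0// ltW. Qed.

Lemma tickS T N k : tick T N k.+1 = tick T N k + T / N%:R.
Proof. by rewrite /tick -natr1 mulrDl mul1r. Qed.

Lemma tick_ge0 T N k : 0 < T -> 0 <= tick T N k.
Proof. by move=> T0; rewrite mulr_ge0// mesh_ge0. Qed.

Lemma ler_tick T N k l : 0 < T -> (k <= l)%N -> tick T N k <= tick T N l.
Proof. by move=> T0 kl; rewrite ler_wpM2r ?ler_nat// mesh_ge0. Qed.

Lemma ltr_tick T N k l : 0 < T -> (0 < N)%N -> (k < l)%N -> tick T N k < tick T N l.
Proof. by move=> T0 N0 kl; rewrite ltr_pM2r ?ltr_nat// mesh_gt0. Qed.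

Lemma tick_le T N k : 0 < T -> (k <= N)%N -> tick T N k <= T.
Proof.
move=> T0; case: N => [|N] kN; first by rewrite /tick invr0 mulr0 mulr0 ltW.
by rewrite -{2}(tick_max T N.+1)// ler_tick.
Qed.

Lemma tick_itv T N k : 0 < T -> (k <= N)%N -> 0 <= tick T N k <= T.
Proof. by move=> T0 kN; rewrite tick_ge0// tick_le. Qed.

Lemma tick_left T N s : 0 < T -> (0 < N)%N -> 0 <= s < T ->
  exists2 k, (k < N)%N & tick T N k <= s < tick T N k.+1.
Proof.
move=> T0 N0 /andP[s0 sT]; have h0 := mesh_gt0 T N T0 N0.
have x0 : 0 <= s / (T / N%:R) by rewrite divr_ge0// ltW.
have /andP[kx xk] := truncn_itv x0.
set k := Num.trunc _ in kx xk.
exists k; last by rewrite /tick -ler_pdivlMr// kx -ltr_pdivrMr.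
rewrite -(ltr_nat R); apply: le_lt_trans kx _.
by rewrite ltr_pdivrMr// mulrC divfK// pnatr_eq0 -lt0n.
Qed.

Lemma tick_right T N s : 0 < T -> (0 < N)%N -> 0 < s <= T ->
  exists2 k, (k < N)%N & tick T N k < s <= tick T N k.+1.
Proof.
move=> T0 N0 /andP[s0 sT].
have : exists k, s <= tick T N k by exists N; rewrite tick_max.
move=> ex; case: (ex_minnP ex) => -[|k] sk kmin.
  by move: sk; rewrite tick0 leNgt s0.
exists k; first by apply: kmin; rewrite tick_max.
by rewrite sk andbT ltNge; apply/negP => /kmin; rewrite ltnn.
Qed.

Lemma tick_inj T N s k l : 0 < T -> tick T N k <= s < tick T N k.+1 ->
  tick T N l <= s < tick T N l.+1 -> k = l.
Proof.
move=> T0 /andP[a b] /andP[c d].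
have [kl|lk|//] := ltngtP k l.
  by have := le_lt_trans (le_trans (ler_tick T N _ _ T0 kl) c) b; rewrite ltxx.
by have := le_lt_trans (le_trans (ler_tick T N _ _ T0 lk) a) d; rewrite ltxx.
Qed.

Lemma tick_injr T N s k l : 0 < T -> tick T N k < s <= tick T N k.+1 ->
  tick T N l < s <= tick T N l.+1 -> k = l.
Proof.
move=> T0 /andP[a b] /andP[c d].
have [kl|lk|//] := ltngtP k l.
  by have := lt_le_trans c (le_trans b (ler_tick T N _ _ T0 kl)); rewrite ltxx.
by have := lt_le_trans a (le_trans d (ler_tick T N _ _ T0 lk)); rewrite ltxx.
Qed.

Lemma cvg_mesh T : T / n%:R @[n --> \oo] --> (0 : R).
Proof.
rewrite -[X in _ --> X](mulr0 T); apply: cvgM; first exact: cvg_cst.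
by have := @cvgr_idn R; move/gtr0_cvgV0; apply; near do rewrite ltr0n; exists 1%N.
Unshelve. all: by end_near. Qed.

Lemma mesh_small T e : 0 < e -> \forall n \near \oo, T / n%:R < e.
Proof. by move=> e0; exact: (cvgr_lt _ (cvg_mesh T)). Qed.

End ticks.

(* lra fails on terms of the form T / N%:R, which lrat first generalizes. *)
Ltac lrat := repeat match goal with
  | H : context [tick ?T ?N ?k] |- _ =>
    let x := fresh "x" in let E := fresh in
    remember (tick T N k) as x eqn:E in *; clear E
  | H : context [?T / ?n%:R] |- _ =>
    let x := fresh "x" in let E := fresh in
    remember (T / n%:R) as x eqn:E in *; clear E
  end; lra.

(** * Regulated functions *)

Section regulated.
Context {R : realType}.
Implicit Types (T x y e M h t : R) (f g : R -> R) (S : seq R).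

(** The step functions take the value of [f] at right endpoints, so that right-continuity gives
    convergence at every point; the last term handles [T], which lies in no half-open cell. *)
Lemma cadlag_measurable T f : 0 < T -> cadlag T f -> measurable_fun `[0, T] f.
Proof.
move=> T0 [fr _].
pose F N s := \sum_(k < N) f (tick T N k.+1) * \1_`[tick T N k, tick T N k.+1[ s
  + f T * \1_`[T, T] s.
suff key (s : R) : 0 <= s <= T -> F N.+1 s @[N --> \oo] --> f s.
  apply: (@measurable_fun_cvg _ _ _ _ (fun N => F N.+1)) => [N|s]; last first.
    by rewrite /= in_itv/=; exact: key.
  apply: measurable_funD.
    by apply: measurable_sum => k; apply: measurable_funM.
  by apply: measurable_funM => //; apply: measurable_indic; exact: measurable_itv.
move=> /andP[s0 sT].
have F1 N k : (k < N.+1)%N -> tick T N.+1 k <= s < tick T N.+1 k.+1 ->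
    F N.+1 s = f (tick T N.+1 k.+1).
  move=> kN ks; rewrite /F (bigD1 (Ordinal kN))//= big1 ?addr0; last first.
    move=> i ik; rewrite indicE memNset ?mulr0//= in_itv/= => iT.
    move: ik; have := tick_inj _ _ _ _ _ T0 iT ks.
    by move=> ii; apply/negP/negPn/eqP/val_inj.
  rewrite !indicE mem_set/=; last by rewrite in_itv/=.
  rewrite memNset ?mulr1 ?mulr0 ?addr0//= in_itv/= => /andP[Ts _].
  have := tick_le T N.+1 k.+1 T0 kN; case/andP: ks => _; lra.
move: sT; rewrite le_eqVlt => /predU1P[sT|sT].
  rewrite (_ : (fun _ => _) = cst (f s)); first exact: cvg_cst.
  apply/funext => N; rewrite /F big1 ?add0r; last first.
    move=> i _; rewrite indicE memNset ?mulr0//= in_itv/= => /andP[_].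
    by have := tick_le T N.+1 i.+1 T0 (ltn_ord i); rewrite sT; lra.
  by rewrite indicE mem_set ?mulr1 -?sT//= in_itv/= sT lexx.
apply/cvgrPdist_lt => e e0.
have /fr/cvgrPdist_lt/(_ _ e0) : 0 <= s < T by rewrite s0.
rewrite /at_right near_withinE => /nbhs_ballP[r /= r0 rf].
have [N0 _ hN0] := mesh_small T r r0; exists N0 => // N /= N0N.
have hN : T / N.+1%:R < r := hN0 N.+1 (leqW N0N).
have sT' : 0 <= s < T by rewrite s0.
have [k kN kT] := tick_left T N.+1 s T0 isT sT'.
rewrite (F1 _ _ kN kT); apply: rf; last by case/andP: kT.
by move: kT => /andP[a b]; have E := tickS T N.+1 k; rewrite /ball /= ltr0_norm; lrat.
Qed.

(** A class containing both càdlàg paths and simple processes, whose indicators of []a, b]] are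
    left-continuous, and stable under sums and products. Keeping breakpoints out of the whole closed
    interval [[x, y]] makes the condition indifferent to the side of continuity. *)
Record regulated T f : Prop := Regulated {
  regulated_measurable : measurable_fun `[0, T] f ;
  regulated_bounded : exists M, forall x, 0 <= x <= T -> `|f x| <= M ;
  regulated_break : forall e, 0 < e -> exists S, forall x y,
    0 <= x -> x <= y -> y <= T -> (forall p, p \in S -> ~ (x <= p <= y)) ->
    `|f x - f y| <= e }.

Lemma cadlag_regulated T f : 0 < T -> cadlag T f -> regulated T f.
Proof.
move=> T0 cf; split; [exact: cadlag_measurable|exact: cadlag_bounded|].
move=> e e0; have [S fS] := cadlag_break T f e T0 cf e0.
exists S => x y x0 xy yT fr; apply: fS => // p pS /andP[xp py].
by apply: (fr p pS); rewrite py ltW.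
Qed.

Lemma regulated_cst T c : regulated T (fun=> c).
Proof.
split=> //; first by exists `|c|.
by move=> e e0; exists [::] => x y *; rewrite subrr normr0 ltW.
Qed.

Lemma regulated_indic T a b : regulated T (\1_`]a, b]).
Proof.
split; first by apply: measurable_indic; exact: measurable_itv.
  by exists 1 => x _; rewrite indicE; case: (_ \in _); rewrite ?normr1 ?normr0.
move=> e e0; exists [:: a; b] => x y x0 xy yT fr.
rewrite (_ : \1_`]a, b] x = \1_`]a, b] y) ?subrr ?normr0 ?ltW//.
have fa : ~ (x <= a <= y) by apply: fr; rewrite mem_head.
have fb : ~ (x <= b <= y) by apply: fr; rewrite !inE eqxx orbT.
rewrite !indicE !mem_setE !in_itv/=; congr (_ (nat_of_bool _)).
apply/idP/idP => /andP[u v]; apply/andP; split; try lra.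
Qed.

Lemma regulatedD T f g : regulated T f -> regulated T g ->
  regulated T (fun x => f x + g x).
Proof.
move=> [mf [M fM] bf] [mg [M' gM'] bg]; split; first exact: measurable_funD.
  exists (M + M') => x xT; apply: (le_trans (ler_normD _ _)).
  by apply: lerD; [exact: fM|exact: gM'].
move=> e e0; have e20 : 0 < e / 2 by rewrite divr_gt0.
have [S fS] := bf _ e20; have [S' gS] := bg _ e20.
exists (S ++ S') => x y x0 xy yT fr; rewrite opprD addrACA [leRHS]splitr.
apply: (le_trans (ler_normD _ _)); apply: lerD; [apply: fS|apply: gS] => // p pS;
  by apply: fr; rewrite mem_cat pS ?orbT.
Qed.

Lemma regulatedM T f g : regulated T f -> regulated T g ->
  regulated T (fun x => f x * g x).
Proof.
move=> [mf [M fM] bf] [mg [M' gM'] bg]; split; first exact: measurable_funM.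
  exists (M * M') => x xT; rewrite normrM.
  by apply: ler_pM => //; [exact: fM|exact: gM'].
move=> e e0; pose K := `|M| + `|M'| + 1.
have K0 : 0 < K by rewrite ltr_wpDl// addr_ge0.
have e20 : 0 < e / 2 / K by rewrite !divr_gt0.
have [S fS] := bf _ e20; have [S' gS] := bg _ e20.
exists (S ++ S') => x y x0 xy yT fr.
have -> : f x * g x - f y * g y = (f x - f y) * g x + f y * (g x - g y) by ring.
have gx : `|g x| <= K.
  rewrite /K; have := gM' x; rewrite x0 (le_trans xy yT) => /(_ isT).
  by have := ler_norm M'; have := normr_ge0 M; lra.
have fy : `|f y| <= K.
  rewrite /K; have := fM y; rewrite yT (le_trans x0 xy) => /(_ isT).
  by have := ler_norm M; have := normr_ge0 M'; lra.
have -> : e = e / 2 / K * K + K * (e / 2 / K) by field; lra.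
apply: (le_trans (ler_normD _ _)); rewrite !normrM.
apply: lerD; apply: ler_pM => //; [apply: fS|apply: gS] => // p pS;
  by apply: fr; rewrite mem_cat pS ?orbT.
Qed.

Lemma regulated_sum T I (r : seq I) (F : I -> R -> R) :
  (forall i, regulated T (F i)) -> regulated T (fun x => \sum_(i <- r) F i x).
Proof.
move=> rF; elim: r => [|i r IH].
  by under [X in regulated _ X]eq_fun do rewrite big_nil; exact: regulated_cst.
by under [X in regulated _ X]eq_fun do rewrite big_cons; exact: regulatedD.
Qed.

End regulated.

(** * Convergence of Riemann sums *)

Section riemann.
Context {R : realType}.
Implicit Types (T x y e M h t : R) (f g : R -> R) (S : seq R).
Notation mu := (@lebesgue_measure R).

Lemma integrable_itv t g M : measurable_fun `[0, t] g ->
  (forall s, 0 <= s <= t -> `|g s| <= M) -> mu.-integrable `[0, t] (EFin \o g).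
Proof.
move=> mg gM; apply: measurable_bounded_integrable => //.
  by rewrite /= lebesgue_measure_itv/=; case: ifP => //; rewrite ltry.
exists M; split; first exact: num_real.
by move=> M' MM' s /=; rewrite in_itv/= => /gM /le_trans; apply; exact: ltW.
Qed.

Lemma integrable_indic_itv t (A : set R) : measurable A ->
  mu.-integrable `[0, t] (EFin \o (\1_A : R -> R)).
Proof.
move=> mA; apply: (@integrable_itv _ _ 1); first exact: measurable_indic.
by move=> s _; rewrite indicE; case: (_ \in _); rewrite ?normr1 ?normr0.
Qed.

Lemma Rintegral_indic_itv t (A : set R) : measurable A ->
  \int[mu]_(s in `[0, t]) (\1_A s : R) = fine (mu (A `&` `[0, t])).
Proof. by move=> mA; rewrite /Rintegral integral_indic. Qed.

Definition bumps S h s : R := \sum_(p <- S) \1_`[p - h, p + h] s.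

Lemma measurable_bumps D S h : measurable_fun D (bumps S h).
Proof. by apply: measurable_sum => p; exact: measurable_indic. Qed.

Lemma bumps_ge0 S h s : 0 <= bumps S h s.
Proof. by apply: sumr_ge0 => p _; rewrite indicE. Qed.

Lemma bumps_ge1 S h s p : p \in S -> p - h <= s <= p + h -> 1 <= bumps S h s.
Proof.
move=> pS ps; rewrite /bumps (big_rem _ pS)/= indicE mem_set/=; last by rewrite in_itv/=.
by rewrite lerDl sumr_ge0// => q _; rewrite indicE.
Qed.

Lemma bumps_le S h s : bumps S h s <= (size S)%:R.
Proof.
rewrite /bumps; elim: S => [|p S IH]; first by rewrite big_nil.
by rewrite big_cons /= -natr1 addrC lerD// indicE; case: (_ \in _).
Qed.

Lemma integrable_bumps t S h : mu.-integrable `[0, t] (EFin \o bumps S h).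
Proof.
apply: (@integrable_itv _ _ (size S)%:R); first exact: measurable_bumps.
by move=> s _; rewrite ger0_norm ?bumps_ge0 ?bumps_le.
Qed.

Lemma Rintegral_bumps t S h : 0 <= h ->
  \int[mu]_(s in `[0, t]) bumps S h s <= (size S)%:R * (2 * h).
Proof.
move=> h0; elim: S => [|p S IH] /=.
  under eq_Rintegral do rewrite /bumps big_nil.
  by rewrite Rintegral_cst// !mul0r.
have -> : \int[mu]_(s in `[0, t]) bumps (p :: S) h s =
    \int[mu]_(s in `[0, t]) (\1_`[p - h, p + h] s + bumps S h s).
  by apply: eq_Rintegral => s _; rewrite /bumps big_cons.
rewrite RintegralD//; [|exact: integrable_indic_itv|exact: integrable_bumps].
rewrite -natr1 mulrDl mul1r addrC lerD// Rintegral_indic_itv//.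
have mub : mu `[p - h, p + h] = (2 * h)%:E.
  rewrite lebesgue_measure_itv/= lte_fin; case: ltP => ph.
    by rewrite -EFinD; congr EFin; ring.
  by congr EFin; lra.
set A := `[p - h, p + h]%classic in mub *.
have le : (mu (A `&` `[0%R, t]) <= (2 * h)%:E)%E.
  by rewrite -mub; apply: le_measure; rewrite ?inE; [apply: measurableI; exact: measurable_itv|exact: measurable_itv|exact: subIsetl].
rewrite -lee_fin fineK// ge0_fin_numE ?measure_ge0//.
by apply: le_lt_trans le _; rewrite ltry.
Qed.

(* The bumps absorb the breakpoints of a regulated function. *)
Lemma Rintegral_le_bumps t g e C S h : 0 <= t -> 0 <= h -> 0 <= e -> 0 <= C ->
  measurable_fun `[0, t] g ->
  (forall s, 0 <= s <= t -> `|g s| <= e + C * bumps S h s) ->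
  `|\int[mu]_(s in `[0, t]) g s| <= e * t + C * ((size S)%:R * (2 * h)).
Proof.
move=> t0 h0 e0 C0 mg gle.
have ig : mu.-integrable `[0, t] (EFin \o g).
  apply: (@integrable_itv _ _ (e + C * (size S)%:R)) => // s /gle /le_trans; apply.
  by rewrite lerD2l ler_wpM2l// bumps_le.
have iC : mu.-integrable `[0, t] (EFin \o (fun s => C * bumps S h s)).
  apply: (@integrable_itv _ _ (C * (size S)%:R)).
    by apply: measurable_funM => //; exact: measurable_bumps.
  by move=> s _; rewrite normrM !ger0_norm ?bumps_ge0// ler_wpM2l// bumps_le.
have ie : mu.-integrable `[0, t] (EFin \o (fun=> e)).
  by apply: (@integrable_itv _ _ e) => // s _; rewrite ger0_norm.
apply: (le_trans (le_normr_Rintegral _ _)) => //.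
apply: (@le_trans _ _ (\int[mu]_(s in `[0, t]) (e + C * bumps S h s))).
  apply: le_Rintegral => //; first exact: (integrable_norm ig).
  exact: (integrableD _ ie iC).
rewrite RintegralD// RintegralZl//; last exact: integrable_bumps.
apply: lerD; last by rewrite ler_wpM2l// Rintegral_bumps.
rewrite Rintegral_cst//= lebesgue_measure_itv/= lte_fin; case: ltP => t0'.
  by rewrite -EFinD /= subr0.
by rewrite mulr0 mulr_ge0.
Qed.

Lemma regulated_sub T t f : t <= T -> regulated T f -> regulated t f.
Proof.
move=> tT [mf [M fM] bf]; split.
- apply: measurable_funS mf => // s /=; rewrite !in_itv/= => /andP[-> st].
  exact: le_trans tT.
- by exists M => x /andP[x0 xt]; apply: fM; rewrite x0 (le_trans xt).
- move=> e /bf[S fS]; exists S => x y x0 xy yt; apply: fS => //.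
  exact: le_trans tT.
Qed.

Lemma regulated_integrable T f : regulated T f -> mu.-integrable `[0, T] (EFin \o f).
Proof. by move=> [mf [M fM] _]; exact: integrable_itv fM. Qed.

Lemma Rintegral_step t I (r : seq I) (P : pred I) (c a b : I -> R) :
  (forall i, P i -> 0 <= a i /\ a i < b i /\ b i <= t) ->
  \int[mu]_(s in `[0, t]) (\sum_(i <- r | P i) c i * \1_`]a i, b i] s) =
  \sum_(i <- r | P i) c i * (b i - a i).
Proof.
move=> ab; have ic i : mu.-integrable `[0, t] (EFin \o (fun s => c i * \1_`]a i, b i] s)).
  apply: (@integrable_itv _ _ `|c i|).
    by apply: measurable_funM => //; exact: measurable_indic.
  move=> s _; rewrite normrM ler_piMr// indicE.
  by case: (_ \in _); rewrite ?normr1 ?normr0.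
elim: r => [|i r IH].
  under eq_Rintegral do rewrite big_nil.
  by rewrite Rintegral_cst// mul0r big_nil.
rewrite big_cons; under eq_Rintegral do rewrite big_cons.
case: ifPn => // Pi; rewrite -IH RintegralD//; last first.
  have -> : EFin \o (fun s => \sum_(i <- r | P i) c i * \1_`]a i, b i] s) =
      (fun s => \sum_(i <- r | P i) (c i * \1_`]a i, b i] s)%R%:E)%E.
    by apply/funext => s /=; rewrite sumEFin.
  by apply: (@integrable_sum _ _ _ mu _ _ _ r P (fun i s => (c i * \1_`]a i, b i] s)%:E)) => // j _; exact: ic.
congr (_ + _); have [a0 [aib bt]] := ab i Pi.
rewrite RintegralZl//; last exact: integrable_indic_itv.
rewrite Rintegral_indic_itv//.
have -> : `]a i, b i] `&` `[0, t] = `]a i, b i]%classic.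
  apply/setIidl => s /=; rewrite !in_itv/= => /andP[as_ sb].
  by rewrite (le_trans a0 (ltW as_)) (le_trans sb).
by rewrite lebesgue_measure_itv/= lte_fin aib -EFinD.
Qed.

(** The left-point step function [u] is within [e1] of [f] away from the breakpoints, and within
    [2 * M] on their neighbourhoods of radius [h], whose total length tends to 0. *)
Lemma riemann_cvg T f t : 0 < T -> regulated T f -> 0 <= t <= T ->
  \sum_(1 <= j < n.+1 | tick T n j <= t) f (tick T n j.-1) * (T / n%:R)
    @[n --> \oo] --> \int[mu]_(s in `[0, t]) f s.
Proof.
move=> T0 rf /andP[t0 tT].
have [mf [M fM] bf] := rf; have rft := regulated_sub _ _ _ tT rf.
have M0 : 0 <= M.
  by have := fM 0; rewrite lexx ltW// => /(_ isT); exact: le_trans.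
apply/cvgrPdist_le => e e0.
pose e1 := e / 2 / T; have e10 : 0 < e1 by rewrite !divr_gt0.
have [S fS] := bf _ e10.
(* [0] and [t] join the breakpoints because [u] vanishes at [0], its cells being open on the left,
   and on the incomplete cell before [t]. [K] is the cost of all bumps per unit of mesh; dividing by
   [K + 1] below keeps the divisor positive. *)
pose S' := 0 :: t :: S; pose K := 2 * M * ((size S')%:R * 2).
have K0 : 0 <= K by rewrite !mulr_ge0.
have d0 : 0 < e / 2 / (K + 1) by rewrite !divr_gt0// ltr_wpDl.
have [N0 _ hN0] := mesh_small T _ d0.
exists (N0 + 1)%N => // n /= N0n.
have n0 : (0 < n)%N by lia.
have hn : T / n%:R < e / 2 / (K + 1) by apply: hN0 => /=; lia.
set h := T / n%:R in hn *; have h0 : 0 < h by exact: mesh_gt0.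
pose u s := \sum_(1 <= j < n.+1 | tick T n j <= t)
  f (tick T n j.-1) * \1_`]tick T n j.-1, tick T n j] s.
pose r := [seq j <- index_iota 1 n.+1 | tick T n j <= t].
have uE s : u s = \sum_(j <- index_iota 1 n.+1 | (1 <= j)%N && (tick T n j <= t))
  f (tick T n j.-1) * \1_`]tick T n j.-1, tick T n j] s.
  rewrite /u big_seq_cond [RHS]big_seq_cond; apply: eq_bigl => j.
  by rewrite mem_index_iota; case: (1 <= j)%N; rewrite //= ?andbF.
have mu_u : measurable_fun `[0, t] u.
  have -> : u = fun s => \sum_(j <- r) f (tick T n j.-1) * \1_`]tick T n j.-1, tick T n j] s.
    by apply/funext => s; rewrite /u -big_filter.
  apply: measurable_sum => j; apply: measurable_funM => //; exact: measurable_indic.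
have ule s : 0 <= s <= t -> (u s = 0 /\ (s = 0 \/ t <= s + h)) \/ exists2 k, (k < n)%N &
    [/\ tick T n k < s, s <= tick T n k.+1, tick T n k.+1 <= t &
        u s = f (tick T n k)].
  move=> /andP[s0 st]; move: s0; rewrite le_eqVlt => /predU1P[s0|s0].
    left; split; [|by left]; rewrite /u big1_seq// => i _.
    by rewrite indicE memNset ?mulr0//= in_itv/= -s0 ltNge tick_ge0.
  have [|k kn /andP[ks sk]] := tick_right T n s T0 n0; first by rewrite s0 (le_trans st).
  have [kt|tk] := leP (tick T n k.+1) t; [right|left]; last first.
    split; last by right; move: tk; rewrite tickS -/h; lra.
    rewrite /u big1_seq// => j /andP[jt jn].
    rewrite indicE memNset ?mulr0//= in_itv/= => sj.
    move: jn; rewrite mem_index_iota => /andP[j0 _].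
    have jE : j = j.-1.+1 by rewrite prednK.
    have kj : k = j.-1 by apply: (tick_injr T n s) => //; rewrite ?ks// -jE.
    by move: jt; rewrite jE -kj leNgt tk.
  exists k => //; split => //; rewrite /u big_mkcond (bigD1_seq k.+1)/=; last 2 first.
  - by rewrite mem_index_iota; apply/andP.
  - exact: iota_uniq.
  rewrite kt big1_seq ?addr0; last first.
    move=> j /andP[jk jn]; case: ifP => // jt.
    rewrite indicE memNset ?mulr0//= in_itv/= => sj.
    move: jn; rewrite mem_index_iota => /andP[j0 _].
    have jE : j = j.-1.+1 by rewrite prednK.
    have kj : k = j.-1 by apply: (tick_injr T n s) => //; rewrite ?ks// -jE.
    by move: jk; rewrite jE -kj eqxx.
  by rewrite indicE mem_set ?mulr1//= in_itv/= ks.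
have bound s : 0 <= s <= t -> `|f s - u s| <= e1 + 2 * M * bumps S' h s.
  move=> st; have fsM : `|f s| <= M by apply: fM; case/andP: st => -> /le_trans ->.
  have big p : p \in S' -> p - h <= s <= p + h -> `|u s| <= M ->
      `|f s - u s| <= e1 + 2 * M * bumps S' h s.
    move=> pS ps usM; apply: (le_trans (ler_normB _ _)).
    have b1 := bumps_ge1 _ _ _ _ pS ps.
    have : 2 * M <= 2 * M * bumps S' h s by rewrite ler_peMr// mulr_ge0.
    by lra.
  have [[u0 st0]|[k kn [ks sk kt uk]]] := ule s st.
    have uM : `|u s| <= M by rewrite u0 normr0.
    case/andP: st => s0 st; case: st0 => [s0E|ths].
      by apply: (big 0) => //; [exact: mem_head|lra].
    by apply: (big t) => //; [by rewrite !inE eqxx orbT|lra].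
  have kT : 0 <= tick T n k <= T by rewrite tick_itv// ltnW.
  have uM : `|u s| <= M by rewrite uk fM.
  have [[p pS /andP[kp ps]]|nS] := pselect (exists2 p, p \in S & tick T n k <= p <= s).
    apply: (big p) => //; first by rewrite !inE pS !orbT.
    by move: sk; rewrite tickS -/h; lra.
  rewrite uk distrC; apply: (@le_trans _ _ e1).
    apply: fS => //; [by case/andP: kT|exact: ltW|by case/andP: st => _ /le_trans->|].
    by move=> p pS ps; apply: nS; exists p.
  by rewrite lerDl !mulr_ge0// bumps_ge0.
have mfu : measurable_fun `[0, t] (fun s => f s - u s).
  by apply: measurable_funB => //; exact: regulated_measurable rft.
have iu : mu.-integrable `[0, t] (EFin \o u).
  apply: (@integrable_itv _ _ M) => // s st.
  have [[-> _]|[k kn [_ _ _ ->]]] := ule s st; first by rewrite normr0.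
  by apply: fM; rewrite tick_itv// ltnW.
have -> : \sum_(1 <= j < n.+1 | tick T n j <= t) f (tick T n j.-1) * h =
    \int[mu]_(s in `[0, t]) u s.
  under eq_Rintegral do rewrite uE.
  rewrite Rintegral_step => [|j /andP[j1 jt]]; last first.
    by rewrite tick_ge0// jt ltr_tick// prednK.
  rewrite big_seq_cond [RHS]big_seq_cond; apply: eq_big => j.
    by rewrite mem_index_iota; case: (1 <= j)%N; rewrite //= ?andbF.
  move=> /andP[+ _]; rewrite mem_index_iota => /andP[j1 _].
  have -> : tick T n j = tick T n j.-1 + h by rewrite -tickS prednK.
  by rewrite addrAC subrr add0r.
rewrite -RintegralB//; last exact: regulated_integrable.
have b := Rintegral_le_bumps _ _ _ _ _ _ t0 (ltW h0) (ltW e10) _ mfu bound.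
apply: (le_trans (b _)); first by rewrite mulr_ge0.
rewrite [leRHS]splitr; apply: lerD.
  have <- : e1 * T = e / 2 by rewrite /e1 divfK// gt_eqF.
  by rewrite ler_wpM2l// ltW.
have -> : 2 * M * ((size S')%:R * (2 * h)) = K * h by rewrite /K; ring.
apply: (@le_trans _ _ ((K + 1) * h)); first by rewrite ler_wpM2r ?ltW// ltrDl.
by rewrite mulrC -ler_pdivlMr ?ltW// ltr_wpDl.
Qed.

End riemann.

(** * Comparison of a fine and a coarse grid *)

Section two_grids.
Context {R : realType}.
Implicit Types (T x y e M h t : R) (f g : R -> R) (S : seq R).
Notation mu := (@lebesgue_measure R).

Lemma ler_tick2 T K N k l : 0 < T -> (0 < K)%N -> (0 < N)%N ->
  (tick T K l <= tick T N k) = (l * N <= k * K)%N.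
Proof.
move=> T0 K0 N0; rewrite /tick !mulrA ler_pdivrMr ?ltr0n// mulrAC.
rewrite ler_pdivlMr ?ltr0n// -[_ * T * _]mulrA -[_ * T * _]mulrA ![T * _]mulrC !mulrA.
by rewrite ler_pM2r// -!natrM ler_nat.
Qed.

Lemma tickM T n m j : (0 < m)%N -> tick T (n * m) (j * m) = tick T n j.
Proof.
move=> m0; rewrite /tick !natrM invfM mulrACA mulrA mulrAC mulrACA.
case: n => [|n]; first by rewrite invr0 !(mulr0, mul0r).
have : (m%:R : R) != 0 by rewrite pnatr_eq0 -lt0n.
have : (n.+1%:R : R) != 0 by rewrite pnatr_eq0.
by move=> *; field; apply/andP.
Qed.

(* The index on the grid of mesh T / K of the last point before tick T N k. *)
Definition coarse K N k := (k * K %/ N)%N.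

Lemma coarse_le T K N k : 0 < T -> (0 < K)%N -> (0 < N)%N ->
  tick T K (coarse K N k) <= tick T N k.
Proof. by move=> *; rewrite ler_tick2// leq_trunc_div. Qed.

Lemma coarse_lt K N k : (0 < K)%N -> (k < N)%N -> (coarse K N k < K)%N.
Proof.
move=> K0 kN; rewrite ltn_divLR ?(leq_ltn_trans _ kN)// mulnC.
by rewrite ltn_pmul2l.
Qed.

Definition straddle T K N p k := tick T K (coarse K N k) < p <= tick T N k.

(** Let [k0] be the first such index. Any other such [k] has its coarse point before
    [p <= tick T N k0], so it exceeds [k0] by less than one coarse cell, that is by at most
    [N %/ K]. *)
Lemma count_straddle T K N p : 0 < T -> (0 < K)%N ->
  (\sum_(k < N) straddle T K N p k <= (N %/ K).+1)%N.
Proof.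
move=> T0 K0; pose b := straddle T K N p.
rewrite -(big_mkord xpredT (fun k => b k : nat)).
rewrite -big_mkcond sum1_count -size_filter.
set s := [seq _ <- _ | _].
have [->//|] := eqVneq s [::].
rewrite -size_eq0 -lt0n -has_predT => /hasP[k ks _].
have ex : exists k, b k && (k < N)%N.
  by exists k; move: ks; rewrite mem_filter mem_index_iota.
case: (ex_minnP ex) => k0 /andP[/andP[_ pk0] k0N] k0min.
rewrite -(size_iota k0 (N %/ K).+1); apply: (@uniq_leq_size _ s (iota k0 (N %/ K).+1)).
  by rewrite filter_uniq// iota_uniq.
move=> j; rewrite mem_filter mem_index_iota => /andP[bj jN'].
have {jN'} jN : (j < N)%N := jN'.
have k0j : (k0 <= j)%N by apply: k0min; apply/andP.
have N0 : (0 < N)%N by apply: leq_ltn_trans jN.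
rewrite mem_iota k0j addnS ltnS -leq_subLR leq_divRL// mulnBl.
have /andP[tp _] := bj.
have : ~~ (tick T N k0 <= tick T K (coarse K N j)).
  by rewrite -ltNge (lt_le_trans tp).
rewrite ler_tick2// -ltnNge => lt1.
have lt2 : (j * K < (coarse K N j).+1 * N)%N by rewrite -ltn_divLR.
move: lt1 lt2; rewrite mulSn leq_subLR; move: (_ * N)%N (j * K)%N (k0 * K)%N => x y z.
clear; lia.
Qed.

(** Squared L2 distance, discretized with mesh [T / N], between [f] and [f] frozen on the grid of
    mesh [T / K]. By the isometry for discrete transforms, its mean is the cost of freezing an
    integrand. *)
Definition grid_gap T f K N := (T / N%:R) *
  \sum_(k < N) (f (tick T N k) - f (tick T K (coarse K N k))) ^+ 2.

(** [K0] does not depend on [N]: a breakpoint spoils at most [(N %/ K).+1], hence at most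
    [2 * N / K], of the [N] terms, a proportion governed by [K] alone. *)
Lemma grid_gap_cvg T f e : 0 < T -> cadlag T f -> 0 < e ->
  exists K0, forall K N, (K0 < K)%N -> (K <= N)%N -> grid_gap T f K N <= e.
Proof.
move=> T0 cf e0; have [M fM] := cadlag_bounded T f T0 cf.
have M0 : 0 <= M.
  by have := fM 0; rewrite lexx ltW// => /(_ isT); exact: le_trans.
(* The minimum with 1 ensures [e1 ^+ 2 <= e1]. *)
pose e1 := Num.min 1 (e / 2 / T).
have e10 : 0 < e1 by rewrite lt_min ltr01 !divr_gt0.
have e1e : e1 ^+ 2 * T <= e / 2.
  rewrite -ler_pdivlMr// (@le_trans _ _ e1)//; last by rewrite ge_min lexx orbT.
  by rewrite expr2 ler_piMr ?(ltW e10)// ge_min lexx.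
have [S fS] := cadlag_break T f e1 T0 cf e10.
pose C := 4 * M ^+ 2 * (size S)%:R * 2.
have C0 : 0 <= C by rewrite !mulr_ge0// exprn_ge0.
have d0 : 0 < e / 2 / (C + 1) by rewrite !divr_gt0// ltr_wpDl.
have [K0 _ hK0] := mesh_small T _ d0.
exists K0 => K N KK KN.
have Kp : (0 < K)%N by exact: leq_ltn_trans KK.
have Np : (0 < N)%N by exact: leq_trans KN.
have hK : T / K%:R < e / 2 / (C + 1) by apply: hK0; exact: ltnW.
have term (k : 'I_N) : (f (tick T N k) - f (tick T K (coarse K N k))) ^+ 2 <=
    e1 ^+ 2 + 4 * M ^+ 2 *
      \sum_(p <- S) (straddle T K N p k)%:R.
  have kT := tick_itv T N k T0 (ltnW (ltn_ord k)).
  have lT := tick_itv T K _ T0 (ltnW (coarse_lt K N k Kp (ltn_ord k))).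
  have lk := coarse_le T K N k T0 Kp Np.
  rewrite -real_normK ?num_real//.
  have [[p pS pk]|nS] := pselect (exists2 p, p \in S &
      tick T K (coarse K N k) < p <= tick T N k).
    have le2 : `|f (tick T N k) - f (tick T K (coarse K N k))| <= 2 * M.
      apply: (le_trans (ler_normB _ _)).
      by rewrite mulrDl mul1r lerD// fM.
    have : `|f (tick T N k) - f (tick T K (coarse K N k))| ^+ 2 <= (2 * M) ^+ 2.
      by rewrite lerXn2r// nnegrE// mulr_ge0.
    move=> /le_trans; apply; rewrite exprMn -natrX.
    rewrite (@le_trans _ _ (4 * M ^+ 2 * 1))// ?mulr1// -[leLHS]add0r.
    apply: lerD; first by rewrite exprn_ge0// ltW.
    rewrite -{1}[4 * _]mulr1 ler_wpM2l//; first by rewrite mulr_ge0// exprn_ge0.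
    by rewrite (big_rem _ pS)/= /straddle pk lerDl sumr_ge0.
  have : `|f (tick T N k) - f (tick T K (coarse K N k))| <= e1.
    rewrite distrC; apply: fS => //.
    - by case/andP: lT.
    - by case/andP: kT.
    - by move=> p pS pk; apply: nS; exists p.
  rewrite -(ler_pXn2r (ltn0Sn 1)) ?nnegrE ?(ltW e10)// => /le_trans; apply.
  by rewrite lerDl !mulr_ge0 ?exprn_ge0// sumr_ge0.
rewrite /grid_gap.
have : \sum_(k < N) (f (tick T N k) - f (tick T K (coarse K N k))) ^+ 2 <=
    e1 ^+ 2 * N%:R + 4 * M ^+ 2 * ((size S)%:R * (2 * N%:R / K%:R)).
  apply: (le_trans (ler_sum _ (fun k _ => term k))).
  rewrite big_split/= sumr_const card_ord -[_ ^+ 2 *+ N]mulr_natr lerD2l -mulr_sumr.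
  rewrite ler_wpM2l//; first by rewrite mulr_ge0// exprn_ge0.
  have -> : (size S)%:R * (2 * N%:R / K%:R) = \sum_(p <- S) (2 * N%:R / K%:R) :> R.
    by rewrite big_const_seq count_predT iter_addr addr0 mulr_natl.
  rewrite exchange_big/=; apply: ler_sum => p _; rewrite -natr_sum.
  apply: (@le_trans _ _ (N %/ K).+1%:R); first by rewrite ler_nat count_straddle.
  rewrite ler_pdivlMr ?ltr0n// -!natrM ler_nat mulSn.
  by have := leq_trunc_div N K; move: KN; clear; lia.
move=> le1; apply: (le_trans (ler_wpM2l (mesh_ge0 T N T0) le1)).
have Nn0 : (N%:R : R) != 0 by rewrite pnatr_eq0 -lt0n.
have Kn0 : (K%:R : R) != 0 by rewrite pnatr_eq0 -lt0n.
have -> : T / N%:R * (e1 ^+ 2 * N%:R + 4 * M ^+ 2 * ((size S)%:R * (2 * N%:R / K%:R)))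
    = e1 ^+ 2 * T + C * (T / K%:R) by rewrite /C; field; apply/andP.
rewrite [leRHS]splitr; apply: lerD => //.
apply: (@le_trans _ _ ((C + 1) * (T / K%:R))); first by rewrite ler_wpM2r ?mesh_ge0// lerDl.
by rewrite mulrC -ler_pdivlMr ?ltW// ltr_wpDl.
Qed.

(** Fitted to simple processes on a grid. Their left-open cells leave the value 0 at time 0, which
    becomes a breakpoint; the agreement with [f] is only eventual because their coefficients are
    clipped at a level that grows with [N]. *)
Lemma cadlag_step_L2 T f (u : nat -> R -> R) t : 0 < T -> cadlag T f -> 0 <= t <= T ->
  (forall N, measurable_fun `[0, t] (u N)) ->
  (\forall N \near \oo, forall s k, (k < N)%N -> tick T N k < s <= tick T N k.+1 ->
     u N s = f (tick T N k)) ->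
  (forall N, u N 0 = 0) ->
  \int[mu]_(s in `[0, t]) (u N s - f s) ^+ 2 @[N --> \oo] --> (0 : R).
Proof.
move=> T0 cf /andP[t0 tT] mu_u uE u0; have [M fM] := cadlag_bounded T f T0 cf.
have M0 : 0 <= M.
  by have := fM 0; rewrite lexx ltW// => /(_ isT); exact: le_trans.
apply/cvgrPdist_le => e e0.
pose e1 := Num.min 1 (e / 2 / T).
have e10 : 0 < e1 by rewrite lt_min ltr01 !divr_gt0.
have e1e : e1 ^+ 2 * T <= e / 2.
  rewrite -ler_pdivlMr// (@le_trans _ _ e1)//; last by rewrite ge_min lexx orbT.
  by rewrite expr2 ler_piMr ?(ltW e10)// ge_min lexx.
have [S fS] := cadlag_break T f e1 T0 cf e10.
pose C := 4 * M ^+ 2 * ((size (0 :: S))%:R * 2).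
have C0 : 0 <= C by rewrite !mulr_ge0// exprn_ge0.
have d0 : 0 < e / 2 / (C + 1) by rewrite !divr_gt0// ltr_wpDl.
near=> N.
have hN : T / N%:R < e / 2 / (C + 1) by near: N; exact: mesh_small.
have Np : (0 < N)%N by near: N; exists 1%N.
have uN : forall s k, (k < N)%N -> tick T N k < s <= tick T N k.+1 ->
     u N s = f (tick T N k) by near: N.
have mf : measurable_fun `[0, t] f.
  apply: regulated_measurable; apply: (regulated_sub _ _ _ tT).
  exact: cadlag_regulated.
have h0 := mesh_ge0 T N T0.
have bound s : 0 <= s <= t ->
   `|(u N s - f s) ^+ 2| <= e1 ^+ 2 + 4 * M ^+ 2 * bumps (0 :: S) (T / N%:R) s.
  move=> /andP[s0 st]; rewrite normrX.
  have sT : s <= T by exact: le_trans tT.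
  have fs : `|f s| <= M by apply: fM; rewrite s0.
  have big p : p \in 0 :: S -> p - T / N%:R <= s <= p + T / N%:R -> `|u N s| <= M ->
      `|u N s - f s| ^+ 2 <= e1 ^+ 2 + 4 * M ^+ 2 * bumps (0 :: S) (T / N%:R) s.
    move=> pS ps us; apply: (@le_trans _ _ ((2 * M) ^+ 2)).
      rewrite lerXn2r ?nnegrE ?mulr_ge0//.
      by apply: (le_trans (ler_normB _ _)); rewrite mulrDl mul1r lerD.
    rewrite exprMn -natrX -[leLHS]add0r lerD// ?exprn_ge0 ?(ltW e10)//.
    rewrite -{1}[4 * _]mulr1 ler_wpM2l//; first by rewrite mulr_ge0// exprn_ge0.
    exact: bumps_ge1 pS ps.
  move: s0; rewrite le_eqVlt => /predU1P[s0|s0].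
    apply: (big 0); rewrite ?mem_head// -s0 ?u0 ?normr0// sub0r add0r.
    by rewrite oppr_le0 h0.
  have [|k kN /[dup] ks /andP[ks1 ks2]] := tick_right T N s T0 Np; first by rewrite s0.
  have kT := tick_itv T N k T0 (ltnW kN).
  rewrite (uN _ _ kN ks) in big *.
  have [[p pS /andP[pk1 pk2]]|nS] := pselect (exists2 p, p \in S & tick T N k < p <= s).
    apply: (big p); rewrite ?inE ?pS ?orbT ?fM//.
    by move: ks2; rewrite tickS => ks2; lrat.
  have : `|f (tick T N k) - f s| <= e1.
    apply: fS; [by case/andP: kT|exact: ltW|by []|].
    by move=> p pS pk; apply: nS; exists p.
  rewrite -(ler_pXn2r (ltn0Sn 1)) ?nnegrE ?(ltW e10)// => /le_trans; apply.
  by rewrite lerDl !mulr_ge0 ?exprn_ge0// bumps_ge0.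
rewrite sub0r normrN.
apply: (le_trans (Rintegral_le_bumps _ _ _ _ _ _ t0 h0 _ _ _ bound)).
- by rewrite exprn_ge0// ltW.
- by rewrite mulr_ge0// exprn_ge0.
- apply: measurable_funX; exact: measurable_funB.
rewrite [leRHS]splitr; apply: lerD.
  by apply: le_trans e1e; rewrite ler_wpM2l// exprn_ge0// ltW.
have -> : 4 * M ^+ 2 * ((size (0 :: S))%:R * (2 * (T / N%:R))) = C * (T / N%:R).
  by rewrite /C !mulrA.
apply: (@le_trans _ _ ((C + 1) * (T / N%:R))); first by rewrite ler_wpM2r// lerDl.
by rewrite mulrC -ler_pdivlMr ?ltW// ltr_wpDl.
Unshelve. all: by end_near. Qed.

End two_grids.

(** * Gaussian moments and martingale transforms *)

Section density.
Import HBNNSimple.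
Context {d : measure_display} {X : measurableType d} {R : realType}.
Local Open Scope ereal_scope.
Variables (mu nu : {measure set X -> \bar R}) (g : X -> R).
Hypotheses (mg : measurable_fun setT g) (g0 : forall x, (0 <= g x)%R).
Hypothesis nuE : forall A, measurable A -> nu A = \int[mu]_(x in A) (g x)%:E.

(** Simple functions, then monotone convergence on both sides. It turns integrals against
    [normal_prob] into Lebesgue integrals. *)
Lemma ge0_integral_density (f : X -> \bar R) : measurable_fun setT f ->
  (forall x, 0 <= f x) -> \int[nu]_x f x = \int[mu]_x (f x * (g x)%:E).
Proof.
move=> mf f0; pose h := nnsfun_approx measurableT mf.
have mgE : measurable_fun setT (EFin \o g) by exact/measurable_EFinP.
have -> : \int[nu]_x f x = lim (\int[nu]_x (EFin \o h n) x @[n --> \oo]).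
  have fE x : setT x -> f x = lim ((EFin \o h n) x @[n --> \oo]).
    by move=> Ex; apply/esym/cvg_lim => //; exact: cvg_nnsfun_approx.
  under eq_integral => x /[!inE] /fE -> //.
  apply: monotone_convergence => //.
  - by move=> n; exact/measurable_EFinP.
  - by move=> n x Ex //=; rewrite lee_fin.
  - by move=> x Ex a b ab; rewrite lee_fin; exact/lefP/nd_nnsfun_approx.
have -> : \int[mu]_x (f x * (g x)%:E) =
    lim (\int[mu]_x ((EFin \o h n) x * (g x)%:E) @[n --> \oo]).
  have fg x : setT x -> f x * (g x)%:E = lim ((EFin \o h n) x * (g x)%:E @[n --> \oo]).
    by move=> Ex; apply/esym/cvg_lim => //; apply: cvgeZr => //;
      exact: cvg_nnsfun_approx.
  under eq_integral => x /[!inE] /fg -> //.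
  apply: monotone_convergence => [//| | |].
  - by move=> n; apply/emeasurable_funM => //; exact/measurable_EFinP.
  - by move=> n x Ex /=; rewrite mule_ge0 ?lee_fin.
  - move=> x Ex a b ab/=; rewrite lee_wpmul2r ?lee_fin//.
    exact/lefP/nd_nnsfun_approx.
suff suf n : \int[mu]_x ((EFin \o h n) x * (g x)%:E) = \int[nu]_x (EFin \o h n) x.
  by apply: congr_lim; apply/funext => n; rewrite -suf.
transitivity (\int[nu]_x
   (\sum_(y \in range (h n)) (y * \1_(h n @^-1` [set y]) x)%:E)); last first.
  by apply: eq_integral => t tE; rewrite /= fimfunE -fsumEFin.
have indich m r : measurable_fun setT (fun x => (r * \1_(h m @^-1` [set r]) x)%:E).
  by apply: (measurable_comp measurableT) => //; exact: measurable_funM.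
rewrite ge0_integral_fsum//; last by move=> m y Ey; exact: nnfun_muleindic_ge0.
transitivity (\int[mu]_x (\sum_(y \in range (h n))
    (y * \1_(h n @^-1` [set y]) x)%:E * (g x)%:E)).
  under [RHS]eq_integral => x xE.
    rewrite -ge0_mule_fsuml => [|y]; last exact: nnfun_muleindic_ge0.
    rewrite fsumEFin // -(fimfunE _ x); over.
  by [].
rewrite ge0_integral_fsum//; last 2 first.
  - by move=> y; exact: emeasurable_funM.
  - by move=> m y Ey; rewrite mule_ge0 ?(nnfun_muleindic_ge0 (h n))// lee_fin.
apply: eq_fsbigr => r /[!inE] rhn.
rewrite integralZl_indic_nnsfun//= integral_indic// setIT.
under eq_integral do rewrite EFinM -muleA.
have r0 : (0 <= r)%R by case: rhn => x _ <-; exact: fun_ge0.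
rewrite ge0_integralZl//; last 2 first.
  - by apply: emeasurable_funM => //; exact/measurable_EFinP/measurable_indic.
  - by move=> x _; rewrite mule_ge0// lee_fin// indicE.
congr (_ * _); rewrite nuE// [RHS]integral_mkcond.
apply: eq_integral => x _; rewrite patchE indicE.
by case: ifPn => _; rewrite ?mul1e ?mul0e.
Qed.

End density.

Section gaussian.
Context {R : realType}.
Notation mu := (@lebesgue_measure R).
Implicit Types (c s : R).

Lemma expR_tangent (y z : R) : expR z * (1 + (y - z)) <= expR y.
Proof. by rewrite -[y in leRHS](subrKC z) expRD ler_wpM2l ?expR_ge0// expR_ge1Dx. Qed.

(** Completing the square: the exponential times the centred density is a constant times the density
    with mean [c * s ^+ 2]. *)
Lemma normal_mgf c s : s != 0 ->
  (\int[normal_prob 0 s]_x (expR (c * x))%:E = (expR (c ^+ 2 * s ^+ 2 / 2))%:E)%E.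
Proof.
move=> s0.
rewrite (@ge0_integral_density _ _ _ mu (normal_prob 0 s) (normal_pdf 0 s) (measurable_normal_pdf 0 s)
  (normal_pdf_ge0 0 s) (fun A _ => erefl)); last 2 first.
- apply/measurable_EFinP/measurableT_comp => //; exact: measurable_funM.
- by move=> x; rewrite lee_fin expR_ge0.
have s20 : s ^+ 2 != 0 by rewrite expf_neq0.
transitivity (\int[mu]_x ((expR (c ^+ 2 * s ^+ 2 / 2))%:E * (normal_pdf (c * s ^+ 2) s x)%:E))%E.
  apply: eq_integral => x _; rewrite -!EFinM; congr EFin.
  rewrite /normal_pdf (negbTE s0) /normal_fun mulrCA [RHS]mulrCA; congr (_ * _).
  by rewrite -!expRD; congr expR; field.
rewrite integralZl//; last exact: integrable_normal_pdf.
by rewrite integral_normal_pdf mule1.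
Qed.

End gaussian.

Definition integrableRV {d} {Omega : measurableType d} {R : realType}
  (P : probability Omega R) (X : Omega -> R) := P.-integrable setT (EFin \o X).

(** Real-valued, so informative only next to integrability; hence the many statements that pair
    [integrableRV] with a value of [Ex]. *)
Definition Ex {d} {Omega : measurableType d} {R : realType}
  (P : probability Omega R) (X : Omega -> R) : R := \int[P]_w X w.

(** * Expectation and independence *)

Section expectation.
Context {d : measure_display} {Omega : measurableType d} {R : realType}.
Variable P : probability Omega R.
Implicit Types (X Y : Omega -> R) (c M : R).
Notation L1 := (integrableRV P).
Notation E := (Ex P).

Lemma L1_measurable X : L1 X -> measurable_fun setT X.
Proof. by move=> iX; exact/measurable_EFinP/(measurable_int P). Qed.

Lemma L1_le X Y : measurable_fun setT X -> (forall w, `|X w| <= Y w) -> L1 Y -> L1 X.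
Proof.
move=> mX XY; apply: le_integrable => //; first exact/measurable_EFinP.
by move=> w _ /=; rewrite lee_fin (le_trans (XY w))// ler_norm.
Qed.

Lemma L1_cst c : L1 (fun=> c).
Proof.
apply: measurable_bounded_integrable => //.
  by apply: (le_lt_trans (probability_le1 P measurableT)); rewrite ltry.
by exists `|c|; split; [exact: num_real|move=> M cM w _ /=; exact: ltW].
Qed.

Lemma L1_bounded X M : measurable_fun setT X -> (forall w, `|X w| <= M) -> L1 X.
Proof. by move=> mX XM; apply: (L1_le _ _ mX XM); exact: L1_cst. Qed.

Lemma L1D X Y : L1 X -> L1 Y -> L1 (fun w => X w + Y w).
Proof. by move=> iX iY; exact: (integrableD _ iX iY). Qed.

Lemma L1B X Y : L1 X -> L1 Y -> L1 (fun w => X w - Y w).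
Proof. by move=> iX iY; exact: (integrableB _ iX iY). Qed.

Lemma L1Z c X : L1 X -> L1 (fun w => c * X w).
Proof. by move=> iX; exact: (integrableZl _ _ iX). Qed.

Lemma L1Mb c X Y : measurable_fun setT X -> (forall w, `|X w| <= c) -> L1 Y ->
  L1 (fun w => X w * Y w).
Proof.
move=> mX Xc iY; apply: (L1_le _ (fun w => c * `|Y w|)).
- by apply: measurable_funM => //; exact: L1_measurable.
- by move=> w; rewrite normrM ler_wpM2r.
- by apply: L1Z; exact: (integrable_norm iY).
Qed.

Lemma L1_sum I (r : seq I) (Q : pred I) (F : I -> Omega -> R) :
  (forall i, Q i -> L1 (F i)) -> L1 (fun w => \sum_(i <- r | Q i) F i w).
Proof.
move=> iF; elim: r => [|i r IH].
  by under [X in L1 X]eq_fun do rewrite big_nil; exact: L1_cst.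
under [X in L1 X]eq_fun do rewrite big_cons.
case Qi : (Q i) => //; apply: L1D => //; exact: iF.
Qed.

Lemma ExD X Y : L1 X -> L1 Y -> E (fun w => X w + Y w) = E X + E Y.
Proof. by move=> iX iY; rewrite /Ex RintegralD. Qed.

Lemma ExB X Y : L1 X -> L1 Y -> E (fun w => X w - Y w) = E X - E Y.
Proof. by move=> iX iY; rewrite /Ex RintegralB. Qed.

Lemma ExZ c X : L1 X -> E (fun w => c * X w) = c * E X.
Proof. by move=> iX; rewrite /Ex RintegralZl. Qed.

Lemma Ex_cst c : E (fun=> c) = c.
Proof.
rewrite /Ex Rintegral_cst// -[RHS]mulr1; congr (_ * _).
by rewrite [X in fine X]probability_setT.
Qed.

Lemma Ex_ge0 X : (forall w, 0 <= X w) -> 0 <= E X.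
Proof. by move=> X0; exact: Rintegral_ge0. Qed.

Lemma Ex_le X Y : L1 X -> L1 Y -> (forall w, X w <= Y w) -> E X <= E Y.
Proof. by move=> iX iY XY; apply: le_Rintegral. Qed.

Lemma Ex_sum I (r : seq I) (Q : pred I) (F : I -> Omega -> R) :
  (forall i, Q i -> L1 (F i)) ->
  E (fun w => \sum_(i <- r | Q i) F i w) = \sum_(i <- r | Q i) E (F i).
Proof.
move=> iF; elim: r => [|i r IH].
  by under [X in E X]eq_fun do rewrite big_nil; rewrite Ex_cst big_nil.
under [X in E X]eq_fun do rewrite big_cons.
rewrite big_cons -IH; case Qi : (Q i) => //; rewrite ExD//; first exact: iF.
exact: L1_sum.
Qed.

Lemma ExE X : L1 X -> (E X)%:E = (\int[P]_w (X w)%:E)%E.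
Proof. by move=> iX; rewrite /Ex /Rintegral fineK//; exact: integrable_fin_num. Qed.

Lemma Ex_indic (A : set Omega) : measurable A -> (E \1_A)%:E = P A.
Proof.
move=> mA; rewrite ExE ?integral_indic ?setIT//.
by apply: (L1_bounded _ 1); [exact: measurable_indic|move=> w; rewrite indicE;
  case: (_ \in _); rewrite ?normr1 ?normr0].
Qed.

Lemma measurable_set_ge X a : measurable_fun setT X -> measurable [set w | a <= X w].
Proof.
move=> mX; have := mX measurableT `[a, +oo[%classic (measurable_itv _).
by rewrite setTI; congr measurable; apply/seteqP; split=> w /=; rewrite in_itv/= andbT.
Qed.

Lemma measurable_set_gt X a : measurable_fun setT X -> measurable [set w | a < X w].
Proof.
move=> mX; have := mX measurableT `]a, +oo[%classic (measurable_itv _).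
by rewrite setTI; congr measurable; apply/seteqP; split=> w /=; rewrite in_itv/= andbT.
Qed.

Lemma markov_Ex X a : L1 X -> (forall w, 0 <= X w) -> 0 < a ->
  (P [set w | (a <= X w)%R] <= (E X / a)%:E)%E.
Proof.
move=> iX X0 a0; have mX := L1_measurable _ iX.
have mA := measurable_set_ge _ a mX.
rewrite -Ex_indic// lee_fin ler_pdivlMr// mulrC -ExZ; last first.
  by apply: (L1_bounded _ 1); [exact: measurable_indic|move=> w; rewrite indicE;
    case: (_ \in _); rewrite ?normr1 ?normr0].
apply: Ex_le => //.
  by apply/L1Z/(L1_bounded _ 1); [exact: measurable_indic|move=> w; rewrite indicE;
    case: (_ \in _); rewrite ?normr1 ?normr0].
move=> w; rewrite indicE; have [|] := boolP (w \in _).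
  by rewrite inE /= mulr1.
by rewrite mulr0.
Qed.

Definition indep X Y := forall A B : set R, measurable A -> measurable B ->
  P (X @^-1` A `&` Y @^-1` B) = (P (X @^-1` A) * P (Y @^-1` B))%E.

(** Independence identifies the law of the pair with the product of the laws; Tonelli then gives
    integrability and Fubini the value. Applied with [X] measurable with respect to the past, it
    takes the place of conditional expectations. *)
Lemma indep_Ex X Y : indep X Y -> L1 X -> L1 Y ->
  L1 (fun w => X w * Y w) /\ E (fun w => X w * Y w) = E X * E Y.
Proof.
move=> XY iX iY.
have mX := L1_measurable _ iX; have mY := L1_measurable _ iY.
pose X' : {mfun Omega >-> R} := HB.pack X (isMeasurableFun.Build _ _ _ _ X mX).
pose Y' : {mfun Omega >-> R} := HB.pack Y (isMeasurableFun.Build _ _ _ _ Y mY).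
pose Z w := (X w, Y w).
have mZ : measurable_fun setT Z by exact: measurable_fun_pair.
pose Z' : {mfun Omega >-> (R * R)%type} :=
  HB.pack Z (isMeasurableFun.Build _ _ _ _ Z mZ).
pose m1 := distribution P X'; pose m2 := distribution P Y'.
have prodE (A : set (R * R)) : measurable A -> (m1 \x m2)%E A = distribution P Z' A.
  by apply: product_measure_unique => B C mB mC; exact: XY.
pose f (z : R * R) : R := z.1 * z.2.
have mf : measurable_fun setT f by exact: measurable_funM.
have iX1 : m1.-integrable setT (EFin \o (fun x : R => x)).
  apply: integrable_pushforward => //; exact/measurable_EFinP.
have iY1 : m2.-integrable setT (EFin \o (fun x : R => x)).
  apply: integrable_pushforward => //; exact/measurable_EFinP.
have EX : (\int[m1]_x (x%:E))%E = (E X)%:E.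
  by rewrite ExE// integral_pushforward//; exact/measurable_EFinP.
have EY : (\int[m2]_x (x%:E))%E = (E Y)%:E.
  by rewrite ExE// integral_pushforward//; exact/measurable_EFinP.
have mabs : measurable_fun [set: R] (fun x : R => `|x%:E|%E).
  by apply: measurableT_comp.
have ifprod : (m1 \x m2)%E.-integrable setT (EFin \o f).
  apply/integrable12ltyP; first exact/measurable_EFinP.
  have -> : (\int[m1]_x \int[m2]_y `|(EFin \o f) (x, y)| =
     \int[m1]_x (`|x|%:E * (\int[m2]_y `|y%:E|)))%E.
    apply: eq_integral => x _; rewrite -ge0_integralZl//.
    by apply: eq_integral => y _; rewrite /= /f/= normrM.
  have /integrableP[_ Yfin] := iY1.
  have [y0 y00 y0E] : exists2 y0 : R, 0 <= y0 & (\int[m2]_y `|y%:E|)%E = y0%:E.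
    exists (fine (\int[m2]_y `|y%:E|)%E); first by rewrite fine_ge0 ?integral_ge0.
    by rewrite fineK// ge0_fin_numE ?integral_ge0.
  rewrite y0E ge0_integralZr//.
  have /integrableP[_ Xfin] := iX1.
  by apply: lte_mul_pinfty; rewrite ?ltry ?ge0_fin_numE ?integral_ge0.
have iZ : (distribution P Z').-integrable setT (EFin \o f).
  apply/integrableP; split; first exact/measurable_EFinP.
  rewrite (eq_measure_integral (m1 \x m2)%E); last by move=> A mA _; exact/esym/prodE.
  by have /integrableP[] := ifprod.
have iXY : L1 (fun w => X w * Y w).
  apply/integrableP; split; first exact/measurable_EFinP/measurable_funM.
  have /integrableP[_] := iZ.
  by rewrite ge0_integral_pushforward//; apply: measurableT_comp => //; exact/measurable_EFinP.
split=> //; apply: EFin_inj; rewrite ExE// EFinM -EX -EY.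
have -> : (\int[P]_w (X w * Y w)%:E = \int[distribution P Z']_z (EFin \o f) z)%E.
  by rewrite integral_pushforward//; exact/measurable_EFinP.
rewrite (eq_measure_integral (m1 \x m2)%E); last by move=> A mA _; exact/esym/prodE.
rewrite -integral12_prod_meas1// /fubini_F EY.
rewrite -integralZr//; apply: eq_integral => x _.
by rewrite -EY -integralZl//; apply: eq_integral => y _; rewrite /f /= EFinM.
Qed.

End expectation.

(** * Exponential bounds for powers *)

Section exp_bounds.
Context {R : realType}.
Implicit Types x u : R.

Lemma normr_le_expR x : `|x| <= expR `|x|.
Proof. by apply: le_trans (expR_ge1Dx _); rewrite lerDr. Qed.

Lemma expR_norm_le x : expR `|x| <= expR x + expR (- x).
Proof.
by case: (ger0P x) => _; rewrite ?lerDl ?lerDr expR_ge0.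
Qed.

Lemma sqr_le_expR x : x ^+ 2 <= expR (2 * x) + expR (- 2 * x).
Proof.
rewrite -real_normK ?num_real// mulNr; apply: le_trans (expR_norm_le _).
rewrite normrM (ger0_norm (ler0n _ 2)) expRM_natl.
by rewrite lerXn2r ?nnegrE ?expR_ge0// normr_le_expR.
Qed.

Lemma pow4_le_expR x : x ^+ 4 <= expR (4 * x) + expR (- 4 * x).
Proof.
rewrite (_ : x ^+ 4 = `|x| ^+ 4); last by rewrite -normrX ger0_norm// exprn_even_ge0.
rewrite mulNr; apply: le_trans (expR_norm_le _).
rewrite normrM (ger0_norm (ler0n _ 4)) expRM_natl.
by rewrite lerXn2r ?nnegrE ?expR_ge0// normr_le_expR.
Qed.

Lemma ler_sqr_ge0 (a b : R) : 0 <= a -> a <= b -> a ^+ 2 <= b ^+ 2.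
Proof. by move=> a0 ab; rewrite lerXn2r ?nnegrE// (le_trans a0). Qed.

(* 2 (cosh (c x) - 1) is c^2 x^2 up to an error of order c^3. *)
Lemma cosh_approx (c x : R) : 0 < c <= 1 ->
  `|expR (c * x) + expR (- c * x) - 2 - c ^+ 2 * x ^+ 2| <=
     c ^+ 3 * (expR (4 * x) + expR (- 4 * x)).
Proof.
move=> /andP[c0 c1]; set y := c * `|x|.
have -> : c ^+ 2 * x ^+ 2 = y ^+ 2 by rewrite -[x ^+ 2]real_normK ?num_real// -exprMn.
have -> : expR (c * x) + expR (- c * x) = expR y + expR (- y).
  by rewrite /y mulNr; case: (ger0P x) => _; rewrite ?mulrN ?opprK 1?addrC// addrC.
have y0 : 0 <= y by rewrite mulr_ge0// ltW.
(* This form is squeezed by [y <= expR y - 1 <= y * expR y]. *)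
have -> : expR y + expR (- y) - 2 = expR (- y) * (expR y - 1) ^+ 2.
  have e1 : expR (- y) * expR y = 1 by rewrite -expRD addNr expR0.
  have -> : expR (- y) * (expR y - 1) ^+ 2 = (expR (- y) * expR y) * expR y
    - 2 * (expR (- y) * expR y) + expR (- y) by ring.
  by rewrite e1; ring.
have ey0 : 0 <= expR y - 1 by rewrite subr_ge0 -expR0 ler_expR.
have up : expR (- y) * (expR y - 1) ^+ 2 <= y ^+ 2 * expR y.
  have : expR y - 1 <= y * expR y.
    have := expR_tangent (0 : R) y; rewrite expR0; lra.
  move=> /ler_sqr_ge0 -/(_ ey0) /(ler_wpM2l (expR_ge0 (- y))) /le_trans; apply.
  have -> : expR (- y) * (y * expR y) ^+ 2 = y ^+ 2 * expR y * (expR (- y) * expR y).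
    by ring.
  by rewrite -expRD addNr expR0 mulr1.
have lo : y ^+ 2 * (1 - y) <= expR (- y) * (expR y - 1) ^+ 2.
  have : y <= expR y - 1 by have := expR_ge1Dx y; lra.
  move=> /ler_sqr_ge0 -/(_ y0) /(ler_wpM2l (expR_ge0 (- y))); apply: le_trans.
  by rewrite mulrC ler_wpM2r ?sqr_ge0// expR_ge1Dx.
have e1 : expR y - 1 <= y * expR y.
  have := expR_tangent (0 : R) y; rewrite expR0; lra.
have ey1 : 1 <= expR y by rewrite -expR0 ler_expR.
(* Of the four factors exp |x| that make up exp(4 |x|), three dominate |x|^3 and the last one
   dominates [expR y], since [c <= 1]. *)
have y3 : y ^+ 3 * expR y <= c ^+ 3 * (expR (4 * x) + expR (- 4 * x)).
  rewrite /y exprMn -mulrA ler_wpM2l ?exprn_ge0 ?(ltW c0)// mulNr.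
  apply: le_trans (expR_norm_le _); rewrite normrM (ger0_norm (ler0n _ 4)).
  rewrite (_ : 4 * `|x| = 3%:R * `|x| + `|x|); last by ring.
  rewrite expRD; apply: ler_pM; rewrite ?exprn_ge0 ?expR_ge0//.
    by rewrite expRM_natl lerXn2r ?nnegrE ?expR_ge0// normr_le_expR.
  by rewrite ler_expR ler_piMl.
apply: (le_trans _ y3); rewrite ler_norml; apply/andP; split.
  suff : y ^+ 3 <= y ^+ 3 * expR y by rewrite !exprS expr0 mulr1 in lo *; nra.
  by rewrite ler_peMr// exprn_ge0.
rewrite lerBlDr; apply: (le_trans up).
suff : y ^+ 2 * (expR y - 1) <= y ^+ 3 * expR y by lra.
by rewrite (exprSr y 2) -mulrA ler_wpM2l// sqr_ge0.
Qed.

Lemma expR_sub1 u : 0 <= u -> 0 <= expR u - 1 <= u * expR u.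
Proof.
move=> u0; rewrite subr_ge0 -{1}expR0 ler_expR u0 /=.
by have := expR_tangent (0 : R) u; rewrite expR0; lra.
Qed.

(** Stands for letting [c] tend to 0 when moments are read off from expansions of the moment
    generating function. *)
Lemma le0_small (a K : R) : (forall c, 0 < c <= 1 -> a <= c * K) -> a <= 0.
Proof.
move=> h; rewrite leNgt; apply/negP => a0.
have K0 : 0 < K by have := h 1; rewrite ltr01 lexx mul1r => /(_ isT); exact: lt_le_trans.
pose c := Num.min 1 (a / 2 / K).
have c0 : 0 < c by rewrite lt_min ltr01 !divr_gt0.
have := h c; rewrite c0 /= ge_min lexx => /(_ isT).
have : c * K <= a / 2 by rewrite -ler_pdivlMr// ge_min lexx orbT.
lra.
Qed.

End exp_bounds.

(** * Moments read off from the moment generating function *)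

Section gaussian_moments.
Context {d : measure_display} {Omega : measurableType d} {R : realType}.
Variable P : probability Omega R.
Variables (xi : Omega -> R) (v : R).
Hypotheses (mxi : measurable_fun setT xi) (v0 : 0 < v).
Hypothesis law : forall B : set R, measurable B ->
  P (xi @^-1` B) = normal_prob 0 (Num.sqrt v) B.
Notation L1 := (integrableRV P).
Notation E := (Ex P).

Lemma gauss_mgf c : L1 (fun w => expR (c * xi w)) /\
  E (fun w => expR (c * xi w)) = expR (c ^+ 2 * v / 2).
Proof.
pose xi' : {mfun Omega >-> measurableTypeR R} :=
  HB.pack (xi : Omega -> measurableTypeR R)
    (isMeasurableFun.Build _ _ Omega (measurableTypeR R) xi mxi).
have mf : measurable_fun setT (fun x : R => (expR (c * x))%:E).
  by apply/measurable_EFinP/measurableT_comp => //; exact: measurable_funM.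
have I : (\int[P]_w (expR (c * xi w))%:E = (expR (c ^+ 2 * v / 2))%:E)%E.
  rewrite -(ge0_integral_distribution xi' mf); last by move=> y; rewrite lee_fin expR_ge0.
  transitivity (\int[normal_prob 0 (Num.sqrt v)]_x (expR (c * x))%:E)%E.
    by apply: eq_measure_integral => A mA _; exact: law.
  by rewrite normal_mgf ?sqr_sqrtr// ?ltW// gt_eqF// sqrtr_gt0.
have iX : L1 (fun w => expR (c * xi w)).
  apply/integrableP; split.
    by apply/measurable_EFinP/measurableT_comp => //; exact: measurable_funM.
  under eq_integral do rewrite /= ger0_norm ?expR_ge0//.
  by rewrite [X in (X < _)%E]I ltry.
by split => //; apply: EFin_inj; rewrite ExE.
Qed.


Lemma gauss_cosh c : L1 (fun w => expR (c * xi w) + expR (- c * xi w)) /\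
  E (fun w => expR (c * xi w) + expR (- c * xi w)) = 2 * expR (c ^+ 2 * v / 2).
Proof.
have [i1 e1] := gauss_mgf c; have [i2 e2] := gauss_mgf (- c).
split; first exact: L1D.
by rewrite ExD// e1 e2 sqrrN; ring.
Qed.

Lemma gauss_L2 : L1 (fun w => xi w ^+ 2).
Proof.
apply: (L1_le _ _ _ _ _ (gauss_cosh 2).1); first exact: measurable_funX.
by move=> w; rewrite ger0_norm ?sqr_ge0// sqr_le_expR.
Qed.

Lemma gauss_L1 : L1 xi.
Proof.
apply: (L1_le _ _ _ mxi _ (gauss_cosh 1).1) => w.
by rewrite mul1r mulN1r (le_trans (normr_le_expR _))// expR_norm_le.
Qed.

Lemma gauss_L4 : L1 (fun w => xi w ^+ 4).
Proof.
apply: (L1_le _ _ _ _ _ (gauss_cosh 4).1); first exact: measurable_funX.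
by move=> w; rewrite ger0_norm ?exprn_even_ge0// pow4_le_expR.
Qed.

(** Rescaling to unit variance; [8] is [4 ^+ 2 / 2], the exponent of the standard moment generating
    function at 4. Only the order [v ^+ 2] matters, so the exact constant 3 is not computed. *)
Lemma gauss_4 : E (fun w => xi w ^+ 4) <= 2 * expR 8 * v ^+ 2.
Proof.
pose c := (Num.sqrt v)^-1.
have c2 : c ^+ 2 * v = 1.
  by rewrite /c exprVn sqr_sqrtr ?ltW// mulVf// gt_eqF.
have [i e] := gauss_cosh (4 * c).
have : E (fun w => c ^+ 4 * xi w ^+ 4) <= 2 * expR 8.
  have <- : 2 * expR ((4 * c) ^+ 2 * v / 2) = 2 * expR 8 :> R.
    have -> : (4 * c) ^+ 2 * v / 2 = 8 * (c ^+ 2 * v) by clearbody c; field.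
    by rewrite c2 mulr1.
  rewrite -e; apply: Ex_le => //; first exact/L1Z/gauss_L4.
  by move=> w; rewrite -exprMn (le_trans (pow4_le_expR _))// !mulNr !mulrA.
rewrite ExZ; last exact: gauss_L4.
have c4 : c ^+ 4 * v ^+ 2 = 1 by rewrite (exprM c 2 2) -exprMn c2 expr1n.
have v2 : 0 <= v ^+ 2 by rewrite sqr_ge0.
move/(ler_wpM2r v2); rewrite mulrAC c4 mul1r; exact.
Qed.

(** For a sign [s], the mean of [c * s * xi] is at most that of [expR (c * s * xi) - 1], which is of
    order [c ^+ 2]; division by [c] leaves [s * E xi <= 0] for both signs. *)
Lemma gauss_1 : E xi = 0.
Proof.
have key s : s ^+ 2 = 1 -> s * E xi <= 0.
  move=> s2; apply: (@le0_small _ _ (v / 2 * expR (v / 2))) => c /andP[c0 c1].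
  have [i e] := gauss_mgf (c * s).
  have : E (fun w => c * s * xi w) <= E (fun w => expR (c * s * xi w) - 1).
    apply: Ex_le; [exact/L1Z/gauss_L1|by apply: L1B => //; exact: L1_cst|].
    by move=> w; have := expR_ge1Dx (c * s * xi w); lra.
  rewrite ExB ?Ex_cst//; last exact: L1_cst.
  rewrite ExZ ?e; last exact: gauss_L1.
  rewrite exprMn s2 mulr1.
  have u0 : 0 <= c ^+ 2 * v / 2 by rewrite !mulr_ge0 ?exprn_ge0 ?invr_ge0// ltW.
  have /andP[_ h] := expR_sub1 _ u0.
  have h2 : c ^+ 2 * v / 2 * expR (c ^+ 2 * v / 2) <= c * (c * (v / 2 * expR (v / 2))).
    have -> : c * (c * (v / 2 * expR (v / 2))) = c ^+ 2 * v / 2 * expR (v / 2) by ring.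
    rewrite ler_wpM2l// ler_expR -mulrA -[leRHS]mul1r ler_wpM2r ?divr_ge0 ?(ltW v0)//.
    by rewrite expr_le1// ltW.
  move=> h3; have : c * (s * E xi) <= c * (c * (v / 2 * expR (v / 2))).
    by rewrite mulrA; lra.
  by rewrite ler_pM2l.
have a := key 1 (expr1n _ _); have b := key (-1) (sqrr_sign _ 1).
by apply/eqP; rewrite eq_le; lra.
Qed.

(** Two expansions of the mean of [expR (c * xi) + expR (- c * xi) - 2] up to order [c ^+ 3] are
    compared: [cosh_approx] yields the coefficient [m] of [c ^+ 2], the explicit formula yields
    [v]. *)
Lemma gauss_2 : E (fun w => xi w ^+ 2) = v.
Proof.
set m := E _.
pose K1 := 2 * expR (4 ^+ 2 * v / 2) + v ^+ 2 * expR (v / 2) : R.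
suff h : `|m - v| <= 0 by apply/eqP; rewrite -subr_eq0 -normr_le0.
apply: (@le0_small _ _ K1) => c /andP[c0 c1].
have [i e] := gauss_cosh c; have [i4 e4] := gauss_cosh 4.
have iL : L1 (fun w => expR (c * xi w) + expR (- c * xi w) - 2 - c ^+ 2 * xi w ^+ 2).
  by apply: L1B; [apply: L1B => //; exact: L1_cst|exact/L1Z/gauss_L2].
have EL : E (fun w => expR (c * xi w) + expR (- c * xi w) - 2 - c ^+ 2 * xi w ^+ 2)
    = 2 * expR (c ^+ 2 * v / 2) - 2 - c ^+ 2 * m.
  rewrite ExB; [|by apply: L1B => //; exact: L1_cst|exact/L1Z/gauss_L2].
  by rewrite ExB ?Ex_cst ?e ?ExZ//; [exact: gauss_L2|exact: L1_cst].
have c01 : 0 < c <= 1 by rewrite c0.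
have up : 2 * expR (c ^+ 2 * v / 2) - 2 - c ^+ 2 * m <= c ^+ 3 * (2 * expR (4 ^+ 2 * v / 2)).
  rewrite -EL -e4 -ExZ//; apply: Ex_le => //; first exact: L1Z.
  by move=> w; apply: le_trans (cosh_approx _ _ c01); exact: ler_norm.
have lo : - (c ^+ 3 * (2 * expR (4 ^+ 2 * v / 2))) <= 2 * expR (c ^+ 2 * v / 2) - 2 - c ^+ 2 * m.
  rewrite -EL -e4 -mulNr -ExZ//; apply: Ex_le => //; first exact: L1Z.
  move=> w; rewrite mulNr lerNl; apply: le_trans (cosh_approx _ _ c01).
  by rewrite -normrN ler_norm.
set u := c ^+ 2 * v / 2 in up lo.
have u0 : 0 <= u by rewrite !mulr_ge0 ?exprn_ge0 ?invr_ge0// ltW.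
have /andP[h0 h1] := expR_sub1 _ u0.
have h2 : u <= expR u - 1 by have := expR_ge1Dx u; lra.
have uv : u <= v / 2.
  rewrite /u -mulrA -[leRHS]mul1r ler_wpM2r ?divr_ge0 ?(ltW v0)//.
  by rewrite expr_le1// ltW.
have h3 : expR u - 1 - u <= u ^+ 2 * expR (v / 2).
  have : u * (expR u - 1) <= u * (u * expR u) by rewrite ler_wpM2l.
  have : u * (u * expR u) <= u ^+ 2 * expR (v / 2).
    by rewrite mulrA -expr2 ler_wpM2l ?sqr_ge0// ler_expR.
  lra.
have h4 : u ^+ 2 * expR (v / 2) <= c ^+ 3 * (v ^+ 2 * expR (v / 2)) / 2.
  have -> : c ^+ 3 * (v ^+ 2 * expR (v / 2)) / 2 = c ^+ 3 * v ^+ 2 / 2 * expR (v / 2) by ring.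
  rewrite ler_wpM2r ?expR_ge0// /u.
  have : c ^+ 3 * v ^+ 2 * c <= c ^+ 3 * v ^+ 2 * 1.
    by rewrite ler_wpM2l// mulr_ge0 ?sqr_ge0// exprn_ge0 ?ltW.
  have : 0 <= c ^+ 3 * v ^+ 2 by rewrite mulr_ge0 ?sqr_ge0// exprn_ge0 ?ltW.
  by lra.
suff : c ^+ 2 * `|m - v| <= c ^+ 2 * (c * K1) by rewrite ler_pM2l// exprn_gt0.
rewrite -[c ^+ 2 in leLHS]ger0_norm ?sqr_ge0// -normrM ler_norml.
have -> : c ^+ 2 * (c * K1) = c ^+ 3 * (2 * expR (4 ^+ 2 * v / 2)) +
   c ^+ 3 * (v ^+ 2 * expR (v / 2)) by rewrite /K1; ring.
have -> : c ^+ 2 * (m - v) = c ^+ 2 * m - 2 * u by rewrite /u; field.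
have : 0 <= c ^+ 3 * (v ^+ 2 * expR (v / 2)).
  by apply: mulr_ge0; [apply: exprn_ge0; exact: ltW|rewrite mulr_ge0 ?expR_ge0 ?sqr_ge0].
lra.
Qed.

End gaussian_moments.

Section measurable_wrt.
Context {d : measure_display} {Omega : measurableType d} {R : realType}.
Implicit Types (G : set (set Omega)) (U V : Omega -> R).

(** Gives access to the closure properties of measurable functions, on the space equipped with
    [G]. *)
Lemma mwrtP G U : sigma_algebra setT G ->
  measurable_wrt G U <->
  measurable_fun (T := g_sigma_algebraType G) setT (U : g_sigma_algebraType G -> R).
Proof.
move=> sG; have GE := sigma_algebra_id sG; split.
  by move=> h _ B mB; rewrite setTI; apply: sub_sigma_algebra; exact: h.
by move=> h B mB; rewrite -GE -[X in <<s _ >> X]setTI; exact: h.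
Qed.

Lemma mwrt_mono G G' U : G `<=` G' -> measurable_wrt G U -> measurable_wrt G' U.
Proof. by move=> GG h B mB; exact/GG/h. Qed.

Lemma mwrt_measurable G U : G `<=` measurable -> measurable_wrt G U ->
  measurable_fun setT U.
Proof. by move=> Gm h _ B mB; rewrite setTI; exact/Gm/h. Qed.

Lemma mwrt_comp G U (f : R -> R) : measurable_fun setT f ->
  measurable_wrt G U -> measurable_wrt G (fun w => f (U w)).
Proof.
move=> mf h B mB; rewrite (_ : _ @^-1` B = U @^-1` (f @^-1` B))//.
by apply: h; rewrite -[X in measurable X]setTI; exact: mf.
Qed.

Lemma mwrt_cst G c : sigma_algebra setT G -> measurable_wrt G (fun=> c : R).
Proof. by move=> sG; apply/(mwrtP _ _ sG); exact: measurable_cst. Qed.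

Lemma mwrtD G U V : sigma_algebra setT G -> measurable_wrt G U ->
  measurable_wrt G V -> measurable_wrt G (fun w => U w + V w).
Proof.
move=> sG /(mwrtP _ _ sG) hU /(mwrtP _ _ sG) hV; apply/(mwrtP _ _ sG).
exact: measurable_funD.
Qed.

Lemma mwrtB G U V : sigma_algebra setT G -> measurable_wrt G U ->
  measurable_wrt G V -> measurable_wrt G (fun w => U w - V w).
Proof.
move=> sG /(mwrtP _ _ sG) hU /(mwrtP _ _ sG) hV; apply/(mwrtP _ _ sG).
exact: measurable_funB.
Qed.

Lemma mwrtM G U V : sigma_algebra setT G -> measurable_wrt G U ->
  measurable_wrt G V -> measurable_wrt G (fun w => U w * V w).
Proof.
move=> sG /(mwrtP _ _ sG) hU /(mwrtP _ _ sG) hV; apply/(mwrtP _ _ sG).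
exact: measurable_funM.
Qed.

End measurable_wrt.

Lemma le_of_eq {R : numDomainType} (x y : R) : x = y -> x <= y.
Proof. by move->. Qed.

(** * Discrete martingale transforms *)

Section transforms.
Context {d : measure_display} {Omega : measurableType d} {R : realType}.
Variable P : probability Omega R.
Notation L1 := (integrableRV P).
Notation E := (Ex P).

Record discrete_filtration n (G : nat -> set (set Omega)) : Prop := DiscreteFiltration {
  dfilt_sigma : forall k, (k <= n)%N -> sigma_algebra setT (G k) ;
  dfilt_sub : forall k, (k <= n)%N -> G k `<=` measurable ;
  dfilt_mono : forall k, (k < n)%N -> G k `<=` G k.+1 }.

Record innovations n (G : nat -> set (set Omega)) (xi : nat -> Omega -> R) : Prop :=
  Innovations {
  innov_wrt : forall k, (k < n)%N -> measurable_wrt (G k.+1) (xi k) ;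
  innov_indep : forall k, (k < n)%N -> forall A B, G k A -> measurable B ->
    P (A `&` xi k @^-1` B) = (P A * P (xi k @^-1` B))%E }.

Variables (n : nat) (G : nat -> set (set Omega)) (xi b : nat -> Omega -> R).
Hypotheses (fG : discrete_filtration n G) (ixi : innovations n G xi).
Variable (v : R).

Let S m w := \sum_(k < m) b k w * xi k w.

Hypothesis hb : forall k, (k < n)%N -> measurable_wrt (G k) (b k).

Lemma transform_wrt m : (m <= n)%N ->
  measurable_wrt (G m) (fun w => \sum_(k < m) b k w * xi k w).
Proof.
elim: m => [|m IH] mn.
  by under [X in measurable_wrt _ X]eq_fun do rewrite big_ord0;
    apply: mwrt_cst; exact: dfilt_sigma fG _ mn.
under [X in measurable_wrt _ X]eq_fun do rewrite big_ord_recr.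
have sG := dfilt_sigma _ _ fG _ mn; have GG := dfilt_mono _ _ fG _ mn.
apply: mwrtD => //; first by apply: mwrt_mono GG _; exact/IH/ltnW.
by apply: mwrtM => //; [apply: mwrt_mono GG _; exact: hb|exact: innov_wrt ixi _ mn].
Qed.

Lemma indep_innov k Z (f : R -> R) : (k < n)%N -> measurable_wrt (G k) Z ->
  measurable_fun setT f -> indep P Z (fun w => f (xi k w)).
Proof.
move=> kn hZ mf A B mA mB.
rewrite (_ : (fun w => f (xi k w)) @^-1` B = xi k @^-1` (f @^-1` B))//.
apply: (innov_indep _ _ _ ixi _ kn); first exact: hZ.
by rewrite -[X in measurable X]setTI; exact: mf.
Qed.

Let mS m : (m <= n)%N -> measurable_fun setT (S m).
Proof. by move=> mn; apply: mwrt_measurable (transform_wrt _ mn); exact: dfilt_sub fG _ mn. Qed.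

(** In the square of the sum, the cross term has mean zero, since [b m * S m] belongs to the past of
    the centred [xi m]. The bound [M] serves integrability and does not enter the estimate, which
    must become small with the [b k]. *)
Lemma transform_L2 M : (forall k w, (k < n)%N -> `|b k w| <= M) ->
  (forall k, (k < n)%N -> L1 (xi k) /\ E (xi k) = 0) ->
  (forall k, (k < n)%N -> L1 (fun w => xi k w ^+ 2) /\ E (fun w => xi k w ^+ 2) <= v) ->
  forall m, (m <= n)%N -> L1 (fun w => (\sum_(k < m) b k w * xi k w) ^+ 2) /\
    E (fun w => (\sum_(k < m) b k w * xi k w) ^+ 2) <=
      v * \sum_(k < m) E (fun w => b k w ^+ 2).
Proof.
move=> bM h1 h2; elim=> [|m IH] mn.
  have -> : (fun w => (\sum_(k < 0) b k w * xi k w) ^+ 2) = (fun=> 0).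
    by apply/funext => w; rewrite big_ord0 expr0n.
  by rewrite big_ord0 mulr0; split; [exact: L1_cst|rewrite Ex_cst].
have [iS2 eS2] := IH (ltnW mn).
have mb : measurable_fun setT (b m).
  by apply: mwrt_measurable (hb _ mn); exact: dfilt_sub fG _ (ltnW mn).
have iS : L1 (S m).
  apply: (L1_le _ _ (fun w => 1 + S m w ^+ 2)); first exact/mS/ltnW.
    move=> w; rewrite -[S m w ^+ 2]real_normK ?num_real//.
    by have := sqr_ge0 (`|S m w| - 1); have := normr_ge0 (S m w); nra.
  by apply: L1D => //; exact: L1_cst.
have wbS : measurable_wrt (G m) (fun w => b m w * S m w).
  apply: mwrtM; [exact: dfilt_sigma fG _ (ltnW mn)|exact: hb|].
  exact/transform_wrt/ltnW.
have ibS : L1 (fun w => b m w * S m w) by apply: (L1Mb _ M) => // w; exact: bM.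
have [i1 e1] := h1 m mn; have [i2 e2] := h2 m mn.
have [ix ex] : L1 (fun w => b m w * S m w * xi m w) /\
    E (fun w => b m w * S m w * xi m w) = E (fun w => b m w * S m w) * E (xi m).
  by apply: indep_Ex => //; exact: (indep_innov m _ id).
have b2 w : `|b m w ^+ 2| <= M ^+ 2.
  by rewrite normrX lerXn2r ?nnegrE ?(le_trans _ (bM m w mn))// bM.
have ib2 : L1 (fun w => b m w ^+ 2).
  by apply: (L1_bounded _ _ (M ^+ 2)) => //; exact: measurable_funX.
have [iy ey] : L1 (fun w => b m w ^+ 2 * xi m w ^+ 2) /\
    E (fun w => b m w ^+ 2 * xi m w ^+ 2) = E (fun w => b m w ^+ 2) * E (fun w => xi m w ^+ 2).
  apply: indep_Ex => //; apply: (indep_innov m _ (fun x => x ^+ 2)) => //.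
  by apply: (mwrt_comp _ _ (fun x => x ^+ 2)) => //; exact: hb.
have -> : (fun w => (\sum_(k < m.+1) b k w * xi k w) ^+ 2) =
   (fun w => S m w ^+ 2 + 2 * (b m w * S m w * xi m w) + b m w ^+ 2 * xi m w ^+ 2).
  by apply/funext => w; rewrite big_ord_recr /= -/(S m w); ring.
have ix2 := L1Z P 2 _ ix.
split; first by apply: L1D => //; apply: L1D.
rewrite ExD//; last exact: L1D.
rewrite ExD// ExZ// ex e1 ey big_ord_recr /= !mulr0 addr0 mulrDr lerD//.
by rewrite mulrC ler_wpM2r// Ex_ge0// => w; exact: sqr_ge0.
Qed.

(** The coefficient [b m] is random, so the moment generating function of [xi m] cannot be evaluated
    at it. With [b m = (2 * l - 1) * M m] and [l] in [[0, 1]], convexity bounds the exponential by a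
    mixture of exponentials with deterministic slopes; the mixing weights belong to the past, and
    independence applies. *)
Lemma transform_exp (M : nat -> R) (th : R) :
  (forall k w, (k < n)%N -> `|b k w| <= M k) ->
  (forall k c, (k < n)%N -> L1 (fun w => expR (c * xi k w)) /\
     E (fun w => expR (c * xi k w)) = expR (c ^+ 2 * v / 2)) ->
  forall m, (m <= n)%N -> L1 (fun w => expR (th * \sum_(k < m) b k w * xi k w)) /\
    E (fun w => expR (th * \sum_(k < m) b k w * xi k w)) <=
      expR (th ^+ 2 * v / 2 * \sum_(k < m) M k ^+ 2).
Proof.
move=> bM hx; elim=> [|m IH] mn.
  have -> : (fun w => expR (th * \sum_(k < 0) b k w * xi k w)) = (fun=> 1).
    by apply/funext => w; rewrite big_ord0 mulr0 expR0.
  by rewrite big_ord0 mulr0 expR0; split; [exact: L1_cst|rewrite Ex_cst].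
have [iZ eZ] := IH (ltnW mn).
set Z := fun w => expR (th * \sum_(k < m) b k w * xi k w) in iZ eZ.
have mb : measurable_fun setT (b m).
  by apply: mwrt_measurable (hb _ mn); exact: dfilt_sub fG _ (ltnW mn).
have sG := dfilt_sigma _ _ fG _ (ltnW mn).
(* If [M m = 0], the quotient is 0 by convention and [b m] vanishes too, so [lb] below remains
   true. *)
pose l w := (1 + b m w / M m) / 2.
have M0 : 0 <= M m by exact: (le_trans (normr_ge0 _) (bM m point mn)).
have bM1 w : `|b m w / M m| <= 1.
  rewrite normrM normfV (ger0_norm M0).
  have [->|Mn0] := eqVneq (M m) 0; first by rewrite invr0 mulr0.
  by rewrite ler_pdivrMr ?lt_def ?Mn0 ?mul1r// bM.
have l01 w : 0 <= l w <= 1 by have := bM1 w; rewrite /l ler_norml; move: (b m w / M m) => z; lra.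
have lb w : (2 * l w - 1) * M m = b m w.
  rewrite /l mulrCA divff// mulr1 addrAC subrr add0r.
  have [E0|Mn0] := eqVneq (M m) 0; last by rewrite divfK.
  by apply/esym/eqP; rewrite E0 mulr0 -normr_le0 -E0 bM.
(* Both tangent inequalities are taken at the barycentre [th * (b m w * x)], so that their linear
   terms cancel in the mixture. *)
have cvx w x : expR (th * (b m w * x)) <=
    l w * expR (th * M m * x) + (1 - l w) * expR (- (th * M m) * x).
  have /andP[l0 l1] := l01 w.
  have t1 := expR_tangent (th * M m * x) (th * (b m w * x)).
  have t2 := expR_tangent (- (th * M m) * x) (th * (b m w * x)).
  have h1 := ler_wpM2l l0 t1.
  have l1' : 0 <= 1 - l w by rewrite subr_ge0.
  have h2 := ler_wpM2l l1' t2.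
  apply: le_trans (lerD h1 h2); rewrite -lb.
  by apply: le_of_eq; ring.
have wZ : measurable_wrt (G m) Z.
  apply: (mwrt_comp _ _ (fun x => expR (th * x))).
    by apply: measurableT_comp => //; exact: measurable_funM.
  exact/transform_wrt/ltnW.
have wl : measurable_wrt (G m) l.
  apply: (mwrt_comp _ _ (fun x => (1 + x / M m) / 2)); last exact: hb.
  by apply: measurable_funM => //; apply: measurable_funD => //; exact: measurable_funM.
have w1l : measurable_wrt (G m) (fun w => 1 - l w).
  by apply: mwrtB => //; exact: mwrt_cst.
have G2m : G m `<=` measurable by exact: dfilt_sub fG _ (ltnW mn).
have Zl : L1 (fun w => l w * Z w).
  apply: (L1Mb _ 1) => //; first exact: mwrt_measurable wl.
  by move=> w; have /andP[? ?] := l01 w; rewrite ger0_norm.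
have Z1l : L1 (fun w => (1 - l w) * Z w).
  apply: (L1Mb _ 1) => //; first exact: mwrt_measurable w1l.
  by move=> w; have /andP[? ?] := l01 w; rewrite ger0_norm; lra.
have [i1 e1] := hx m (th * M m) mn; have [i2 e2] := hx m (- (th * M m)) mn.
have mexp c : measurable_fun setT (fun x : R => expR (c * x)).
  by apply: measurableT_comp => //; exact: measurable_funM.
have [j1 f1] := indep_Ex P _ _ (indep_innov m _ _ mn (mwrtM _ _ _ sG wl wZ) (mexp (th * M m))) Zl i1.
have [j2 f2] := indep_Ex P _ _ (indep_innov m _ _ mn (mwrtM _ _ _ sG w1l wZ) (mexp (- (th * M m)))) Z1l i2.
have j12 := L1D P _ _ j1 j2.
have le w : expR (th * \sum_(k < m.+1) b k w * xi k w) <=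
    l w * Z w * expR (th * M m * xi m w) + (1 - l w) * Z w * expR (- (th * M m) * xi m w).
  rewrite big_ord_recr /= mulrDr expRD -/(Z w).
  have := ler_wpM2l (expR_ge0 (th * \sum_(k < m) b k w * xi k w)) (cvx w (xi m w)).
  by move/le_trans; apply; apply: le_of_eq; rewrite -/(Z w); ring.
have iT : L1 (fun w => expR (th * \sum_(k < m.+1) b k w * xi k w)).
  apply: (L1_le _ _ _ _ _ j12); last by move=> w; rewrite ger0_norm ?expR_ge0.
  by apply: (measurableT_comp (mexp th)); exact: (mS m.+1).
split=> //; apply: (le_trans (Ex_le P _ _ iT j12 le)).
rewrite ExD// f1 f2 e1 e2 sqrrN -mulrDl -ExD//.
have -> : (fun w => l w * Z w + (1 - l w) * Z w) = Z by apply/funext => w; ring.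
rewrite big_ord_recr /= mulrDr expRD; apply: ler_pM; rewrite ?expR_ge0//.
- by apply: Ex_ge0 => w; exact: expR_ge0.
- by rewrite ler_expR exprMn; apply: le_of_eq; ring.
Qed.

(** Chernoff's bound for the sum and its opposite, at the optimal [th = lam / V]. The separate [V]
    keeps the divisor positive even if all [M k] vanish. *)
Lemma transform_tail (M : nat -> R) (lam V : R) :
  (forall k w, (k < n)%N -> `|b k w| <= M k) ->
  (forall k c, (k < n)%N -> L1 (fun w => expR (c * xi k w)) /\
     E (fun w => expR (c * xi k w)) = expR (c ^+ 2 * v / 2)) ->
  0 < lam -> 0 < V -> v * \sum_(k < n) M k ^+ 2 <= V ->
  (P [set w | (lam <= `|\sum_(k < n) b k w * xi k w|)%R] <=
    (2 * expR (- (lam ^+ 2 / (2 * V))))%:E)%E.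
Proof.
move=> bM hx lam0 V0 vV.
have one th : 0 < th -> forall s, s ^+ 2 = 1 ->
  (P [set w | (lam <= s * \sum_(k < n) b k w * xi k w)%R] <=
     (expR (th ^+ 2 * V / 2 - th * lam))%:E)%E.
  move=> th0 s s2.
  have [i e] := transform_exp M (th * s) bM hx n (leqnn n).
  have := markov_Ex P _ (expR (th * lam)) i (fun w => expR_ge0 _) (expR_gt0 _).
  have -> : [set w | expR (th * lam) <= expR (th * s * \sum_(k < n) b k w * xi k w)] =
     [set w | lam <= s * \sum_(k < n) b k w * xi k w].
    by apply/seteqP; split=> w /=; rewrite ler_expR -mulrA ler_pM2l.
  move=> /le_trans; apply; rewrite lee_fin expRD expRN ler_pM2r ?invr_gt0 ?expR_gt0//.
  apply: (le_trans e); rewrite ler_expR exprMn s2 mulr1.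
  have -> : th ^+ 2 * v / 2 * \sum_(k < n) M k ^+ 2 =
    th ^+ 2 / 2 * (v * \sum_(k < n) M k ^+ 2) by ring.
  have -> : th ^+ 2 * V / 2 = th ^+ 2 / 2 * V by ring.
  by rewrite ler_wpM2l// divr_ge0// sqr_ge0.
have mS' := mS n (leqnn n).
have mm s : measurable [set w | lam <= s * S n w].
  by apply: measurable_set_ge; exact: measurable_funM.
have sub : [set w | lam <= `|S n w|] `<=`
    [set w | lam <= 1 * S n w] `|` [set w | lam <= -1 * S n w].
  by move=> w /=; rewrite ler_normr mul1r mulN1r => /orP[]; [left|right].
apply: (@le_trans _ _ (P ([set w | lam <= 1 * S n w] `|` [set w | lam <= -1 * S n w]))).
  apply: le_measure => //; rewrite inE; last exact: measurableU.
  by apply: measurable_set_ge; exact: measurableT_comp.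
apply: (le_trans (measureU2 P (mm 1) (mm (-1)))).
have th0 : 0 < lam / V by rewrite divr_gt0.
have ee : expR ((lam / V) ^+ 2 * V / 2 - lam / V * lam) = expR (- (lam ^+ 2 / (2 * V))).
  by congr expR; field; rewrite gt_eqF.
rewrite mulrDl !mul1r EFinD -ee; apply: leeD.
  by apply: one => //; rewrite expr1n.
by apply: one => //; rewrite sqrrN expr1n.
Qed.

End transforms.

(** * Convergence in probability *)

Section negligible_sequences.
Context {d : measure_display} {Omega : measurableType d} {R : realType}.
Variable P : probability Omega R.
Implicit Types (A B : nat -> set Omega) (U V C : nat -> Omega -> R) (u v : Omega -> R).

Lemma set_normr_leE u M : [set w | `|u w| <= M] = ~` [set w | M < `|u w|].
Proof.
apply/seteqP; split=> w /=; first by move=> h; apply/negP; rewrite -leNgt.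
by move/negP; rewrite -leNgt.
Qed.

Lemma exhaustion_P A : (forall n, measurable (A n)) -> (forall n, A n `<=` A n.+1) ->
  (forall w, exists n, A n w) ->
  forall e, 0 < e -> \forall n \near \oo, (P (~` A n) <= e%:E)%E.
Proof.
move=> mA incA UA e e0.
have AT : \bigcup_n A n = setT.
  by rewrite -subTset => w _; have [n Anw] := UA w; exists n.
have nd : nondecreasing_seq A.
  by apply/nondecreasing_seqP => n; apply/subsetPset/incA.
have cv : (P \o A) n @[n --> \oo] --> 1%E.
  rewrite -(probability_setT P) -AT; apply: nondecreasing_cvg_mu => //.
  exact: bigcup_measurable.
move: cv => /fine_cvgP[_ /cvgrPdist_le/(_ e e0)].
apply: filterS => n /= h.
rewrite probability_setC//.
have fA : P (A n) \is a fin_num by rewrite fin_num_measure.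
rewrite -(fineK fA) -EFinB lee_fin; apply: le_trans h.
exact: ler_norm.
Qed.

(* Outer probabilities tending to 0; the events need not be measurable. *)
Definition vanishing A := forall e : R, 0 < e -> \forall n \near \oo,
  exists B : set Omega, [/\ measurable B, A n `<=` B & (P B <= e%:E)%E].

Lemma vanishing_sub A B : (\forall n \near \oo, A n `<=` B n) -> vanishing B -> vanishing A.
Proof.
move=> AB vB e e0; apply: filterS2 AB (vB e e0) => n ABn [C [mC BC PC]].
by exists C; split => //; exact: subset_trans ABn BC.
Qed.

Lemma vanishingU A B : vanishing A -> vanishing B -> vanishing (fun n => A n `|` B n).
Proof.
move=> vA vB e e0; have e20 : 0 < e / 2 by rewrite divr_gt0.
apply: filterS2 (vA _ e20) (vB _ e20) => n [C [mC AC PC]] [D [mD BD PD]].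
exists (C `|` D); split; [exact: measurableU|exact: setUSS|].
apply: (le_trans (measureU2 P mC mD)); rewrite (splitr e) EFinD.
exact: leeD.
Qed.

Lemma vanishing_null (N : set Omega) : P.-negligible N -> vanishing (fun=> N).
Proof.
move=> [B [mB PB NB]] e e0; near=> n; exists B; split => //.
by rewrite PB lee_fin ltW.
Unshelve. all: by end_near. Qed.

Lemma vanishing_P A : (forall n, measurable (A n)) -> vanishing A ->
  P (A n) @[n --> \oo] --> 0%E.
Proof.
move=> mA vA; apply/fine_cvgP; split.
  by near=> n; rewrite fin_num_measure.
apply/cvgrPdist_le => e e0; apply: filterS (vA e e0) => n [B [mB AB PB]] /=.
rewrite sub0r normrN ger0_norm ?fine_ge0 ?measure_ge0//.
rewrite -lee_fin fineK ?fin_num_measure//; apply: le_trans PB.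
by apply: le_measure; rewrite ?inE.
Unshelve. all: by end_near. Qed.

Lemma P_vanishing A : (forall n, measurable (A n)) -> P (A n) @[n --> \oo] --> 0%E ->
  vanishing A.
Proof.
move=> mA /fine_cvgP[_ /cvgrPdist_le h] e e0; apply: filterS (h e e0) => n /=.
rewrite sub0r normrN => hn; exists (A n); split => //.
have fA : P (A n) \is a fin_num by rewrite fin_num_measure.
by rewrite -(fineK fA) lee_fin; apply: le_trans hn; exact: ler_norm.
Qed.

(** One level [M], chosen before [n], makes the complement of [Om M] cost at most [e / 2] for all
    [n] at once. *)
Lemma vanishing_local (Om : nat -> set Omega) A :
  (forall n, measurable (Om n)) -> (forall n, Om n `<=` Om n.+1) ->
  (forall w, exists n, Om n w) ->
  (forall M, vanishing (fun n => A n `&` Om M)) -> vanishing A.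
Proof.
move=> mO incO UO vA e e0; have e20 : 0 < e / 2 by rewrite divr_gt0.
have [M _ /(_ M (leqnn M)) /= hM] := exhaustion_P _ mO incO UO _ e20.
apply: filterS (vA M _ e20) => n [B [mB AB PB]].
have mCO : measurable (~` Om M) by exact: measurableC.
exists (B `|` ~` Om M); split; first exact: measurableU.
  move=> w Aw; have [Ow|nOw] := pselect (Om M w); [left|by right].
  by apply: AB.
apply: (le_trans (measureU2 P mB mCO)); rewrite (splitr e) EFinD.
exact: leeD.
Qed.

Definition negl U := forall e : R, 0 < e -> vanishing (fun n => [set w | e < `|U n w|]).

(** Boundedness in probability, again through measurable supersets. *)
Definition tight U := forall e : R, 0 < e -> exists K : R, \forall n \near \oo,
  exists B : set Omega,
    [/\ measurable B, [set w | K < `|U n w|] `<=` B & (P B <= e%:E)%E].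

Lemma negl_local (Om : nat -> set Omega) U :
  (forall n, measurable (Om n)) -> (forall n, Om n `<=` Om n.+1) ->
  (forall w, exists n, Om n w) ->
  (forall M e, 0 < e -> vanishing (fun n => [set w | e < `|U n w|] `&` Om M)) -> negl U.
Proof. by move=> mO iO uO h e e0; apply: (vanishing_local Om) => // M; exact: h. Qed.

Lemma negl_le U V : (forall n w, `|U n w| <= `|V n w|) -> negl V -> negl U.
Proof.
move=> UV nV e e0; apply: vanishing_sub (nV e e0); near=> n => w /=.
by move/lt_le_trans; apply.
Unshelve. all: by end_near. Qed.

Lemma neglD U V : negl U -> negl V -> negl (fun n w => U n w + V n w).
Proof.
move=> nU nV e e0; have e20 : 0 < e / 2 by rewrite divr_gt0.
apply: vanishing_sub (vanishingU _ _ (nU _ e20) (nV _ e20)); near=> n => w /=.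
move=> h; have [|Ue] := ltP (e / 2) `|U n w|; [by left|right].
have := ler_normD (U n w) (V n w); move: h; lra.
Unshelve. all: by end_near. Qed.

Lemma neglZ c U : negl U -> negl (fun n w => c * U n w).
Proof.
move=> nU e e0; have d0 : 0 < e / (`|c| + 1) by rewrite divr_gt0// ltr_wpDl.
apply: vanishing_sub (nU _ d0); near=> n => w /=.
rewrite normrM ltr_pdivrMr ?ltr_wpDl// => h.
by apply: (lt_le_trans h); rewrite mulrC ler_wpM2l// lerDl.
Unshelve. all: by end_near. Qed.

(* The Cauchy-Schwarz inequality in probability, th being the AM-GM weight. *)
Lemma negl_interp U V C : (forall n w, 0 <= U n w) -> (forall n w, 0 <= V n w) ->
  (forall n w th, 0 < th -> `|C n w| <= th^-1 * U n w + th * V n w) ->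
  negl U -> tight V -> negl C.
Proof.
move=> U0 V0 CUV nU tV e e0 p p0; have p20 : 0 < p / 2 by rewrite divr_gt0.
have [K hK] := tV _ p20.
pose th := e / 2 / (`|K| + 1).
have K1 : 0 < `|K| + 1 by rewrite ltr_wpDl.
have th0 : 0 < th by rewrite !divr_gt0.
have d0 : 0 < th * (e / 2) by rewrite mulr_gt0// divr_gt0.
apply: filterS2 hK (nU _ d0 _ p20) => n [B [mB VB PB]] [D [mD UD PD]].
exists (B `|` D); split; first exact: measurableU; last first.
  apply: (le_trans (measureU2 P mB mD)); rewrite (splitr p) EFinD.
  exact: leeD.
move=> w /= eC; have [KV|VK] := ltP K `|V n w|; [left; exact: VB|right].
apply: UD => /=; rewrite ger0_norm// in VK; rewrite ger0_norm//.
have := CUV n w th th0.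
have : th * V n w <= e / 2.
  apply: (@le_trans _ _ (th * (`|K| + 1))).
    by rewrite ler_pM2l// (le_trans VK)// (le_trans (ler_norm _))// lerDl.
  by rewrite /th divfK// gt_eqF.
move=> h1 h2; rewrite -ltr_pdivlMl//.
by move: eC h1 h2; lra.
Qed.

Lemma tight_le U V : (forall n w, `|U n w| <= `|V n w|) -> tight V -> tight U.
Proof.
move=> UV tV e e0; have [K hK] := tV e e0; exists K.
apply: filterS hK => n [B [mB VB PB]]; exists B; split => // w /= KU.
by apply: VB => /=; exact: lt_le_trans (UV n w).
Qed.

Lemma tight_cst u : measurable_fun setT u -> tight (fun=> u).
Proof.
move=> mu e e0; pose A n := [set w | `|u w| <= n%:R].
have AE n : A n = ~` [set w | n%:R < `|u w|] by exact: set_normr_leE.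
have mgt n : measurable [set w | n%:R < `|u w|].
  by apply: measurable_set_gt; exact: measurableT_comp.
have mA n : measurable (A n) by rewrite AE; exact: measurableC.
have [||n _ /(_ n (leqnn n)) /= h] := exhaustion_P A mA _ _ e e0.
- by move=> n w /le_trans; apply; rewrite ler_nat.
- by move=> w; exists (Num.trunc `|u w|).+1; exact/ltW/truncnS_gt.
exists n%:R; near=> m; exists [set w | n%:R < `|u w|]; split => //.
by move: h; rewrite AE setCK.
Unshelve. all: by end_near. Qed.

Lemma negl_tight U : negl U -> tight U.
Proof. by move=> nU e e0; exists 1; exact: nU. Qed.

Lemma tightD U V : tight U -> tight V -> tight (fun n w => U n w + V n w).
Proof.
move=> tU tV e e0; have e20 : 0 < e / 2 by rewrite divr_gt0.
have [K hK] := tU _ e20; have [L hL] := tV _ e20; exists (K + L).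
apply: filterS2 hK hL => n [B [mB UB PB]] [D [mD VD PD]].
exists (B `|` D); split; first exact: measurableU; last first.
  apply: (le_trans (measureU2 P mB mD)); rewrite (splitr e) EFinD.
  exact: leeD.
move=> w /= h; have [KU|UK] := ltP K `|U n w|; [left; exact: UB|right].
by apply: VD => /=; have := ler_normD (U n w) (V n w); lra.
Qed.

Lemma negl_tight_cvg U u : measurable_fun setT u -> negl (fun n w => U n w - u w) -> tight U.
Proof.
move=> mu nU.
apply: (tight_le _ (fun n w => (U n w - u w) + u w)).
  by move=> n w; rewrite subrK.
by apply: tightD; [exact: negl_tight|exact: tight_cst].
Qed.

(** The events [A n], where the values stay below [e] from rank [n] on, increase to the whole space;
    the rate of convergence may depend on [w]. *)
Lemma negl_pointwise U : (forall n, measurable_fun setT (U n)) ->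
  (forall w, U n w @[n --> \oo] --> (0 : R)) -> negl U.
Proof.
move=> mU U0 e e0 p p0.
pose A n := \bigcap_(m in [set m | (n <= m)%N]) ~` [set w | e < `|U m w|].
have mgt m : measurable [set w | e < `|U m w|].
  by apply: measurable_set_gt; exact: measurableT_comp.
have mA n : measurable (A n).
  by apply: bigcap_measurable => [|m _]; [exists n => /=|exact: measurableC].
have := exhaustion_P A mA _ _ p p0.
have incA n : A n `<=` A n.+1 by move=> w Aw m /= nm; apply: Aw => /=; exact: ltnW.
have UA w : exists n, A n w.
  have /cvgrPdist_le/(_ e e0)[n _ hn] := U0 w.
  exists n => m /= nm; have := hn m nm; rewrite /= sub0r normrN => h.
  by apply/negP; rewrite -leNgt.
move=> /(_ incA UA); apply: filterS => n hn; exists (~` A n); split => //.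
  exact: measurableC.
by move=> w /= ew Aw; exact: (Aw n (leqnn n)).
Qed.

Lemma cvg_in_probP U u : (forall n, measurable_fun setT (U n)) -> measurable_fun setT u ->
  negl (fun n w => U n w - u w) -> cvg_in_prob P U u.
Proof.
move=> mU mu nU e e0; apply: vanishing_P; last exact: nU.
move=> n; apply: measurable_set_gt; apply: measurableT_comp => //.
exact: measurable_funB.
Qed.

Lemma cvg_in_prob_negl U u : (forall n, measurable_fun setT (U n)) -> measurable_fun setT u ->
  cvg_in_prob P U u -> negl (fun n w => U n w - u w).
Proof.
move=> mU mu nU e e0; apply: P_vanishing; last exact: nU.
move=> n; apply: measurable_set_gt; apply: measurableT_comp => //.
exact: measurable_funB.
Qed.

(** The inequality [key] holds for all reals, [Num.sqrt] being 0 on negative ones, so [u] may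
    approach 0. *)
Lemma negl_sqrt U u : negl (fun n w => U n w - u w) ->
  negl (fun n w => Num.sqrt (U n w) - Num.sqrt (u w)).
Proof.
move=> nU e e0; have e2 : 0 < e ^+ 2 by rewrite exprn_gt0.
apply: vanishing_sub (nU _ e2); near=> n => w /=.
have key (a b : R) : `|Num.sqrt a - Num.sqrt b| ^+ 2 <= `|a - b|.
  wlog ab : a b / b <= a.
    by move=> h; have [/h//|/ltW/h] := leP b a; rewrite distrC [in leRHS]distrC.
  have sab : Num.sqrt b <= Num.sqrt a by exact: ler_wsqrtr.
  rewrite !ger0_norm ?subr_ge0//.
  have [a0|a0] := leP a 0.
    by rewrite !ler0_sqrtr ?(le_trans ab)// subrr expr0n subr_ge0.
  have sa : Num.sqrt a ^+ 2 = a by rewrite sqr_sqrtr// ltW.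
  have [b0|b0] := leP b 0; first by rewrite (ler0_sqrtr b0) subr0 sa lerDl oppr_ge0.
  have sb : Num.sqrt b ^+ 2 = b by rewrite sqr_sqrtr// ltW.
  have := sqrtr_ge0 b; rewrite -{2}sa -{3}sb; nra.
move=> h; apply: lt_le_trans (key _ _).
by rewrite ltrXn2r ?nnegrE ?(ltW e0).
Unshelve. all: by end_near. Qed.

Lemma measurable_set_bounded u M : measurable_fun setT u -> measurable [set w | `|u w| <= M].
Proof.
move=> mu; rewrite set_normr_leE.
by apply/measurableC/measurable_set_gt; exact: measurableT_comp.
Qed.

Lemma neglM U V u v : measurable_fun setT u -> measurable_fun setT v ->
  negl (fun n w => U n w - u w) -> negl (fun n w => V n w - v w) ->
  negl (fun n w => U n w * V n w - u w * v w).
Proof.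
move=> mu mv nU nV.
pose Om n := [set w | `|u w| <= n%:R] `&` [set w | `|v w| <= n%:R].
apply: (negl_local Om).
- by move=> n; apply: measurableI; exact: measurable_set_bounded.
- by move=> n w [/= un vn]; split; [apply: (le_trans un)|apply: (le_trans vn)]; rewrite ler_nat.
- move=> w; exists (Num.trunc (Num.max `|u w| `|v w|)).+1.
  by split => /=; apply/ltW/(le_lt_trans _ (truncnS_gt _)); rewrite le_max lexx ?orbT.
move=> M e e0; pose del := Num.min 1 (e / (M%:R * 2 + 1)).
have D0 : 0 < M%:R * 2 + 1 :> R by rewrite ltr_wpDl// mulr_ge0.
have del0 : 0 < del by rewrite lt_min ltr01 divr_gt0.
apply: vanishing_sub (vanishingU _ _ (nU _ del0) (nV _ del0)).
near=> n => w [/= + [/= uM vM]].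
have [|Ud] := ltP del `|U n w - u w|; [by left|].
have [|Vd] := ltP del `|V n w - v w|; [by right|].
rewrite ltNge => /negP; case.
have -> : U n w * V n w - u w * v w = (U n w - u w) * (V n w - v w) +
  u w * (V n w - v w) + (U n w - u w) * v w by ring.
apply: (@le_trans _ _ (del * 1 + M%:R * del + del * M%:R)).
  apply: (le_trans (ler_normD _ _)); apply: lerD; last by rewrite normrM ler_pM.
  apply: (le_trans (ler_normD _ _)); apply: lerD; last by rewrite normrM ler_pM.
  rewrite normrM ler_pM// (le_trans Vd)// /del ge_min lexx//.
have -> : del * 1 + M%:R * del + del * M%:R = del * (M%:R * 2 + 1) by ring.
by rewrite -ler_pdivlMr// /del ge_min lexx orbT.
Unshelve. all: by end_near. Qed.

(** The null set where [v] vanishes is put into every [Om n], so that these events exhaust the space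
    surely, as [negl_local] demands; it is discarded afterwards by [vanishing_null]. *)
Lemma negl_div U V u v : measurable_fun setT u -> measurable_fun setT v ->
  {ae P, forall w, v w <> 0} ->
  negl (fun n w => U n w - u w) -> negl (fun n w => V n w - v w) ->
  negl (fun n w => U n w / V n w - u w / v w).
Proof.
move=> mu mv v0 nU nV.
pose Om n := [set w | v w = 0] `|` ([set w | `|u w| <= n.+1%:R] `&`
   [set w | n.+1%:R^-1 <= `|v w|]).
have mv0 : measurable [set w | v w = 0].
  by have := mv measurableT [set 0] (measurable_set1 0); rewrite setTI.
have inv_le (a : R) n : 0 < a -> a^-1 <= n.+1%:R -> n.+1%:R^-1 <= a.
  by move=> a0 h; rewrite -[leRHS]invrK lef_pV2 ?posrE ?invr_gt0// ltr0n.
apply: (negl_local Om).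
- move=> n; apply: measurableU => //; apply: measurableI; first exact: measurable_set_bounded.
  by apply: measurable_set_ge; exact: measurableT_comp.
- move=> n w [|[/= un vn]]; [by left|right]; split => /=.
    by apply: (le_trans un); rewrite ler_nat.
  by apply: le_trans vn; rewrite lef_pV2 ?posrE ?ltr0n// ler_nat.
- move=> w; have [vw|vw] := eqVneq (v w) 0; first by exists 0%N; left.
  exists (Num.trunc (Num.max `|u w| `|v w|^-1)).
  right; split => /=.
    by apply/ltW/(le_lt_trans _ (truncnS_gt _)); rewrite le_max lexx.
  apply: inv_le; first by rewrite normr_gt0.
  by apply/ltW/(le_lt_trans _ (truncnS_gt _)); rewrite le_max lexx orbT.
move=> M e e0; set m : R := M.+1%:R.
have m0 : 0 < m by rewrite ltr0n.
have m1 : 1 <= m by rewrite ler1n.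
(* The first bound keeps the absolute value of [V n w] above [m^-1 / 2]; the second makes the final
   error [del * (m * 2) + m * del * (m * 2 * m)] at most [e]. *)
pose del := Num.min (m^-1 / 2) (e / (m * 2 + m * m * m * 2)).
have D0 : 0 < m * 2 + m * m * m * 2 :> R by rewrite addr_gt0// !mulr_gt0.
have del0 : 0 < del by rewrite lt_min !divr_gt0// invr_gt0.
have nv0 := vanishing_null _ v0.
apply: vanishing_sub (vanishingU _ _ nv0 (vanishingU _ _ (nU _ del0) (nV _ del0))).
near=> n => w [/= + [/= vw0|[/= uM vM]]]; first by move=> _; left => /=; apply; exact: vw0.
have [|Ud] := ltP del `|U n w - u w|; [by move=> _; right; left|].
have [|Vd] := ltP del `|V n w - v w|; [by move=> _; right; right|].
rewrite ltNge => /negP; case.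
have mi0 : 0 < m^-1 by rewrite invr_gt0.
have vp : 0 < `|v w| by exact: lt_le_trans vM.
have d1 : del <= m^-1 / 2 by rewrite ge_min lexx.
have Vm : m^-1 / 2 <= `|V n w|.
  have := ler_normB (V n w) (V n w - v w); rewrite subKr.
  by move: vM Vd d1; rewrite -/m; move: (m^-1) => mi; lra.
have Vp : 0 < `|V n w| by apply: lt_le_trans Vm; rewrite divr_gt0.
have Vn0 : V n w != 0 by rewrite -normr_gt0.
have vn0 : v w != 0 by rewrite -normr_gt0.
have -> : U n w / V n w - u w / v w = (U n w - u w) / V n w -
   u w * (V n w - v w) / (V n w * v w) by field; apply/andP.
have iV : `|V n w|^-1 <= m * 2.
  have -> : m * 2 = (m^-1 / 2)^-1 by rewrite invfM !invrK.
  by rewrite lef_pV2 ?posrE// divr_gt0.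
have iv : `|v w|^-1 <= m.
  by rewrite -[leRHS]invrK lef_pV2 ?posrE.
apply: (@le_trans _ _ (del * (m * 2) + m * del * (m * 2 * m))).
  apply: (le_trans (ler_normB _ _)); rewrite !normrM !normfV normrM invfM.
  apply: lerD; first by rewrite ler_pM ?invr_ge0.
  apply: ler_pM; rewrite ?mulr_ge0 ?invr_ge0//; first by rewrite ler_pM.
  by rewrite ler_pM ?invr_ge0.
have -> : del * (m * 2) + m * del * (m * 2 * m) = del * (m * 2 + m * m * m * 2) by ring.
by rewrite -ler_pdivlMr// /del ge_min lexx orbT.
Unshelve. all: by end_near. Qed.

End negligible_sequences.

(** * Brownian increments and quadratic variation *)

Section clip.
Context {R : realType}.
Implicit Types M x y : R.

(** Continuous, unlike multiplication by an indicator, so clipped càdlàg paths remain càdlàg. *)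
Definition clip M x := Num.max (- M) (Num.min M x).

Lemma clip_le M x : 0 <= M -> `|clip M x| <= M.
Proof.
move=> M0; rewrite /clip ler_norml le_max lexx /= ge_max ge_min lexx /=.
by rewrite (le_trans _ M0)// oppr_le0.
Qed.

Lemma clip_id M x : `|x| <= M -> clip M x = x.
Proof.
by rewrite ler_norml => /andP[h1 h2]; rewrite /clip (min_idPr h2) (max_idPr h1).
Qed.

Lemma continuous_clip M : continuous (clip M).
Proof.
move=> x; apply: (@continuous_max _ _ (fun=> - M) (fun x => Num.min M x)).
  exact: cst_continuous.
apply: (@continuous_min _ _ (fun=> M) (fun x => x)); first exact: cst_continuous.
exact: cvg_id.
Qed.

Lemma measurable_clip M : measurable_fun setT (clip M).
Proof. exact: continuous_measurable_fun (@continuous_clip M). Qed.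

End clip.

Section processes.
Context {d : measure_display} {Omega : measurableType d} {R : realType}.
Variables (P : probability Omega R) (T : R).
Hypothesis T0 : 0 < T.
Implicit Types (X c H : R -> Omega -> R).

Definition incr N X k w := X (tick T N k.+1) w - X (tick T N k) w.

Lemma adapted_measurable F X t : is_filtration T F -> adapted T F X -> 0 <= t <= T ->
  measurable_fun setT (X t).
Proof.
by move=> fF aX tT; apply: mwrt_measurable (aX t tT); exact: filtration_sub fF _ tT.
Qed.

(** Testing only the countably many grid times makes the event measurable, and one event serves all
    meshes. *)
Definition grid_bounded X (M : nat) : set Omega :=
  [set w | forall N k, (k <= N)%N -> `|X (tick T N k) w| <= M%:R].

Lemma measurable_grid_bounded X M : (forall t, 0 <= t <= T -> measurable_fun setT (X t)) ->
  measurable (grid_bounded X M).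
Proof.
move=> mX.
rewrite (_ : grid_bounded X M = \bigcap_N \bigcap_(k in [set k | (k <= N)%N])
    [set w | `|X (tick T N k) w| <= M%:R]); last first.
  by apply/seteqP; split=> [w h N _ k kN|w h N k kN]; [exact: h|exact: h].
apply: bigcap_measurable => [|N _]; first by exists 0%N.
apply: bigcap_measurable => [|k /= kN]; first by exists 0%N.
by apply: measurable_set_bounded; apply: mX; exact: tick_itv.
Qed.

Lemma grid_bounded_incr X M : grid_bounded X M `<=` grid_bounded X M.+1.
Proof. by move=> w h N k kN; apply: (le_trans (h N k kN)); rewrite ler_nat. Qed.

Lemma grid_bounded_all X : cadlag_paths T X -> forall w, exists M, grid_bounded X M w.
Proof.
move=> cX w; have [K hK] := cadlag_bounded T (X^~ w) T0 (cX w).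
exists (Num.trunc K).+1 => N k kN; apply: (le_trans (hK _ (tick_itv T N k T0 kN))).
exact/ltW/truncnS_gt.
Qed.

Lemma grid_bounded_clip X M w : grid_bounded X M w -> forall N k, (k <= N)%N ->
  clip M%:R (X (tick T N k) w) = X (tick T N k) w.
Proof. by move=> h N k kN; apply: clip_id; exact: h. Qed.

Definition obs t n k := tick T n k.+1 <= t.

Lemma sum_obs n t (f : nat -> R) :
  \sum_(1 <= j < n.+1 | tick T n j <= t) f j =
  \sum_(k < n) (obs t n k)%:R * f k.+1.
Proof.
rewrite big_mkcond big_add1 /= big_mkord; apply: eq_bigr => k _.
by rewrite /obs; case: ifP => _; rewrite ?mul1r ?mul0r.
Qed.

(** The convergence is pathwise, and exhibits the time integral as a limit of random variables,
    whence its measurability. *)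
Lemma riemann_negl c t : cadlag_paths T c -> (forall s, 0 <= s <= T -> measurable_fun setT (c s)) ->
  0 <= t <= T -> measurable_fun setT (time_integral c t) /\
  negl P (fun n w => \sum_(k < n) (obs t n k)%:R * (c (tick T n k) w * (T / n%:R))
       - time_integral c t w).
Proof.
move=> cc mc tT; pose U n w := \sum_(k < n) (obs t n k)%:R * (c (tick T n k) w * (T / n%:R)).
have mU n : measurable_fun setT (U n).
  apply: measurable_sum => k; apply: measurable_funM => //; apply: measurable_funM => //.
  by apply: mc; apply: tick_itv => //; exact/ltnW/ltn_ord.
have cv w : U n w @[n --> \oo] --> time_integral c t w.
  have := riemann_cvg T (c^~ w) t T0 (cadlag_regulated T _ T0 (cc w)) tT.
  rewrite /time_integral; under eq_fun do rewrite sum_obs.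
  by [].
have mI : measurable_fun setT (time_integral c t).
  by apply: (@measurable_fun_cvg _ _ _ _ U) => // w _; exact: cv.
split=> //; apply: negl_pointwise.
  by move=> n; apply: measurable_funB => //; exact: mU.
by move=> w; apply/subr_cvg0; exact: cv.
Qed.

(** Chebyshev's inequality for a surrogate [X] that agrees with [U] on the localizing event only. *)
Lemma vanishing_L2 (X : nat -> Omega -> R) (U : nat -> Omega -> R) (Om : set Omega) e :
  (forall n w, Om w -> U n w = X n w) ->
  (\forall n \near \oo, integrableRV P (fun w => X n w ^+ 2)) ->
  Ex P (fun w => X n w ^+ 2) @[n --> \oo] --> (0 : R) -> 0 < e ->
  vanishing P (fun n => [set w | e < `|U n w|] `&` Om).
Proof.
move=> UX iX X0 e0 p p0; have e2 : 0 < e ^+ 2 by rewrite exprn_gt0.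
have pe : 0 < p * e ^+ 2 by rewrite mulr_gt0.
have /cvgrPdist_le/(_ _ pe) := X0; apply: filterS2 iX => n iX /=.
rewrite sub0r normrN => h.
exists [set w | e ^+ 2 <= X n w ^+ 2]; split.
- by apply: measurable_set_ge; exact: (L1_measurable P _ iX).
- move=> w [/= eU Omw]; move: eU; rewrite UX// => eU.
  by apply: ltW; rewrite -[X n w ^+ 2]real_normK ?num_real// ltrXn2r ?nnegrE ?(ltW e0).
- apply: (le_trans (markov_Ex P _ _ iX (fun w => sqr_ge0 _) e2)).
  by rewrite lee_fin ler_pdivrMr// (le_trans (ler_norm _)).
Qed.

End processes.

Lemma innov_comp {d} {Omega : measurableType d} {R : realType} (P : probability Omega R)
  n G xi (f : R -> R) : innovations P n G xi -> measurable_fun setT f ->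
  innovations P n G (fun k w => f (xi k w)).
Proof.
move=> [h1 h2] mf; split=> k kn; first by apply: (mwrt_comp _ _ f) => //; exact: h1.
move=> A B GA mB; rewrite (_ : _ @^-1` B = xi k @^-1` (f @^-1` B))//.
by apply: h2 => //; rewrite -[X in measurable X]setTI; exact: mf.
Qed.

Section brownian.
Context {d : measure_display} {Omega : measurableType d} {R : realType}.
Variables (P : probability Omega R) (T : R) (F : R -> set (set Omega)).
Hypotheses (T0 : 0 < T) (fF : is_filtration T F).
Variable W : R -> Omega -> R.
Hypothesis bW : is_brownian P T F W.
Notation L1 := (integrableRV P).
Notation E := (Ex P).

Lemma tick_filtration N : discrete_filtration N (fun k => F (tick T N k)).
Proof.
split=> k kN.
- exact: filtration_sigma fF _ (tick_itv T N k T0 kN).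
- exact: filtration_sub fF _ (tick_itv T N k T0 kN).
- apply: filtration_mono fF _ _ _ _ _; [exact: tick_ge0|exact: ler_tick|exact: tick_le].
Qed.

Lemma incr_innov N : innovations P N (fun k => F (tick T N k)) (incr T N W).
Proof.
have [->|N0] := posnP N; first by split.
split=> k kN.
  have /andP[kT0 kT1] := tick_itv T N k.+1 T0 kN.
  have kT := tick_itv T N k T0 (ltnW kN).
  apply: mwrtB; [exact: filtration_sigma fF _ (tick_itv T N k.+1 T0 kN)| |].
    by apply: brownian_adapted bW _ _; rewrite kT0.
  apply: mwrt_mono (brownian_adapted bW kT).
  by apply: filtration_mono fF _ _ _ _ _; [exact: tick_ge0|exact: ler_tick|exact: tick_le].
move=> A B FA mB; apply: (brownian_indep bW) => //.
- exact: tick_ge0.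
- exact: ltr_tick.
- exact: tick_le.
Qed.

Lemma incr_measurable N k : (k < N)%N -> measurable_fun setT (incr T N W k).
Proof.
move=> kN; apply: mwrt_measurable (innov_wrt _ _ _ _ (incr_innov N) _ kN).
exact: dfilt_sub (tick_filtration N) _ kN.
Qed.

Lemma incr_law N k : (k < N)%N -> forall B : set R, measurable B ->
  P (incr T N W k @^-1` B) = normal_prob 0 (Num.sqrt (T / N%:R)) B.
Proof.
move=> kN B mB.
have -> : T / N%:R = tick T N k.+1 - tick T N k by rewrite tickS addrC addKr.
apply: (brownian_normal bW) => //; [exact: tick_ge0| |exact: tick_le].
by apply: ltr_tick => //; exact: leq_ltn_trans kN.
Qed.

Lemma incr_mesh N k : (k < N)%N -> 0 < T / N%:R.
Proof. by move=> kN; apply: mesh_gt0 => //; exact: leq_ltn_trans kN. Qed.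

Lemma incr_mgf N k c : (k < N)%N -> L1 (fun w => expR (c * incr T N W k w)) /\
  E (fun w => expR (c * incr T N W k w)) = expR (c ^+ 2 * (T / N%:R) / 2).
Proof.
by move=> kN; apply: gauss_mgf (incr_mesh N k kN) (incr_law N k kN) c; exact: incr_measurable.
Qed.

Lemma incr_mean N k : (k < N)%N -> L1 (incr T N W k) /\ E (incr T N W k) = 0.
Proof.
move=> kN; have h := incr_mesh N k kN; have l := incr_law N k kN.
by have m := incr_measurable N k kN; split; [exact: gauss_L1 m h l|exact: gauss_1 m h l].
Qed.

Lemma incr_sqr N k : (k < N)%N -> L1 (fun w => incr T N W k w ^+ 2) /\
  E (fun w => incr T N W k w ^+ 2) = T / N%:R.
Proof.
move=> kN; have h := incr_mesh N k kN; have l := incr_law N k kN.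
by have m := incr_measurable N k kN; split; [exact: gauss_L2 m h l|exact: gauss_2 m h l].
Qed.

Lemma incr_sqr_var N k : (k < N)%N ->
  [/\ L1 (fun w => incr T N W k w ^+ 2 - T / N%:R),
      E (fun w => incr T N W k w ^+ 2 - T / N%:R) = 0,
      L1 (fun w => (incr T N W k w ^+ 2 - T / N%:R) ^+ 2) &
      E (fun w => (incr T N W k w ^+ 2 - T / N%:R) ^+ 2) =
        E (fun w => incr T N W k w ^+ 4) - (T / N%:R) ^+ 2].
Proof.
move=> kN; have h := incr_mesh N k kN; have l := incr_law N k kN.
have m := incr_measurable N k kN; set v := T / N%:R in h l *.
have [i2 e2] := incr_sqr N k kN; have i4 := gauss_L4 P _ _ m h l.
have ic c := L1_cst P c.
have iv := L1Z P (2 * v) _ i2.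
split; first exact: L1B.
- by rewrite ExB// e2 Ex_cst subrr.
- have -> : (fun w => (incr T N W k w ^+ 2 - v) ^+ 2) =
     (fun w => incr T N W k w ^+ 4 - (2 * v) * incr T N W k w ^+ 2 + v ^+ 2).
    by apply/funext => w; ring.
  by apply: L1D => //; exact: L1B.
- have -> : (fun w => (incr T N W k w ^+ 2 - v) ^+ 2) =
     (fun w => incr T N W k w ^+ 4 - (2 * v) * incr T N W k w ^+ 2 + v ^+ 2).
    by apply/funext => w; ring.
  by rewrite ExD//; [rewrite ExB// ExZ// e2 Ex_cst -/v; ring|exact: L1B].
Qed.

End brownian.

(** * Quadratic variation and mean freezing error *)

Section quadratic_variation.
Context {d : measure_display} {Omega : measurableType d} {R : realType}.
Variables (P : probability Omega R) (T : R) (F : R -> set (set Omega)).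
Hypotheses (T0 : 0 < T) (fF : is_filtration T F).
Notation L1 := (integrableRV P).
Notation E := (Ex P).

Lemma cvg_cst_mesh (K : R) : K * (T / n%:R) @[n --> \oo] --> (0 : R).
Proof. by rewrite -[X in _ --> X](mulr0 K); apply: cvgM; [exact: cvg_cst|exact: cvg_mesh]. Qed.

Lemma squeeze0 (f g : nat -> R) : (forall n, 0 <= f n) -> (\forall n \near \oo, f n <= g n) ->
  g n @[n --> \oo] --> (0 : R) -> f n @[n --> \oo] --> (0 : R).
Proof.
move=> f0 fg g0; apply: (@squeeze_cvgr _ _ _ _ (fun=> 0) g) => //; last exact: cvg_cst.
by apply: filterS fg => n ->; rewrite f0.
Qed.

Lemma mwrt_clip_grid (c : R -> Omega -> R) M n k (a : R) : adapted T F c -> (k <= n)%N ->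
  measurable_wrt (F (tick T n k)) (fun w => a * clip M (c (tick T n k) w)).
Proof.
move=> ac kn; apply: (mwrt_comp _ _ (fun x => a * clip M x)).
  by apply: measurable_funM => //; exact: measurable_clip.
by apply: ac; exact: tick_itv.
Qed.

(** [incr ^+ 2 - T / n] is a centred innovation of variance at most [2 * expR 8 * (T / n) ^+ 2], so
    its transform with clipped weights has a second moment of order [T / n]. The compensator is a
    Riemann sum. *)
Lemma quadratic_variation W c t : is_brownian P T F W -> adapted T F c -> cadlag_paths T c ->
  0 <= t <= T ->
  negl P (fun n w => \sum_(k < n) (obs T t n k)%:R * (c (tick T n k) w * incr T n W k w ^+ 2)
     - time_integral c t w).
Proof.
move=> bW ac cc tT.
have mc s : 0 <= s <= T -> measurable_fun setT (c s) by exact: adapted_measurable fF ac.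
have [mI nR] := riemann_negl P T T0 c t cc mc tT.
pose U n w := \sum_(k < n) (obs T t n k)%:R * c (tick T n k) w * (incr T n W k w ^+ 2 - T / n%:R).
apply: (@negl_le _ _ _ _ _ (fun n w => U n w + (\sum_(k < n) (obs T t n k)%:R *
    (c (tick T n k) w * (T / n%:R)) - time_integral c t w))).
  move=> n w; rewrite addrA -big_split /=; apply: le_of_eq; congr (`|_ - _|).
  by apply: eq_bigr => k _; ring.
apply: neglD => //; apply: (negl_local P (grid_bounded T c)).
- by move=> M; exact: measurable_grid_bounded.
- by move=> M; exact: grid_bounded_incr.
- exact: grid_bounded_all.
move=> M e e0.
pose b n k w := (obs T t n k)%:R * clip M%:R (c (tick T n k) w).
pose X n w := \sum_(k < n) b n k w * (incr T n W k w ^+ 2 - T / n%:R).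
have bM n k w : `|b n k w| <= M%:R.
  rewrite normrM ger0_norm// -[leRHS]mul1r ler_pM// ?clip_le//.
  by case: (obs T t n k).
have key n : L1 (fun w => X n w ^+ 2) /\
    E (fun w => X n w ^+ 2) <= M%:R ^+ 2 * (2 * expR 8) * T * (T / n%:R).
  have [->|n0] := posnP n.
    rewrite /X; have -> : (fun w => (\sum_(k < 0) b 0%N k w * (incr T 0 W k w ^+ 2 - T / 0%:R)) ^+ 2) = (fun=> 0).
      by apply/funext => w; rewrite big_ord0 expr0n.
    by rewrite Ex_cst invr0 !mulr0; split => //; exact: L1_cst.
  set h := T / n%:R; have h0 : 0 < h by exact: mesh_gt0.
  have msq : measurable_fun setT (fun x : R => x ^+ 2 - h).
    by apply: measurable_funB => //; exact: measurable_funX.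
  have hv k : (k < n)%N -> L1 (fun w => (incr T n W k w ^+ 2 - h) ^+ 2) /\
      E (fun w => (incr T n W k w ^+ 2 - h) ^+ 2) <= 2 * expR 8 * h ^+ 2.
    move=> kn; have [_ _ i2 e2] := incr_sqr_var P T F T0 fF W bW n k kn.
    split=> //; rewrite e2 -/h.
    have := gauss_4 P _ _ (incr_measurable P T F T0 fF W bW n k kn) h0 (incr_law P T F T0 W bW n k kn).
    by have := sqr_ge0 h; lra.
  have [i le] := transform_L2 P n _ _ (b n) (tick_filtration T F T0 fF n)
    (innov_comp P n _ _ (fun x => x ^+ 2 - h) (incr_innov P T F T0 fF W bW n) msq)
    (2 * expR 8 * h ^+ 2)
    (fun k kn => mwrt_clip_grid c _ n k _ ac (ltnW kn)) M%:R (fun k w _ => bM n k w)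
    (fun k kn => let: And4 i e _ _ := incr_sqr_var P T F T0 fF W bW n k kn in conj i e)
    hv n (leqnn n).
  split=> //; apply: (le_trans le).
  have -> : M%:R ^+ 2 * (2 * expR 8) * T * h = 2 * expR 8 * h ^+ 2 * (n%:R * M%:R ^+ 2).
    by rewrite /h; field; rewrite pnatr_eq0 -lt0n.
  apply: ler_wpM2l; first by rewrite !mulr_ge0 ?expR_ge0// ?ltW.
  rewrite mulr_natl -[n in leRHS]card_ord -sumr_const; apply: ler_sum => k _.
  have mb : measurable_fun setT (b n k).
    apply: mwrt_measurable (mwrt_clip_grid c M%:R n k (obs T t n k)%:R ac (ltnW (ltn_ord k))).
    exact: filtration_sub fF _ (tick_itv T n k T0 (ltnW (ltn_ord k))).
  have b2 w : b n k w ^+ 2 <= M%:R ^+ 2.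
    by rewrite -[b n k w ^+ 2]real_normK ?num_real//; apply: ler_sqr_ge0.
  rewrite -(Ex_cst P (M%:R ^+ 2)); apply: Ex_le => //; last exact: L1_cst.
  apply: (L1_bounded _ _ (M%:R ^+ 2)); first exact: measurable_funX.
  by move=> w; rewrite ger0_norm ?sqr_ge0.
apply: (vanishing_L2 P X) => //.
- move=> n w Ow; rewrite /U /X; apply: eq_bigr => k _.
  by rewrite /b (grid_bounded_clip T _ _ _ Ow)// ltnW.
- by near=> n; have [] := key n.
- apply: squeeze0 (cvg_cst_mesh (M%:R ^+ 2 * (2 * expR 8) * T)).
    by move=> n; apply: Ex_ge0 => w; exact: sqr_ge0.
  by near=> n; have [] := key n.
Unshelve. all: by end_near. Qed.

(** Bounded convergence by hand, because the [K0] of [grid_gap_cvg] depends on the path: the events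
    [A K0] exhaust the space, and outside [A K0] clipping bounds the gap by [C]. The result is still
    uniform in [N]. *)
Lemma Ex_grid_gap H (M : nat) e : adapted T F H -> cadlag_paths T H -> 0 < e ->
  exists K0, forall K N, (K0 < K)%N -> (K <= N)%N ->
    L1 (fun w => grid_gap T (fun s => clip M%:R (H s w)) K N) /\
    E (fun w => grid_gap T (fun s => clip M%:R (H s w)) K N) <= e.
Proof.
move=> aH cH e0; pose g K N w := grid_gap T (fun s => clip M%:R (H s w)) K N.
have e20 : 0 < e / 2 by rewrite divr_gt0.
pose A K0 := [set w | forall K N, (K0 < K)%N -> (K <= N)%N -> g K N w <= e / 2].
have mcl n k : (k <= n)%N -> measurable_fun setT (fun w => clip M%:R (H (tick T n k) w)).
  move=> kn; apply: (measurableT_comp (measurable_clip _)).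
  exact: adapted_measurable fF aH (tick_itv T n k T0 kn).
have mg K N : (0 < K)%N -> measurable_fun setT (g K N).
  move=> K0; apply: measurable_funM => //; apply: measurable_sum => k.
  apply: measurable_funX; apply: measurable_funB; apply: mcl; first exact/ltnW/ltn_ord.
  exact/ltnW/coarse_lt.
have mA K0 : measurable (A K0).
  rewrite (_ : A K0 = \bigcap_(K in [set K | (K0 < K)%N]) \bigcap_(N in [set N | (K <= N)%N])
      [set w | `|g K N w| <= e / 2]); last first.
    have g0 K N w : 0 <= g K N w.
      by rewrite /g /grid_gap mulr_ge0 ?mesh_ge0// sumr_ge0// => k _; exact: sqr_ge0.
    apply/seteqP; split=> [w h K KK N KN|w h K N KK KN].
      by rewrite /= ger0_norm// h.
    by have := h K KK N KN; rewrite /= ger0_norm.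
  apply: bigcap_measurable => [|K /= KK]; first by exists K0.+1 => /=.
  apply: bigcap_measurable => [|N /= KN]; first by exists K => /=.
  by apply: measurable_set_bounded; apply: mg; exact: leq_ltn_trans KK.
pose C : R := 4 * M%:R ^+ 2 * T.
have C0 : 0 <= C by rewrite !mulr_ge0// ?exprn_ge0// ltW.
have d0 : 0 < e / 2 / (C + 1) by rewrite !divr_gt0// ltr_wpDl.
have [||K0 _ /(_ K0 (leqnn K0)) /= hK0] := exhaustion_P P A mA _ _ _ d0.
- by move=> K0 w h K N KK KN; apply: h => //; exact: ltnW.
- move=> w; apply: grid_gap_cvg => //.
  exact: (cadlag_comp T (H^~ w) (clip M%:R) (continuous_clip _) (cH w)).
exists K0 => K N KK KN.
have Kp : (0 < K)%N by exact: leq_ltn_trans KK.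
have Np : (0 < N)%N by exact: leq_trans KN.
have gC w : g K N w <= C.
  rewrite /g /grid_gap /C.
  have -> : 4 * M%:R ^+ 2 * T = T / N%:R * (N%:R * (4 * M%:R ^+ 2)) :> R.
    by field; rewrite pnatr_eq0 -lt0n.
  rewrite ler_wpM2l ?mesh_ge0// mulr_natl -[N in leRHS]card_ord -sumr_const.
  apply: ler_sum => k _; rewrite -[leLHS]real_normK ?num_real//.
  have -> : 4 * M%:R ^+ 2 = (2 * M%:R) ^+ 2 :> R by ring.
  apply: ler_sqr_ge0 => //; apply: (le_trans (ler_normB _ _)).
  by rewrite mulrDl mul1r lerD// clip_le.
have g0 w : 0 <= g K N w.
  by rewrite /g /grid_gap mulr_ge0 ?mesh_ge0// sumr_ge0// => k _; exact: sqr_ge0.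
have ig : L1 (g K N).
  by apply: (L1_bounded _ _ C); [exact: mg|move=> w; rewrite ger0_norm].
split=> //.
have mCA : measurable (~` A K0) by exact: measurableC.
have iI : L1 (\1_(~` A K0)).
  by apply: (L1_bounded _ _ 1); [exact: measurable_indic|move=> w; rewrite indicE;
    case: (_ \in _); rewrite ?normr1 ?normr0].
have iCI := L1Z P C _ iI; have ie := L1_cst P (e / 2).
apply: (@le_trans _ _ (E (fun w => e / 2 + C * \1_(~` A K0) w))).
  apply: Ex_le => //; first exact: L1D.
  move=> w; rewrite indicE; have [Aw|nAw] := pselect (A K0 w).
    by rewrite memNset ?mulr0 ?addr0; [exact: Aw|move=> h; exact: (h Aw)].
  by rewrite mem_set// mulr1 (le_trans (gC w))// lerDr ltW.
rewrite ExD// Ex_cst ExZ// [leRHS]splitr lerD2l.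
have : E (\1_(~` A K0)) <= e / 2 / (C + 1) by rewrite -lee_fin Ex_indic.
move=> /(ler_wpM2l C0) /le_trans; apply.
apply: (@le_trans _ _ ((C + 1) * (e / 2 / (C + 1)))).
  by rewrite ler_wpM2r ?(ltW d0)// lerDl.
by rewrite mulrC divfK// gt_eqF// ltr_wpDl.
Qed.

End quadratic_variation.

(** * Increments of Itô integrals *)

Section block_sums.
Context {R : realType}.
Implicit Types f : nat -> R.

Lemma sum_ltn N a f : (a <= N)%N -> \sum_(i < N) (i < a)%N%:R * f i = \sum_(i < a) f i.
Proof.
move=> aN; rewrite (big_ord_widen N f aN) [RHS]big_mkcond; apply: eq_bigr => i _.
by case: (i < a)%N; rewrite ?mul1r ?mul0r.
Qed.

Lemma block_sum n m j f : (0 < m)%N -> (j < n)%N ->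
  \sum_(i < n * m) (i %/ m == j)%N%:R * f i = \sum_(i < j.+1 * m) f i - \sum_(i < j * m) f i.
Proof.
move=> m0 jn; rewrite -(sum_ltn (n * m)) ?leq_mul2r ?jn ?orbT//.
rewrite -(sum_ltn (n * m) (j * m)) ?leq_mul2r ?(ltnW jn) ?orbT// -sumrB.
apply: eq_bigr => i _; rewrite -mulrBl; congr (_ * _).
rewrite -!ltn_divLR// ltnS; have [ij|ji|_] := ltngtP (i %/ m)%N j.
- by rewrite subrr.
- by rewrite subrr.
- by rewrite subr0.
Qed.

Lemma sum_incr {d} {Omega : measurableType d} T N (X : R -> Omega -> R) w a :
  \sum_(i < a) incr T N X i w = X (tick T N a) w - X (tick T N 0) w.
Proof.
elim: a => [|a IH]; first by rewrite big_ord0 subrr.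
by rewrite big_ord_recr /= IH /incr; ring.
Qed.

End block_sums.

Section more_vanishing.
Context {d : measure_display} {Omega : measurableType d} {R : realType}.
Variable P : probability Omega R.

Lemma vanishing_exists n (A : nat -> nat -> set Omega) :
  (forall j, (j < n)%N -> vanishing P (A j)) ->
  vanishing P (fun m => [set w | exists2 j, (j < n)%N & A j m w]).
Proof.
elim: n => [|n IH] vA.
  move=> e e0; near=> m; exists set0; split => //; first by move=> w [].
  by rewrite measure0 lee_fin ltW.
have vn := vanishingU P _ _ (IH (fun j jn => vA j (ltnW jn))) (vA n (leqnn _)).
apply: vanishing_sub vn; near=> m => w [j]; rewrite ltnS leq_eqVlt => /predU1P[->|jn] Aj.
  by right.
by left; exists j.
Unshelve. all: by end_near. Qed.

Lemma vanishing_subseq (A : nat -> set Omega) (phi : nat -> nat) :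
  (forall m, (m <= phi m)%N) -> vanishing P A -> vanishing P (fun m => A (phi m)).
Proof.
move=> h vA e e0; have [N _ hN] := vA e e0.
by exists N => // m /= Nm; apply: hN => /=; exact: leq_trans (h m).
Qed.

End more_vanishing.

Section ito.
Context {d : measure_display} {Omega : measurableType d} {R : realType}.
Variables (P : probability Omega R) (T : R) (F : R -> set (set Omega)).
Hypotheses (T0 : 0 < T) (fF : is_filtration T F).
Variables (W H I : R -> Omega -> R).
Hypotheses (bW : is_brownian P T F W) (aH : adapted T F H) (cH : cadlag_paths T H)
  (iI : is_ito_integral P T F W H I).
Notation E := (Ex P).

Lemma time_integral_measurable (G : R -> Omega -> R) t : (forall w, regulated T (G^~ w)) ->
  (forall s, 0 <= s <= T -> measurable_fun setT (G s)) -> 0 <= t <= T ->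
  measurable_fun setT (time_integral G t).
Proof.
move=> rG mG tT.
apply: (@measurable_fun_cvg _ _ _ _ (fun n w =>
    \sum_(k < n) (obs T t n k)%:R * (G (tick T n k) w * (T / n%:R)))) => [n|w _].
  apply: measurable_sum => k; apply: measurable_funM => //; apply: measurable_funM => //.
  by apply: mG; apply: tick_itv => //; exact/ltnW/ltn_ord.
have := riemann_cvg T (G^~ w) t T0 (rG w) tT.
by rewrite /time_integral; under eq_fun do rewrite sum_obs.
Qed.

Lemma sp_grid_range N i : (i <= N)%N -> 0 <= tick T N i <= T.
Proof. exact: tick_itv. Qed.

Lemma sp_grid_mono N i : (i < N)%N -> tick T N i <= tick T N i.+1.
Proof. by move=> _; exact: ler_tick. Qed.

Lemma sp_grid_wrt N i : (i < N)%N ->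
  measurable_wrt (F (tick T N i)) (fun w => clip N%:R (H (tick T N i) w)).
Proof.
move=> iN; apply: (mwrt_comp _ _ (clip N%:R)); first exact: measurable_clip.
by apply: aH; apply: tick_itv => //; exact: ltnW.
Qed.

Lemma sp_grid_bounded N i : (i < N)%N ->
  exists C : R, forall w, `|clip N%:R (H (tick T N i) w)| <= C.
Proof. by move=> _; exists N%:R => w; exact: clip_le. Qed.

(** A simple process needs bounded coefficients, so [H] is clipped; the level [N] grows with the
    grid and is eventually inactive on each path. *)
Definition sp_grid N : simple_process T F :=
  {| sp_size := N; sp_time := tick T N;
     sp_coef := fun i w => clip N%:R (H (tick T N i) w);
     sp_time_range := sp_grid_range N; sp_time_mono := sp_grid_mono N;
     sp_coef_measurable := sp_grid_wrt N; sp_coef_bounded := sp_grid_bounded N |}.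

Lemma sp_grid_value N s w k : (k < N)%N -> tick T N k < s <= tick T N k.+1 ->
  sp_value (sp_grid N) s w = clip N%:R (H (tick T N k) w).
Proof.
move=> kN ks; rewrite /sp_value /= (bigD1 (Ordinal kN))//= big1 ?addr0; last first.
  move=> i ik; rewrite indicE memNset ?mulr0//= in_itv/= => iT.
  move: ik; have := tick_injr _ _ _ _ _ T0 iT ks.
  by move=> ii; apply/negP/negPn/eqP/val_inj.
by rewrite indicE mem_set ?mulr1//= in_itv.
Qed.

Lemma sp_grid_approx t : 0 <= t <= T -> approximates P sp_grid H t.
Proof.
move=> tT; have cst0 : measurable_fun setT (cst 0 : Omega -> R) by exact: measurable_cst.
have reg N w : regulated T (fun s => sp_value (sp_grid N) s w).
  rewrite /sp_value; apply: regulated_sum => i; apply: regulatedM.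
    exact: regulated_cst.
  exact: regulated_indic.
have regB N w : regulated T (fun s => sp_value (sp_grid N) s w - H s w).
  have h : regulated T (fun s => -1 * H s w).
    by apply: regulatedM; [exact: regulated_cst|exact: cadlag_regulated].
  have := regulatedD _ _ _ (reg N w) h.
  by rewrite (_ : (fun s => _ + _) = (fun s => sp_value (sp_grid N) s w - H s w))//;
    apply/funext => s; rewrite mulN1r.
have reg2 N w : regulated T (fun s => (sp_value (sp_grid N) s w - H s w) ^+ 2).
  rewrite (_ : (fun s => _ ^+ 2) = (fun s => (sp_value (sp_grid N) s w - H s w) *
    (sp_value (sp_grid N) s w - H s w))); first exact: regulatedM.
  by apply/funext => s; rewrite expr2.
have mU N : measurable_fun setT (time_integral
    (fun s w => (sp_value (sp_grid N) s w - H s w) ^+ 2) t).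
  apply: (time_integral_measurable _ t (reg2 N) _ tT).
  move=> s sT; apply: measurable_funX; apply: measurable_funB; last first.
    exact: adapted_measurable fF aH sT.
  apply: measurable_sum => i; apply: measurable_funM => //.
  by apply: mwrt_measurable (sp_grid_wrt N i (ltn_ord i)); apply: filtration_sub fF _ _;
    apply: tick_itv => //; exact/ltnW/ltn_ord.
apply: cvg_in_probP => //.
apply: (negl_le _ _ (fun N w => time_integral
    (fun s w => (sp_value (sp_grid N) s w - H s w) ^+ 2) t w)).
  by move=> n w; rewrite subr0.
apply: negl_pointwise => // w.
have [M hM] := grid_bounded_all T T0 H cH w.
apply: (cadlag_step_L2 T (H^~ w) (fun N s => sp_value (sp_grid N) s w)) => //.
- move=> N; apply: regulated_measurable; apply: regulated_sub (reg N w).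
  by case/andP: tT.
- near=> N => s k kN ks; rewrite (sp_grid_value _ _ _ _ kN ks) clip_id//.
  apply: (le_trans (hM N k (ltnW kN))); rewrite ler_nat; near: N; exact: nbhs_infty_ge.
- move=> N; rewrite /sp_value big1// => i _; rewrite indicE memNset ?mulr0//= in_itv/=.
  by rewrite ltNge tick_ge0.
Unshelve. all: by end_near. Qed.

Lemma sp_grid_integral n m j w : (0 < m)%N -> (j <= n)%N ->
  sp_integral (sp_grid (n * m)) W (tick T n j) w =
  \sum_(i < j * m) clip (n * m)%:R (H (tick T (n * m) i) w) * incr T (n * m) W i w.
Proof.
move=> m0 jn; rewrite /sp_integral /= -(tickM T n m j m0).
rewrite -(sum_ltn (n * m) (j * m) (fun i => clip (n * m)%:R (H (tick T (n * m) i) w) *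
  incr T (n * m) W i w)) ?leq_mul2r ?jn ?orbT//.
apply: eq_bigr => i _; have [ij|ji] := ltnP i (j * m).
  rewrite mul1r; congr (_ * (W _ w - W _ w)); apply/min_idPr; apply: ler_tick => //.
  exact: ltnW.
rewrite mul0r (min_idPl _) ?(min_idPl _) ?subrr ?mulr0//; apply: ler_tick => //.
exact: leqW.
Qed.

(* block_integral M n m j is the integral of H, clipped at M, over the j-th
   interval of mesh T / n, discretized with mesh T / (n * m). *)
Definition block_coef (M n m j i : nat) (w : Omega) : R :=
  (i %/ m == j)%N%:R * clip M%:R (H (tick T (n * m) i) w).

Definition block_integral M n m j w : R :=
  \sum_(i < n * m) block_coef M n m j i w * incr T (n * m) W i w.

(** Under these conditions both clippings, at [M] on the left and at [n * m] on the right, are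
    inactive. *)
Lemma block_integralE M n m j w : grid_bounded T H M w -> (0 < m)%N -> (j < n)%N ->
  (M <= n * m)%N ->
  block_integral M n m j w = sp_integral (sp_grid (n * m)) W (tick T n j.+1) w -
     sp_integral (sp_grid (n * m)) W (tick T n j) w.
Proof.
move=> Hw m0 jn Mnm; rewrite !sp_grid_integral// ?(ltnW jn)//.
pose f i := clip (n * m)%:R (H (tick T (n * m) i) w) * incr T (n * m) W i w.
rewrite -(block_sum n m j f m0 jn).
apply: eq_bigr => i _; rewrite /block_coef -mulrA; congr (_ * (_ * _)).
have b := Hw (n * m)%N i (ltnW (ltn_ord i)).
by rewrite !clip_id// (le_trans b)// ler_nat.
Qed.

Lemma sp_grid_integral_negl n j : (0 < n)%N -> (j <= n)%N ->
  negl P (fun m w => sp_integral (sp_grid (n * m.+1)) W (tick T n j) w - I (tick T n j) w).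
Proof.
move=> n0 jn; have tj := tick_itv T n j T0 jn.
have := ito_cvg iI tj (sp_grid_approx _ tj).
have mI := ito_measurable iI tj.
have mS N : measurable_fun setT (sp_integral (sp_grid N) W (tick T n j)).
  apply: measurable_sum => i; apply: measurable_funM.
    apply: mwrt_measurable (sp_grid_wrt N i (ltn_ord i)); apply: filtration_sub fF _ _.
    by apply: tick_itv => //; exact/ltnW/ltn_ord.
  have mW k : (k <= N)%N -> measurable_fun setT (W (Num.min (tick T n j) (tick T N k))).
    move=> kN; apply: adapted_measurable fF (brownian_adapted bW) _.
    by have := tick_itv T N k T0 kN; rewrite /Num.min; case: ifP.
  by apply: measurable_funB; apply: mW => //; exact/ltnW/ltn_ord.
move=> /(cvg_in_prob_negl P _ _ mS mI) nS e e0.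
apply: (vanishing_subseq P _ (fun m => (n * m.+1)%N)) (nS e e0).
by move=> m; rewrite (leq_trans (leqnSn m))// leq_pmull.
Qed.

(** Here [n] is fixed and [m] tends to infinity: only finitely many times [tick T n j] occur, and
    convergence in probability at each of them suffices. *)
Lemma incr_block_vanishing M n del : (0 < n)%N -> 0 < del ->
  vanishing P (fun m => [set w | exists2 j, (j < n)%N &
     del < `|incr T n I j w - block_integral M n m.+1 j w|] `&` grid_bounded T H M).
Proof.
move=> n0 d0; have d20 : 0 < del / 2 by rewrite divr_gt0.
pose U j m w := sp_integral (sp_grid (n * m.+1)) W (tick T n j) w - I (tick T n j) w.
have v := vanishing_exists P n.+1 (fun j m => [set w | del / 2 < `|U j m w|])
  (fun j jn => sp_grid_integral_negl n j n0 jn _ d20).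
apply: vanishing_sub v; near=> m => w [[j jn h] Hw].
have Mm : (M <= n * m.+1)%N.
  apply: (@leq_trans m.+1); last by rewrite leq_pmull.
  by apply/leqW; near: m; exact: nbhs_infty_ge.
move: h; rewrite (block_integralE _ _ _ _ _ Hw)// => h.
have [U1|U1] := ltP (del / 2) `|U j.+1 m w|; first by exists j.+1 => //; rewrite ltnS.
exists j => /=; first exact: ltnW.
have := ler_normB (U j m w) (U j.+1 m w).
have -> : U j m w - U j.+1 m w = incr T n I j w -
   (sp_integral (sp_grid (n * m.+1)) W (tick T n j.+1) w -
    sp_integral (sp_grid (n * m.+1)) W (tick T n j) w) by rewrite /U /incr; ring.
by move: h U1; lra.
Unshelve. all: by end_near. Qed.

Lemma block_coef_wrt M n m j i : (i <= n * m)%N ->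
  measurable_wrt (F (tick T (n * m) i)) (block_coef M n m j i).
Proof. by move=> inm; exact: mwrt_clip_grid. Qed.

(** A block consists of [m] cells of mesh [T / (n * m)], so the variance proxy is
    [M ^+ 2 * (T / n)], whatever [m]; adding 1 keeps it positive when [M = 0]. *)
Lemma block_integral_tail M n m j lam : (0 < n)%N -> (0 < m)%N -> (j < n)%N -> 0 < lam ->
  (P [set w | (lam <= `|block_integral M n m j w|)%R] <=
     (2 * expR (- (lam ^+ 2 / (2 * ((M%:R ^+ 2 + 1) * (T / n%:R))))))%:E)%E.
Proof.
move=> n0 m0 jn lam0; have nm0 : (0 < n * m)%N by rewrite muln_gt0 n0.
have M21 : 0 < M%:R ^+ 2 + 1 :> R by rewrite ltr_wpDl// sqr_ge0.
apply: (transform_tail P (n * m) _ _ _ (tick_filtration T F T0 fF _)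
  (incr_innov P T F T0 fF W bW _) (T / (n * m)%:R) (fun k kn => block_coef_wrt M n m j k (ltnW kn))
  (fun i => (i %/ m == j)%N%:R * M%:R)) => //.
- move=> k w kn; rewrite normrM ger0_norm// ler_wpM2l//; exact: clip_le.
- by move=> k c kn; exact: incr_mgf fF W bW _ _ _ kn.
- by rewrite mulr_gt0// mesh_gt0.
have -> : \sum_(k < n * m) ((k %/ m == j)%N%:R * M%:R) ^+ 2 = m%:R * M%:R ^+ 2 :> R.
  have -> : \sum_(k < n * m) ((k %/ m == j)%N%:R * M%:R) ^+ 2 =
     \sum_(k < n * m) (k %/ m == j)%N%:R * (M%:R ^+ 2) :> R.
    by apply: eq_bigr => k _; rewrite exprMn; case: (_ == _); rewrite ?expr1n ?expr0n.
  rewrite (block_sum n m j (fun=> M%:R ^+ 2))// !sumr_const !card_ord -mulrnBr.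
    by rewrite mulSn addnK mulr_natl.
  by rewrite leq_mul2r leqnSn orbT.
have -> : T / (n * m)%:R * (m%:R * M%:R ^+ 2) = M%:R ^+ 2 * (T / n%:R) :> R.
  by rewrite natrM; field; rewrite !pnatr_eq0 -!lt0n n0.
by rewrite ler_wpM2r ?mesh_ge0// lerDl.
Qed.

(** One [lam] pays for the distance to the block integral, exceeded with probability at most [p]
    once [m] is large, and the other for the block integral itself. The Gaussian bound is free of
    [m], so [m] may be as large as [n] and [p] demand. *)
Lemma ito_tail M n lam p : (0 < n)%N -> 0 < lam -> 0 < p ->
  exists B : set Omega, [/\ measurable B,
    [set w | exists2 j, (j < n)%N & 2 * lam < `|incr T n I j w|] `&` grid_bounded T H M `<=` B &
    (P B <= (p + n%:R * (2 * expR (- (lam ^+ 2 / (2 * ((M%:R ^+ 2 + 1) * (T / n%:R)))))))%:E)%E].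
Proof.
move=> n0 lam0 p0.
have [m _ /(_ m (leqnn m)) [B [mB sB PB]]] := incr_block_vanishing M n lam n0 lam0 p p0.
pose A j := [set w | (lam <= `|block_integral M n m.+1 j w|)%R].
have mA j : measurable (A j).
  apply: measurable_set_ge; apply: measurableT_comp => //.
  apply: measurable_sum => i; apply: measurable_funM.
    apply: mwrt_measurable (block_coef_wrt M n m.+1 j i (ltnW (ltn_ord i))).
    by apply: filtration_sub fF _ _; apply: tick_itv => //; exact/ltnW/ltn_ord.
  exact: incr_measurable fF W bW _ _ (ltn_ord i).
have PA k : (k <= n)%N -> exists C : set Omega, [/\ measurable C,
    (forall j, (j < k)%N -> A j `<=` C) &
    (P C <= (k%:R * (2 * expR (- (lam ^+ 2 / (2 * ((M%:R ^+ 2 + 1) * (T / n%:R)))))))%:E)%E].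
  elim: k => [|k IH] kn; first by exists set0; split => //; rewrite measure0 mul0r.
  have [C [mC AC PC]] := IH (ltnW kn).
  exists (C `|` A k); split; first exact: measurableU.
    move=> j; rewrite ltnS leq_eqVlt => /predU1P[->|jk] w Aw; [by right|left].
    exact: AC jk w Aw.
  apply: (le_trans (measureU2 P mC (mA k))); rewrite -natr1 mulrDl EFinD mul1r.
  by apply: leeD => //; exact: block_integral_tail.
have [C [mC AC PC]] := PA n (leqnn n).
exists (B `|` C); split; first exact: measurableU.
  move=> w [[j jn h] Hw]; have [Aw|nAw] := pselect (A j w); [by right; exact: AC jn w Aw|left].
  apply: sB; split => //; exists j => //.
  have lt : `|block_integral M n m.+1 j w| < lam by rewrite ltNge; apply/negP.
  have := ler_normB (incr T n I j w) (incr T n I j w - block_integral M n m.+1 j w).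
  rewrite subKr => _.
  have := ler_normD (incr T n I j w - block_integral M n m.+1 j w) (block_integral M n m.+1 j w).
  by rewrite subrK; move: h lt; lra.
by apply: (le_trans (measureU2 P mB mC)); rewrite EFinD; exact: leeD.
Qed.

(** [K] ranges over all positive constants because the variance proxy depends on the localization
    level: it is used at [8 * (M ^+ 2 + 1)], where 8 collects the halving of [lam n], squared, and
    the 2 of the Gaussian tail. *)
Lemma ito_small (lam : nat -> R) : (\forall n \near \oo, 0 < lam n) ->
  (forall K : R, 0 < K -> n%:R * expR (- (lam n ^+ 2 / (K * (T / n%:R)))) @[n --> \oo] --> (0 : R)) ->
  vanishing P (fun n => [set w | exists2 j, (j < n)%N & lam n < `|incr T n I j w|]).
Proof.
move=> lam0 hlam; apply: (vanishing_local P (grid_bounded T H)).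
- by move=> M; apply: measurable_grid_bounded => // t; exact: adapted_measurable fF aH.
- by move=> M; exact: grid_bounded_incr.
- exact: grid_bounded_all.
move=> M p p0; have p20 : 0 < p / 2 by rewrite divr_gt0.
have p40 : 0 < p / 4 by rewrite divr_gt0.
have M21 : 0 < M%:R ^+ 2 + 1 :> R by rewrite ltr_wpDl// sqr_ge0.
have K0 : 0 < 8 * (M%:R ^+ 2 + 1) :> R by rewrite mulr_gt0.
have /cvgrPdist_le/(_ _ p40) := hlam _ K0.
apply: filterS3 lam0 (nbhs_infty_gt 0%N) => n lamn n0; rewrite sub0r normrN => h.
have l20 : 0 < lam n / 2 by rewrite divr_gt0.
have [B [mB sB PB]] := ito_tail M n _ _ n0 l20 p20.
exists B; split => //.
  by move=> w [[j jn hj] Hw]; apply: sB; split => //; exists j => //; rewrite mulrC divfK.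
apply: (le_trans PB); rewrite lee_fin [leRHS]splitr lerD2l.
have -> : (lam n / 2) ^+ 2 / (2 * ((M%:R ^+ 2 + 1) * (T / n%:R))) =
   lam n ^+ 2 / (8 * (M%:R ^+ 2 + 1) * (T / n%:R)).
  by field; rewrite !gt_eqF ?ltr0n.
move: (le_trans (ler_norm _) h); lra.
Qed.

End ito.

Lemma young {R : realFieldType} (s x y : R) : 0 < s ->
  `|x * y| <= (s^-1 * x ^+ 2 + s * y ^+ 2) / 2.
Proof.
move=> s0; have s0' : s != 0 by rewrite gt_eqF.
have h : 0 <= s^-1 * (`|x| - s * `|y|) ^+ 2 by rewrite mulr_ge0 ?sqr_ge0// invr_ge0 ltW.
rewrite -[x ^+ 2]real_normK ?num_real// -[y ^+ 2]real_normK ?num_real// normrM.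
have : s^-1 * (`|x| - s * `|y|) ^+ 2 =
  s^-1 * `|x| ^+ 2 + s * `|y| ^+ 2 - 2 * (`|x| * `|y|) by field.
lra.
Qed.

Section ito_approximation.
Context {d : measure_display} {Omega : measurableType d} {R : realType}.
Variables (P : probability Omega R) (T : R) (F : R -> set (set Omega)).
Hypotheses (T0 : 0 < T) (fF : is_filtration T F).
Variables (W H I : R -> Omega -> R).
Hypotheses (bW : is_brownian P T F W) (aH : adapted T F H) (cH : cadlag_paths T H)
  (iI : is_ito_integral P T F W H I).
Notation L1 := (integrableRV P).
Notation E := (Ex P).

Let cl M n k w := clip (M%:R : R) (H (tick T n k) w).

Let gap M n m i w := cl M (n * m)%N i w - cl M n (coarse n (n * m) i) w.

Lemma coarse_mul n m i : (0 < n)%N -> coarse n (n * m) i = (i %/ m)%N.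
Proof. by move=> n0; rewrite /coarse mulnC divnMl. Qed.

Lemma block_gap M n m j w : (0 < n)%N -> (0 < m)%N -> (j < n)%N ->
  block_integral T W H M n m j w - cl M n j w * incr T n W j w =
  \sum_(i < n * m) ((i %/ m == j)%N%:R * gap M n m i w) * incr T (n * m) W i w.
Proof.
move=> n0 m0 jn.
have -> : incr T n W j w = \sum_(i < n * m) (i %/ m == j)%N%:R * incr T (n * m) W i w.
  rewrite (block_sum n m j (fun i => incr T (n * m) W i w) m0 jn) !sum_incr !tickM//.
  by rewrite /incr; ring.
rewrite mulr_sumr -sumrB; apply: eq_bigr => i _.
rewrite /block_coef /gap coarse_mul// /cl; have [->|_] := eqVneq (i %/ m)%N j.
  by ring.
by rewrite !mul0r mulr0 subr0.
Qed.

Lemma measurable_cl M n k : (k <= n)%N -> measurable_fun setT (cl M n k).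
Proof.
move=> kn; apply: (measurableT_comp (measurable_clip _)).
exact: adapted_measurable fF aH (tick_itv T n k T0 kn).
Qed.

(** The isometry block by block. A fine index [i] lies in the single block [i %/ m], so the double
    sum of second moments collapses to the mean of [grid_gap] between the two grids, and [K0] serves
    every [m]. *)
Lemma block_L2 M e : 0 < e -> exists K0, forall n m, (K0 < n)%N -> (0 < m)%N ->
  L1 (fun w => \sum_(j < n) (block_integral T W H M n m j w - cl M n j w * incr T n W j w) ^+ 2) /\
  E (fun w => \sum_(j < n) (block_integral T W H M n m j w - cl M n j w * incr T n W j w) ^+ 2) <= e.
Proof.
move=> e0; have [K0 hK0] := Ex_grid_gap P T F T0 fF H M e aH cH e0.
exists K0 => n m Kn m0; have n0 : (0 < n)%N by exact: leq_ltn_trans Kn.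
have [ig eg] := hK0 n (n * m)%N Kn (leq_pmulr n m0).
have nm0 : (0 < n * m)%N by rewrite muln_gt0 n0.
have mgap i : (i < n * m)%N -> measurable_fun setT (gap M n m i).
  move=> inm; apply: measurable_funB; apply: measurable_cl; first exact: ltnW.
  exact/ltnW/coarse_lt.
have gapM i w : `|gap M n m i w| <= 2 * M%:R.
  by apply: (le_trans (ler_normB _ _)); rewrite mulrDl mul1r lerD// clip_le.
have igap i : (i < n * m)%N -> L1 (fun w => gap M n m i w ^+ 2).
  move=> inm; apply: (L1_bounded _ _ ((2 * M%:R) ^+ 2)).
    by apply: measurable_funX; exact: mgap.
  by move=> w; rewrite normrX; apply: ler_sqr_ge0.
have wbeta j k : (k < n * m)%N ->
    measurable_wrt (F (tick T (n * m) k)) (fun w => (k %/ m == j)%N%:R * gap M n m k w).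
  move=> knm; have kT := tick_itv T (n * m) k T0 (ltnW knm).
  have sF := filtration_sigma fF kT.
  apply: (mwrt_comp _ _ (fun x => (k %/ m == j)%N%:R * x)); first exact: measurable_funM.
  apply: mwrtB => //; apply: (mwrt_comp _ _ (clip M%:R)); try exact: measurable_clip.
    exact: aH.
  have ckn : (coarse n (n * m) k <= n)%N by exact/ltnW/coarse_lt.
  apply: mwrt_mono (aH _ (tick_itv T n _ T0 ckn)).
  apply: (filtration_mono fF); [exact: tick_ge0|exact: coarse_le|exact: tick_le (ltnW knm)].
have L j : (j < n)%N ->
  L1 (fun w => (block_integral T W H M n m j w - cl M n j w * incr T n W j w) ^+ 2) /\
  E (fun w => (block_integral T W H M n m j w - cl M n j w * incr T n W j w) ^+ 2) <=
    T / (n * m)%:R * \sum_(i < n * m) (i %/ m == j)%N%:R * E (fun w => gap M n m i w ^+ 2).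
  move=> jn.
  have -> : (fun w => (block_integral T W H M n m j w - cl M n j w * incr T n W j w) ^+ 2) =
     (fun w => (\sum_(i < n * m) ((i %/ m == j)%N%:R * gap M n m i w) * incr T (n * m) W i w) ^+ 2).
    by apply/funext => w; rewrite block_gap.
  have bM k w : (k < n * m)%N -> `|(k %/ m == j)%N%:R * gap M n m k w| <= 2 * M%:R.
    move=> _; rewrite normrM ger0_norm// -[leRHS]mul1r ler_pM//.
    by case: (_ == _).
  have h1 k : (k < n * m)%N -> L1 (incr T (n * m) W k) /\ E (incr T (n * m) W k) = 0.
    by move=> knm; exact: incr_mean fF W bW _ _ knm.
  have h2 k : (k < n * m)%N -> L1 (fun w => incr T (n * m) W k w ^+ 2) /\
      E (fun w => incr T (n * m) W k w ^+ 2) <= T / (n * m)%:R.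
    by move=> knm; have [? ->] := incr_sqr P T F T0 fF W bW _ _ knm.
  have [i le] := transform_L2 P (n * m) _ _
    (fun k w => (k %/ m == j)%N%:R * gap M n m k w) (tick_filtration T F T0 fF _)
    (incr_innov P T F T0 fF W bW _) (T / (n * m)%:R) (wbeta j) (2 * M%:R) bM h1 h2
    (n * m)%N (leqnn _).
  split=> //; apply: (le_trans le); rewrite ler_wpM2l ?mesh_ge0//.
  apply: ler_sum => k _; rewrite -ExZ; last exact: igap.
  apply: le_of_eq; congr (Ex P _); apply/funext => w.
  by rewrite exprMn; case: (_ == _); rewrite ?expr1n ?expr0n.
split; first by apply: L1_sum => j _; have [] := L j (ltn_ord j).
rewrite Ex_sum; last by move=> j _; have [] := L j (ltn_ord j).
apply: le_trans eg; apply: (@le_trans _ _ (\sum_(j < n) T / (n * m)%:R *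
    \sum_(i < n * m) (i %/ m == j)%N%:R * E (fun w => gap M n m i w ^+ 2))).
  by apply: ler_sum => j _; have [] := L j (ltn_ord j).
rewrite -mulr_sumr exchange_big /= /grid_gap ExZ; last first.
  by apply: L1_sum => i _; exact: igap.
rewrite Ex_sum; last by move=> i _; exact: igap.
rewrite ler_wpM2l ?mesh_ge0//; apply: ler_sum => i _.
have im : (i %/ m < n)%N by rewrite ltn_divLR.
rewrite (bigD1 (Ordinal im))//= eqxx mul1r big1 ?addr0// => j ji.
rewrite (_ : (i %/ m == j)%N = false) ?mul0r//.
by apply/negbTE; apply: contra ji => /eqP ij; apply/eqP/val_inj.
Qed.

(** [m] is chosen after [n], so that all [n] increments of [I] are within [del] of the block
    integrals; [del] depends on [n] and makes the [n] squared errors add up to at most [eta / 4].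
    The choice is free because [block_L2] is uniform in [m]. *)
Lemma ito_increments : negl P (fun n w =>
  \sum_(k < n) (incr T n I k w - H (tick T n k) w * incr T n W k w) ^+ 2).
Proof.
apply: (negl_local P (grid_bounded T H)).
- by move=> M; apply: measurable_grid_bounded => // t; exact: adapted_measurable fF aH.
- by move=> M; exact: grid_bounded_incr.
- exact: grid_bounded_all.
move=> M eta eta0 p p0; have p20 : 0 < p / 2 by rewrite divr_gt0.
have e0 : 0 < p / 2 * (eta / 4) by rewrite mulr_gt0// divr_gt0.
have [K0 hK0] := block_L2 M _ e0.
exists K0.+1 => // n /= Kn; have n0 : (0 < n)%N by exact: leq_ltn_trans Kn.
pose del : R := Num.min 1 (eta / 4 / n%:R).
have del0 : 0 < del by rewrite lt_min ltr01 !divr_gt0// ltr0n.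
have del2 : n%:R * del ^+ 2 <= eta / 4.
  rewrite mulrC -ler_pdivlMr ?ltr0n// (@le_trans _ _ del)//; last by rewrite ge_min lexx orbT.
  by rewrite expr2 ler_piMr ?(ltW del0)// ge_min lexx.
have [m _ /(_ m (leqnn m)) [B [mB sB PB]]] :=
  incr_block_vanishing P T F T0 fF W H I bW aH cH iI M n del n0 del0 _ p20.
have [iX eX] := hK0 n m.+1 Kn isT.
set X := (fun w => \sum_(j < n) _) in iX eX.
have X0 w : 0 <= X w by apply: sumr_ge0 => j _; exact: sqr_ge0.
pose C := [set w | (eta / 4 <= X w)%R].
have mC : measurable C by apply: measurable_set_ge; exact: (L1_measurable P _ iX).
have eta4 : 0 < eta / 4 by rewrite divr_gt0.
have PC : (P C <= (p / 2)%:E)%E.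
  apply: (le_trans (markov_Ex P _ _ iX X0 eta4)).
  by rewrite lee_fin ler_pdivrMr.
exists (B `|` C); split; first exact: measurableU; last first.
  by apply: (le_trans (measureU2 P mB mC)); rewrite [p in leRHS]splitr EFinD; exact: leeD.
move=> w [/= + Hw]; rewrite ger0_norm; last by apply: sumr_ge0 => j _; exact: sqr_ge0.
move=> h; have [Cw|nCw] := pselect (C w); [by right|left].
have Xw : X w < eta / 4 by rewrite ltNge; apply/negP.
apply: contrapT => nBw.
have small j : (j < n)%N -> `|incr T n I j w - block_integral T W H M n m.+1 j w| <= del.
  move=> jn; rewrite leNgt; apply/negP => dj; apply: nBw; apply: sB.
  by split => //; exists j.
move: h; apply/negP; rewrite -leNgt.
apply: (@le_trans _ _ (\sum_(k < n) (2 * del ^+ 2 + 2 * (block_integral T W H M n m.+1 k w -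
    cl M n k w * incr T n W k w) ^+ 2))).
  apply: ler_sum => k _; rewrite /cl (grid_bounded_clip T _ _ _ Hw) ?(ltnW (ltn_ord k))//.
  set a := incr T n I k w; set b := block_integral _ _ _ _ _ _ _ _; set c := _ * _.
  have : (a - b) ^+ 2 <= del ^+ 2.
    by rewrite -[leLHS]real_normK ?num_real//; apply: ler_sqr_ge0 => //; exact: small.
  have : 0 <= (a - b - (b - c)) ^+ 2 by exact: sqr_ge0.
  nra.
rewrite big_split /= sumr_const card_ord -mulr_sumr -/(X w) -[_ *+ n]mulr_natl.
by move: del2 Xw; lra.
Qed.

End ito_approximation.

(** * Products of increments of independent Brownian motions *)

Section orthogonality.
Context {d : measure_display} {Omega : measurableType d} {R : realType}.
Variables (P : probability Omega R) (T : R) (F : R -> set (set Omega)).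
Hypotheses (T0 : 0 < T) (fF : is_filtration T F).
Variables (W1 W3 : R -> Omega -> R).
Hypotheses (b1 : is_brownian P T F W1) (b3 : is_brownian P T F W3)
  (i13 : independent_processes P T W1 W3).
Notation L1 := (integrableRV P).
Notation E := (Ex P).

Lemma incr_cross W n k l : is_brownian P T F W -> (k < n)%N -> (l < n)%N ->
  L1 (fun w => incr T n W k w * incr T n W l w) /\
  E (fun w => incr T n W k w * incr T n W l w) = (k == l)%:R * (T / n%:R).
Proof.
move=> bW; wlog kl : k l / (k <= l)%N.
  move=> h kn ln; have [/h|/ltnW lk] := leqP k l; first exact.
  have [i e] := h l k lk ln kn.
  have C : (fun w => incr T n W k w * incr T n W l w) = (fun w => incr T n W l w * incr T n W k w).
    by apply/funext => w; rewrite mulrC.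
  by rewrite C eq_sym.
move=> kn ln; have [<-|nkl] := eqVneq k l.
  have [i e] := incr_sqr P T F T0 fF W bW n k kn.
  have C : (fun w => incr T n W k w * incr T n W k w) = (fun w => incr T n W k w ^+ 2).
    by apply/funext => w; rewrite expr2.
  by rewrite C mul1r.
have kltl : (k < l)%N by rewrite ltn_neqAle nkl.
have [ik ek] := incr_mean P T F T0 fF W bW n k kn.
have [il el] := incr_mean P T F T0 fF W bW n l ln.
have ind : indep P (incr T n W k) (incr T n W l).
  move=> A B mA mB; apply: (innov_indep _ _ _ _ (incr_innov P T F T0 fF W bW n)) => //.
  have := innov_wrt _ _ _ _ (incr_innov P T F T0 fF W bW n) _ kn A mA.
  apply: (filtration_mono fF); [exact: tick_ge0|exact: ler_tick|exact: tick_le (ltnW ln)].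
have [i e] := indep_Ex P _ _ ind ik il.
by rewrite e ek mul0r mul0r.
Qed.

Lemma incr_sigma_process (W : R -> Omega -> R) n k : (k < n)%N ->
  measurable_wrt (sigma_process T W) (incr T n W k).
Proof.
move=> kn; have sG : sigma_algebra setT (sigma_process T W) by exact: smallest_sigma_algebra.
have h j : (j <= n)%N -> measurable_wrt (sigma_process T W) (W (tick T n j)).
  move=> jn B mB; apply: sub_sigma_algebra; exists (tick T n j), B; split => //.
  exact: tick_itv.
by apply: mwrtB => //; apply: h => //; exact: ltnW.
Qed.

Lemma incr_quad n k l : (k < n)%N -> (l < n)%N ->
  L1 (fun w => (incr T n W1 k w * incr T n W1 l w) * (incr T n W3 k w * incr T n W3 l w)) /\
  E (fun w => (incr T n W1 k w * incr T n W1 l w) * (incr T n W3 k w * incr T n W3 l w)) =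
    (k == l)%:R * (T / n%:R) ^+ 2.
Proof.
move=> kn ln; have [i1 e1] := incr_cross W1 n k l b1 kn ln.
have [i3 e3] := incr_cross W3 n k l b3 kn ln.
have ind : indep P (fun w => incr T n W1 k w * incr T n W1 l w)
    (fun w => incr T n W3 k w * incr T n W3 l w).
  have sG (W : R -> Omega -> R) : sigma_algebra setT (sigma_process T W) by exact: smallest_sigma_algebra.
  have w2 (W : R -> Omega -> R) : measurable_wrt (sigma_process T W) (fun w => incr T n W k w * incr T n W l w).
    exact: (mwrtM _ _ _ (sG W) (incr_sigma_process W n k kn) (incr_sigma_process W n l ln)).
  by move=> A B mA mB; apply: i13; exact: w2.
have [i e] := indep_Ex P _ _ ind i1 i3.
by split => //; rewrite e e1 e3; case: (_ == _); rewrite ?mul1r ?mul0r// expr2.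
Qed.

(** Independence of the two processes splits the mean of a product of four increments into two
    covariances, which vanish off the diagonal. Deterministic weights leave this splitting
    intact. *)
Lemma orth_L2 n (a : nat -> bool) :
  L1 (fun w => (\sum_(k < n) (a k)%:R * (incr T n W1 k w * incr T n W3 k w)) ^+ 2) /\
  E (fun w => (\sum_(k < n) (a k)%:R * (incr T n W1 k w * incr T n W3 k w)) ^+ 2) <=
    n%:R * (T / n%:R) ^+ 2.
Proof.
have -> : (fun w => (\sum_(k < n) (a k)%:R * (incr T n W1 k w * incr T n W3 k w)) ^+ 2) =
  (fun w => \sum_(k < n) \sum_(l < n) ((a k)%:R * (a l)%:R) *
    ((incr T n W1 k w * incr T n W1 l w) * (incr T n W3 k w * incr T n W3 l w))).
  apply/funext => w; rewrite expr2 mulr_suml; apply: eq_bigr => k _.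
  by rewrite mulr_sumr; apply: eq_bigr => l _; ring.
have iq (k l : 'I_n) : L1 (fun w => ((a k)%:R * (a l)%:R) *
    ((incr T n W1 k w * incr T n W1 l w) * (incr T n W3 k w * incr T n W3 l w))).
  by apply: L1Z; have [] := incr_quad n k l (ltn_ord k) (ltn_ord l).
split; first by apply: L1_sum => k _; apply: L1_sum => l _.
rewrite Ex_sum; last by move=> k _; apply: L1_sum => l _.
have -> : n%:R * (T / n%:R) ^+ 2 = \sum_(k < n) (T / n%:R) ^+ 2.
  by rewrite sumr_const card_ord mulr_natl.
apply: ler_sum => k _; rewrite Ex_sum// (bigD1 k)//= big1 ?addr0; last first.
  move=> l lk; have [i e] := incr_quad n k l (ltn_ord k) (ltn_ord l).
  rewrite ExZ// e (_ : (k == l :> nat) = false) ?mul0r ?mulr0//.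
  by apply/negbTE; rewrite eq_sym.
have [i e] := incr_quad n k k (ltn_ord k) (ltn_ord k).
by rewrite ExZ// e eqxx; case: (a k); rewrite ?mul1r ?mul0r ?sqr_ge0.
Qed.

(* Freezing c on a coarse grid leaves finitely many unweighted sums, which vanish by
   independence of W1 and W3; the freezing error is controlled by grid_gap. *)
Lemma orthogonal_variation c t : adapted T F c -> cadlag_paths T c ->
  negl P (fun n w => \sum_(k < n) (obs T t n k)%:R *
     (c (tick T n k) w * (incr T n W1 k w * incr T n W3 k w))).
Proof.
move=> ac cc; apply: (negl_local P (grid_bounded T c)).
- by move=> M; apply: measurable_grid_bounded => // s; exact: adapted_measurable fF ac.
- by move=> M; exact: grid_bounded_incr.
- exact: grid_bounded_all.
move=> M eta eta0 p p0.
pose cl n k w := clip (M%:R : R) (c (tick T n k) w).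
have p40 : 0 < p / 4 by rewrite divr_gt0.
have eta20 : 0 < eta / 2 by rewrite divr_gt0.
(* theta T <= (eta / 2) (p / 4) and theta^-1 e1 <= (eta / 2) (p / 4) *)
pose q := eta / 2 * (p / 4).
have q0 : 0 < q by rewrite mulr_gt0.
pose th := q / T.
have th0 : 0 < th by rewrite divr_gt0.
have e10 : 0 < th * q by rewrite mulr_gt0.
have [K0 hK0] := Ex_grid_gap P T F T0 fF c M _ ac cc e10.
pose K := K0.+1; have Kp : (0 < K)%N by [].
pose Rs n l w := \sum_(k < n) (obs T t n k && (coarse K n k == l)%N)%:R *
  (incr T n W1 k w * incr T n W3 k w).
have vR l : vanishing P (fun n => [set w | eta / 2 / (K%:R * (M%:R + 1)) < `|Rs n l w|]).
  have KM : 0 < K%:R * (M%:R + 1) :> R by rewrite mulr_gt0 ?ltr0n// ltr_wpDl.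
  apply: (vanishing_sub P _ (fun n => [set w | eta / 2 / (K%:R * (M%:R + 1)) < `|Rs n l w|] `&` setT)).
    by near=> n => w.
  apply: (vanishing_L2 P (fun n => Rs n l)) => //.
  - by near=> n; have [] := orth_L2 n (fun k => obs T t n k && (coarse K n k == l)%N).
  - apply: squeeze0 (cvg_cst_mesh T T).
      by move=> n; apply: Ex_ge0 => w; exact: sqr_ge0.
    near=> n; have n0 : (0 < n)%N by near: n; exact: nbhs_infty_gt.
    have [_] := orth_L2 n (fun k => obs T t n k && (coarse K n k == l)%N).
    move=> /le_trans; apply; apply: le_of_eq; field.
    by rewrite pnatr_eq0 -lt0n.
  - by rewrite divr_gt0.
have p20 : 0 < p / 2 by rewrite divr_gt0.
have := vanishing_exists P K (fun l n => [set w | eta / 2 / (K%:R * (M%:R + 1)) < `|Rs n l w|])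
   (fun l _ => vR l) _ p20.
apply: filterS2 (nbhs_infty_ge K) => n Kn [B [mB sB PB]].
have n0 : (0 < n)%N by exact: leq_trans Kn.
have [igap egap] := hK0 K n (leqnn _) Kn.
pose gap k w := cl n k w - cl K (coarse K n k) w.
pose X w := \sum_(k < n) (gap k w * incr T n W1 k w) ^+ 2.
pose Y w := \sum_(k < n) incr T n W3 k w ^+ 2.
have mcl N k : (k <= N)%N -> measurable_fun setT (cl N k).
  move=> kN; apply: (measurableT_comp (measurable_clip _)).
  exact: adapted_measurable fF ac (tick_itv T N k T0 kN).
have gapM k w : `|gap k w| <= 2 * M%:R.
  by apply: (le_trans (ler_normB _ _)); rewrite mulrDl mul1r lerD// clip_le.
(* The coarse point does not exceed [tick T n k], so the freezing error is known at the start of the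
   increment. *)
have wgap k : (k < n)%N -> measurable_wrt (F (tick T n k)) (gap k).
  move=> kn; have kT := tick_itv T n k T0 (ltnW kn); have sF := filtration_sigma fF kT.
  apply: mwrtB => //; apply: (mwrt_comp _ _ (clip M%:R)); try exact: measurable_clip.
    exact: ac.
  have ckn : (coarse K n k <= K)%N by exact/ltnW/coarse_lt.
  apply: mwrt_mono (ac _ (tick_itv T K _ T0 ckn)).
  apply: (filtration_mono fF); [exact: tick_ge0|exact: coarse_le|exact: tick_le (ltnW kn)].
have igap2 k : (k < n)%N -> L1 (fun w => gap k w ^+ 2).
  move=> kn; apply: (L1_bounded _ _ ((2 * M%:R) ^+ 2)).
    apply: measurable_funX; apply: measurable_funB; apply: mcl; first exact: ltnW.
    exact/ltnW/coarse_lt.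
  by move=> w; rewrite normrX; apply: ler_sqr_ge0.
have iX1 k : (k < n)%N -> L1 (fun w => (gap k w * incr T n W1 k w) ^+ 2) /\
    E (fun w => (gap k w * incr T n W1 k w) ^+ 2) = E (fun w => gap k w ^+ 2) * (T / n%:R).
  move=> kn; have [i2 e2] := incr_sqr P T F T0 fF W1 b1 n k kn.
  have m2 : measurable_fun setT (fun x : R => x ^+ 2) by exact: measurable_funX.
  have ind := indep_innov P n _ _ (incr_innov P T F T0 fF W1 b1 n) k _ _ kn
    (mwrt_comp _ _ _ m2 (wgap k kn)) m2.
  have [i e] := indep_Ex P _ _ ind (igap2 k kn) i2.
  have -> : (fun w => (gap k w * incr T n W1 k w) ^+ 2) =
     (fun w => gap k w ^+ 2 * incr T n W1 k w ^+ 2) by apply/funext => w; rewrite exprMn.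
  by rewrite e e2.
have iX : L1 X by apply: L1_sum => k _; have [] := iX1 k (ltn_ord k).
have eX : E X <= th * q.
  apply: le_trans egap; rewrite Ex_sum; last by move=> k _; have [] := iX1 k (ltn_ord k).
  rewrite /grid_gap ExZ; last by apply: L1_sum => k _; exact: igap2.
  rewrite Ex_sum; last by move=> k _; exact: igap2.
  rewrite mulr_sumr; apply: ler_sum => k _.
  by have [_ ->] := iX1 k (ltn_ord k); rewrite mulrC.
have iY : L1 Y by apply: L1_sum => k _; have [] := incr_sqr P T F T0 fF W3 b3 n k (ltn_ord k).
have eY : E Y = T.
  rewrite Ex_sum; last by move=> k _; have [] := incr_sqr P T F T0 fF W3 b3 n k (ltn_ord k).
  rewrite (eq_bigr (fun=> T / n%:R)); last first.
    by move=> k _; have [_ ->] := incr_sqr P T F T0 fF W3 b3 n k (ltn_ord k).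
  by rewrite sumr_const card_ord -[_ *+ n]mulr_natl mulrC divfK// pnatr_eq0 -lt0n.
pose Z w := (th^-1 * X w + th * Y w) / 2.
have iZ0 := L1D P _ _ (L1Z P th^-1 _ iX) (L1Z P th _ iY).
have iZ : L1 Z.
  rewrite (_ : Z = fun w => 2^-1 * (th^-1 * X w + th * Y w)); first exact: L1Z.
  by apply/funext => w; rewrite mulrC.
have eZ : E Z <= q.
  rewrite (_ : Z = fun w => 2^-1 * (th^-1 * X w + th * Y w)); last first.
    by apply/funext => w; rewrite mulrC.
  rewrite ExZ// ExD; [|exact: L1Z|exact: L1Z].
  rewrite !ExZ// eY /th divfK ?gt_eqF//.
  have : (q / T)^-1 * E X <= q by rewrite mulrC ler_pdivrMr ?divr_gt0// mulrC.
  lra.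
have X0 w : 0 <= X w by apply: sumr_ge0 => k _; exact: sqr_ge0.
have Y0 w : 0 <= Y w by apply: sumr_ge0 => k _; exact: sqr_ge0.
have Z0 w : 0 <= Z w by rewrite divr_ge0// addr_ge0// mulr_ge0// ?invr_ge0 ltW.
pose C := [set w | (eta / 2 <= Z w)%R].
have mC : measurable C by apply: measurable_set_ge; exact: (L1_measurable P _ iZ).
have PC : (P C <= (p / 4)%:E)%E.
  apply: (le_trans (markov_Ex P _ _ iZ Z0 eta20)).
  by rewrite lee_fin ler_pdivrMr// mulrC.
exists (B `|` C); split; first exact: measurableU; last first.
  apply: (le_trans (measureU2 P mB mC)); apply: (le_trans (leeD PB PC)).
  by rewrite -EFinD lee_fin; lra.
move=> w [/= h Hw]; have [Cw|nCw] := pselect (C w); [by right|left].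
have Zw : Z w < eta / 2 by rewrite ltNge; apply/negP.
apply: contrapT => nBw; move: h; apply/negP; rewrite -leNgt.
have small l : (l < K)%N -> `|Rs n l w| <= eta / 2 / (K%:R * (M%:R + 1)).
  move=> lK; rewrite leNgt; apply/negP => dl; apply: nBw; apply: sB.
  by exists l.
have -> : \sum_(k < n) (obs T t n k)%:R * (c (tick T n k) w * (incr T n W1 k w * incr T n W3 k w)) =
    \sum_(k < n) (obs T t n k)%:R * ((gap k w * incr T n W1 k w) * incr T n W3 k w) +
    \sum_(l < K) cl K l w * Rs n l w.
  have -> : \sum_(l < K) cl K l w * Rs n l w =
     \sum_(k < n) (obs T t n k)%:R * (cl K (coarse K n k) w * (incr T n W1 k w * incr T n W3 k w)).
    rewrite /Rs; under eq_bigr do rewrite mulr_sumr.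
    rewrite exchange_big /=; apply: eq_bigr => k _.
    have ck : (coarse K n k < K)%N by exact: coarse_lt.
    rewrite (bigD1 (Ordinal ck))//= eqxx andbT big1 ?addr0; first by ring.
    move=> l lk; rewrite (_ : (coarse K n k == l)%N = false) ?andbF ?mul0r ?mulr0//.
    by apply/negbTE; apply: contra lk => /eqP kl; apply/eqP/val_inj.
  rewrite -big_split /=; apply: eq_bigr => k _; rewrite /gap /cl.
  by rewrite (grid_bounded_clip T _ _ _ Hw) ?(ltnW (ltn_ord k))//; ring.
rewrite [eta in leRHS]splitr; apply: (le_trans (ler_normD _ _)); apply: lerD.
  apply: le_trans (ltW Zw); apply: (le_trans (ler_norm_sum _ _ _)).
  rewrite /Z /X /Y !mulr_sumr -big_split /= mulr_suml; apply: ler_sum => k _.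
  set x := gap k w * _; set y := incr T n W3 k w.
  apply: (@le_trans _ _ `|x * y|).
    by rewrite normrM ger0_norm// ler_piMl//; case: (obs T t n k).
  exact: young.
apply: (le_trans (ler_norm_sum _ _ _)).
apply: (@le_trans _ _ (\sum_(l < K) (M%:R + 1) * (eta / 2 / (K%:R * (M%:R + 1))))).
  apply: ler_sum => l _; rewrite normrM; apply: ler_pM => //; last exact: small.
  by apply: (@le_trans _ _ M%:R); [exact: clip_le|rewrite lerDl].
rewrite sumr_const card_ord -[_ *+ K]mulr_natl mulrA mulrC divfK//.
by rewrite gt_eqF// mulr_gt0 ?ltr0n// ltr_wpDl.
Unshelve. all: by end_near. Qed.

End orthogonality.

(** * Threshold estimators *)

Section threshold.
Context {R : realType}.
Variables (T : R) (r : R -> R).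
Hypotheses (T0 : 0 < T) (hr_pos : \forall h \near 0^'+, 0 < r h)
  (hr0 : r h @[h --> 0^'+] --> (0 : R))
  (hr_log : h * ln (1 / h) / r h @[h --> 0^'+] --> (0 : R)).

Lemma near_mesh (Q : R -> Prop) : (\forall h \near 0^'+, Q h) ->
  \forall n \near \oo, Q (T / n%:R).
Proof.
rewrite /at_right near_withinE => /nbhs_ballP[e /= e0 he].
apply: filterS2 (mesh_small T e e0) (nbhs_infty_gt 0%N) => n hn n0.
have h0 := mesh_gt0 T n T0 n0; apply: he => //.
by rewrite /ball /= sub0r normrN ger0_norm// ltW.
Qed.

Lemma mesh_threshold_pos : \forall n \near \oo, 0 < r (T / n%:R).
Proof. exact: (near_mesh (fun h => 0 < r h) hr_pos). Qed.

Lemma mesh_threshold0 : r (T / n%:R) @[n --> \oo] --> (0 : R).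
Proof.
apply/cvgrPdist_lt => e e0; have /cvgrPdist_lt/(_ e e0) h := hr0.
exact: (near_mesh _ h).
Qed.

Lemma mesh_log e : 0 < e -> \forall n \near \oo,
  T / n%:R * ln (1 / (T / n%:R)) <= e * r (T / n%:R).
Proof.
move=> e0; have /cvgrPdist_lt/(_ e e0) h := hr_log.
apply: filterS2 (near_mesh _ h) mesh_threshold_pos => n /= hn rn.
rewrite -ler_pdivrMr//; apply/ltW; apply: le_lt_trans hn.
by rewrite sub0r normrN ler_norm.
Qed.

Lemma ln_mesh_ge (K : R) : \forall n \near \oo, K <= ln (1 / (T / n%:R)).
Proof.
apply: filterS2 (nbhs_infty_gt 0%N) (mesh_small T _ (expR_gt0 (- K))) => n n0 h.
have h0 := mesh_gt0 T n T0 n0.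
rewrite -(expRK K) ler_ln ?posrE ?expR_gt0 ?divr_gt0 ?ltr0n//.
rewrite div1r -[leLHS]invrK lef_pV2 ?posrE ?invr_gt0 ?expR_gt0//.
by rewrite -expRN ltW.
Qed.

(** Eventually [ln (1 / h) >= 1], so the logarithmic hypothesis already contains [h = o(r h)], which
    handles the drift. *)
Lemma mesh_over_threshold (K : R) : K * (T / n%:R) / r (T / n%:R) @[n --> \oo] --> (0 : R).
Proof.
apply/cvgrPdist_le => e e0.
have d0 : 0 < e / (`|K| + 1) by rewrite divr_gt0// ltr_wpDl.
near=> n; rewrite sub0r normrN normrM normfV normrM.
have n0 : (0 < n)%N by near: n; exact: nbhs_infty_gt.
have h0 := mesh_gt0 T n T0 n0.
have rn : 0 < r (T / n%:R) by near: n; exact: mesh_threshold_pos.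
have ln1 : 1 <= ln (1 / (T / n%:R)) by near: n; exact: ln_mesh_ge.
have lg : T / n%:R * ln (1 / (T / n%:R)) <= e / (`|K| + 1) * r (T / n%:R).
  by near: n; exact: mesh_log.
rewrite (ger0_norm (ltW h0)) (ger0_norm (ltW rn)) ler_pdivrMr//.
have hl : T / n%:R <= e / (`|K| + 1) * r (T / n%:R).
  by apply: le_trans lg; rewrite ler_peMr// ltW.
apply: (@le_trans _ _ ((`|K| + 1) * (e / (`|K| + 1) * r (T / n%:R)))).
  by apply: ler_pM; rewrite ?(ltW h0)// lerDl.
by rewrite mulrA [_ * (e / _)]mulrC divfK// gt_eqF// ltr_wpDl.
Unshelve. all: by end_near. Qed.

(** Once [8 * K * (h * ln (1 / h)) <= r h], the exponent is at most [2 * ln h]; the exponential is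
    then at most [h ^+ 2], and [n * h ^+ 2 = T * h]. *)
Lemma exp_threshold (K : R) : 0 < K ->
  n%:R * expR (- ((Num.sqrt (r (T / n%:R)) / 2) ^+ 2 / (K * (T / n%:R))))
    @[n --> \oo] --> (0 : R).
Proof.
move=> K0; have e0 : 0 < (8 * K)^-1 by rewrite invr_gt0 mulr_gt0.
apply: squeeze0 (cvg_cst_mesh T T).
  by move=> n; rewrite mulr_ge0// expR_ge0.
apply: filterS3 (nbhs_infty_gt 0%N) mesh_threshold_pos (mesh_log _ e0) => n n0 rn lg.
have h0 := mesh_gt0 T n T0 n0.
set h := T / n%:R in h0 rn lg *.
have -> : T * h = n%:R * h ^+ 2 by rewrite /h; field; rewrite pnatr_eq0 -lt0n.
rewrite ler_wpM2l//.
rewrite -[h in leRHS]lnK ?posrE// -expRM_natl ler_expR.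
rewrite exprMn sqr_sqrtr ?(ltW rn)//.
rewrite lerNl -mulrN -lnV ?posrE// -[h^-1]div1r.
rewrite ler_pdivlMr ?(mulr_gt0 K0 h0)//.
have : 8 * K * (h * ln (1 / h)) <= r h.
  by rewrite -ler_pdivlMl ?mulr_gt0.
move: (ln _) => l; lra.
Qed.

End threshold.

(** * Drift and measurability of coefficients *)

Section drift.
Context {R : realType}.

Lemma Rintegral_lipschitz (f : R -> R) T M u v : regulated T f ->
  (forall x, 0 <= x <= T -> `|f x| <= M) -> 0 <= u -> u <= v -> v <= T ->
  `|\int[lebesgue_measure]_(s in `[0, v]) f s - \int[lebesgue_measure]_(s in `[0, u]) f s|
    <= M * (v - u).
Proof.
move=> rf fM u0 uv vT; have rfv := regulated_sub _ _ _ vT rf.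
have iv := regulated_integrable _ _ rfv.
rewrite Rintegral_itvB ?bnd_simp//.
have sub : `]u, v] `<=` `[0, v].
  by move=> s /=; rewrite !in_itv/= => /andP[us ->]; rewrite (le_trans u0 (ltW us)).
have iuv : (@lebesgue_measure R).-integrable `]u, v] (EFin \o f).
  by apply: integrableS iv.
apply: (le_trans (le_normr_Rintegral _ iuv)) => //.
have icst : (@lebesgue_measure R).-integrable `]u, v] (EFin \o (fun=> M)).
  apply: measurable_bounded_integrable => //.
    by rewrite /= lebesgue_measure_itv/=; case: ifP => //; rewrite ltry.
  by exists `|M|; split; [exact: num_real|move=> M' MM' w _ /=; exact: ltW].
apply: (@le_trans _ _ (\int[lebesgue_measure]_(s in `]u, v]) M)).
  apply: le_Rintegral => //; first exact: (integrable_norm iuv).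
  move=> s /= /sub; rewrite /= in_itv/= => /andP[s0 sv]; apply: fM.
  by rewrite s0 (le_trans sv).
rewrite Rintegral_cst//= lebesgue_measure_itv/= lte_fin.
move: uv; rewrite le_eqVlt => /predU1P[->|uv]; first by rewrite ltxx mulr0 subrr mulr0.
by rewrite uv -EFinD.
Qed.

Lemma measurable_inv : measurable_fun setT (fun x : R => x^-1).
Proof.
rewrite -(setUv [set 0]); apply/measurable_funU => //; first exact: measurableC.
split; first exact: measurable_fun_set1.
apply: open_continuous_measurable_fun.
  by rewrite openC; exact: closed_eq.
by move=> x; rewrite inE /= => /eqP x0; exact: inv_continuous.
Qed.

End drift.

Section adapted_calculus.
Context {d : measure_display} {Omega : measurableType d} {R : realType}.
Variables (T : R) (F : R -> set (set Omega)).
Hypothesis fF : is_filtration T F.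
Implicit Types X Y : R -> Omega -> R.

Lemma adaptedM X Y : adapted T F X -> adapted T F Y ->
  adapted T F (fun t w => X t w * Y t w).
Proof.
move=> aX aY t tT; apply: mwrtM; [exact: filtration_sigma fF _ tT|exact: aX|exact: aY].
Qed.

Lemma adapted_comp X (g : R -> R) : continuous g -> adapted T F X ->
  adapted T F (fun t w => g (X t w)).
Proof.
move=> cg aX t tT; apply: (mwrt_comp _ _ g); last exact: aX.
exact: continuous_measurable_fun.
Qed.

Lemma cadlag_pathsM X Y : cadlag_paths T X -> cadlag_paths T Y ->
  cadlag_paths T (fun t w => X t w * Y t w).
Proof. by move=> cX cY w; exact: (cadlagM T (X^~ w) (Y^~ w) (cX w) (cY w)). Qed.

Lemma cadlag_paths_comp X (g : R -> R) : continuous g -> cadlag_paths T X ->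
  cadlag_paths T (fun t w => g (X t w)).
Proof. by move=> cg cX w; exact: (cadlag_comp T (X^~ w) g cg (cX w)). Qed.

End adapted_calculus.

Lemma continuous_sqrt1B {R : realType} : continuous (fun x : R => Num.sqrt (1 - x ^+ 2)).
Proof.
move=> x; apply: (@continuous_comp _ _ _ (fun x : R => 1 - x ^+ 2) Num.sqrt).
  by apply: cvgB; [exact: cvg_cst|exact: exprn_continuous].
exact: sqrt_continuous.
Qed.

(** * Continuous parts and truncation of jumps *)

Section jump_diffusions.
Context {d : measure_display} {Omega : measurableType d} {R : realType}.
Variables (P : probability Omega R) (T : R) (F : R -> set (set Omega)).
Hypotheses (T0 : 0 < T) (fF : is_filtration T F).

Lemma negl_ae (N : set Omega) U V : P.-negligible N ->
  (forall n w, ~ N w -> `|V n w| <= `|U n w|) -> negl P U -> negl P V.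
Proof.
move=> nN UV nU e e0.
apply: vanishing_sub (vanishingU P _ _ (vanishing_null P _ nN) (nU e e0)).
near=> n => w /= h; have [Nw|nNw] := pselect (N w); [by left|right].
exact: lt_le_trans (UV n w nNw).
Unshelve. all: by end_near. Qed.

(** The bound on [a], and with it [C], depends on the path, which is enough for [negl_pointwise]. *)
Lemma drift_sum (a : R -> Omega -> R) : cadlag_paths T a ->
  forall w, exists C : R, forall n,
    \sum_(k < n) incr T n (time_integral a) k w ^+ 2 <= C * (T / n%:R).
Proof.
move=> ca w; have [M hM] := cadlag_bounded T (a^~ w) T0 (ca w).
exists (M ^+ 2 * T) => n; have [->|n0] := posnP n; first by rewrite big_ord0 invr0 !mulr0.
have -> : M ^+ 2 * T * (T / n%:R) = \sum_(k < n) (M * (T / n%:R)) ^+ 2.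
  rewrite sumr_const card_ord -[_ *+ n]mulr_natl; field.
  by rewrite pnatr_eq0 -lt0n.
apply: ler_sum => k _; rewrite -[leLHS]real_normK ?num_real//.
apply: ler_sqr_ge0 => //.
have := Rintegral_lipschitz (a^~ w) T M (tick T n k) (tick T n k.+1)
  (cadlag_regulated T _ T0 (ca w)) hM (tick_ge0 T n k T0) (ler_tick T n k k.+1 T0 (leqnSn k))
  (tick_le T n k.+1 T0 (ltn_ord k)).
have -> : tick T n k.+1 - tick T n k = T / n%:R by rewrite tickS addrAC subrr add0r.
exact.
Qed.

Lemma measurable_drift_sum (a : R -> Omega -> R) n : adapted T F a -> cadlag_paths T a ->
  measurable_fun setT (fun w => \sum_(k < n) incr T n (time_integral a) k w ^+ 2).
Proof.
move=> aa ca; apply: measurable_sum => k; apply: measurable_funX.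
have mA t : 0 <= t <= T -> measurable_fun setT (time_integral a t).
  move=> tT; have [] := riemann_negl P T T0 a t ca _ tT => //.
  by move=> s; exact: adapted_measurable fF aa.
by apply: measurable_funB; apply: mA; apply: tick_itv => //; exact: ltnW.
Qed.

Section continuous_part.
Variables (W a sigma I : R -> Omega -> R).
Hypotheses (bW : is_brownian P T F W) (aa : adapted T F a) (ca : cadlag_paths T a)
  (as_ : adapted T F sigma) (cs : cadlag_paths T sigma)
  (iI : is_ito_integral P T F W sigma I).

Let Y t w := time_integral a t w + I t w.

Lemma incr_cont n k w : incr T n Y k w = incr T n (time_integral a) k w + incr T n I k w.
Proof. by rewrite /incr /Y; ring. Qed.

Lemma continuous_part_approx : negl P (fun n w =>
  \sum_(k < n) (incr T n Y k w - sigma (tick T n k) w * incr T n W k w) ^+ 2).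
Proof.
pose D n w := \sum_(k < n) incr T n (time_integral a) k w ^+ 2.
pose A n w := \sum_(k < n) (incr T n I k w - sigma (tick T n k) w * incr T n W k w) ^+ 2.
have nD : negl P D.
  apply: negl_pointwise => [n|w]; first exact: measurable_drift_sum.
  have [C hC] := drift_sum a ca w.
  apply: squeeze0 (cvg_cst_mesh T C); last by near=> n; exact: hC.
  by move=> n; apply: sumr_ge0 => k _; exact: sqr_ge0.
apply: (negl_le P _ (fun n w => 2 * D n w + 2 * A n w)); last first.
  by apply: neglD; apply: neglZ => //; exact: ito_increments iI.
move=> n w; rewrite !ger0_norm; last 2 first.
- by rewrite addr_ge0// mulr_ge0// sumr_ge0// => k _; exact: sqr_ge0.
- by apply: sumr_ge0 => k _; exact: sqr_ge0.
rewrite !mulr_sumr -big_split; apply: ler_sum => k _ /=; rewrite incr_cont.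
set x := incr _ _ _ _ _; set y := incr _ _ _ _ _; set z := _ * _.
by have := sqr_ge0 (x - (y - z)); nra.
Unshelve. all: by end_near. Qed.

(** Squared drift and Itô increments are each kept below [r / 4], and the square of a sum is at most
    twice the sum of the squares. A single drift increment is controlled through the sum of all the
    squares. *)
Lemma continuous_part_small (r : R -> R) : (\forall h \near 0^'+, 0 < r h) ->
  (h * ln (1 / h) / r h @[h --> 0^'+] --> (0 : R)) ->
  vanishing P (fun n => [set w | exists2 k, (k < n)%N & r (T / n%:R) < incr T n Y k w ^+ 2]).
Proof.
move=> rpos rlog.
(* [r] is positive only near 0; the maximum keeps the quotient nonnegative for every [n]. *)
pose D n w := (\sum_(k < n) incr T n (time_integral a) k w ^+ 2) / Num.max (r (T / n%:R)) 0.
have rn := mesh_threshold_pos T r T0 rpos.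
have nD : negl P D.
  apply: negl_pointwise => [n|w].
    by apply: measurable_funM => //; exact: measurable_drift_sum.
  have [C hC] := drift_sum a ca w.
  apply: squeeze0 (mesh_over_threshold T r T0 rpos rlog C).
    move=> n; apply: divr_ge0; last by rewrite le_max lexx orbT.
    by apply: sumr_ge0 => k _; exact: sqr_ge0.
  apply: filterS rn => n rn; rewrite /D (max_idPl (ltW rn)).
  by rewrite ler_wpM2r ?hC// invr_ge0 ltW.
pose lam n := Num.sqrt (r (T / n%:R)) / 2.
have vI : vanishing P (fun n => [set w | exists2 j, (j < n)%N & lam n < `|incr T n I j w|]).
  apply: (ito_small P T F T0 fF W sigma I bW as_ cs iI).
    by apply: filterS rn => n rn; rewrite divr_gt0// sqrtr_gt0.
  by move=> K K0; exact: exp_threshold.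
have q0 : 0 < 1 / 4 :> R by rewrite divr_gt0.
apply: vanishing_sub (vanishingU P _ _ vI (nD _ q0)).
apply: filterS rn => n rn w [k kn h]; rewrite incr_cont in h.
apply: contrapT => /= nh; move: h; apply/negP; rewrite -leNgt.
have hI : `|incr T n I k w| <= lam n.
  by rewrite leNgt; apply/negP => hI; apply: nh; left; exists k.
have hD : `|D n w| <= 1 / 4 by rewrite leNgt; apply/negP => hD; apply: nh; right.
have hA : incr T n (time_integral a) k w ^+ 2 <= r (T / n%:R) / 4.
  apply: (@le_trans _ _ (\sum_(k < n) incr T n (time_integral a) k w ^+ 2)).
    rewrite (bigD1 (Ordinal kn))//= lerDl sumr_ge0// => i _; exact: sqr_ge0.
  have := le_trans (ler_norm _) hD; rewrite /D (max_idPl (ltW rn)) ler_pdivrMr//.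
  by rewrite mulrAC mul1r.
have hI2 : incr T n I k w ^+ 2 <= r (T / n%:R) / 4.
  rewrite -[leLHS]real_normK ?num_real//; apply: (le_trans (ler_sqr_ge0 _ _ (normr_ge0 _) hI)).
  rewrite /lam exprMn sqr_sqrtr ?(ltW rn)// ler_wpM2l ?(ltW rn)//.
  by rewrite exprVn lef_pV2 ?posrE// -natrX ler_nat.
have := sqr_ge0 (incr T n (time_integral a) k w - incr T n I k w).
by move: hA hI2; move: (r _) => ?; nra.
Qed.

(** Up to time [T] these sums converge in probability to the integral of [sigma ^+ 2], hence are
    tight. *)
Lemma tight_diffusion : tight P (fun n w =>
  \sum_(k < n) (sigma (tick T n k) w * incr T n W k w) ^+ 2).
Proof.
have TT : 0 <= T <= T by rewrite lexx ltW.
have sqrc : continuous (fun x : R => x ^+ 2) by exact: exprn_continuous.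
have cs2 := cadlag_paths_comp T _ _ sqrc cs.
have as2 := adapted_comp T F _ _ sqrc as_.
have [mI _] := riemann_negl P T T0 _ T cs2 (fun s sT => adapted_measurable T F _ s fF as2 sT) TT.
have := negl_tight_cvg P _ _ mI (quadratic_variation P T F T0 fF W _ T bW as2 cs2 TT).
apply: tight_le => n w; apply: le_of_eq; congr (`|_|); apply: eq_bigr => k _.
by rewrite /obs tick_le// mul1r exprMn.
Qed.

End continuous_part.

Lemma negl_cross t (x1 x2 : forall n, nat -> Omega -> R) :
  negl P (fun n w => \sum_(k < n) x1 n k w ^+ 2) ->
  tight P (fun n w => \sum_(k < n) x2 n k w ^+ 2) ->
  negl P (fun n w => \sum_(k < n) (obs T t n k)%:R * (x1 n k w * x2 n k w)).
Proof.
move=> n1 t2; apply: negl_interp n1 t2.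
- by move=> n w; apply: sumr_ge0 => k _; exact: sqr_ge0.
- by move=> n w; apply: sumr_ge0 => k _; exact: sqr_ge0.
move=> n w th th0; apply: (le_trans (ler_norm_sum _ _ _)).
rewrite !mulr_sumr -big_split; apply: ler_sum => k _ /=.
apply: (@le_trans _ _ `|x1 n k w * x2 n k w|).
  by rewrite normrM ger0_norm// ler_piMl//; case: (obs T t n k).
apply: (le_trans (young _ _ _ th0)).
have : 0 <= th^-1 * x1 n k w ^+ 2 + th * x2 n k w ^+ 2.
  by rewrite addr_ge0// mulr_ge0 ?sqr_ge0// ?invr_ge0 ltW.
lra.
Qed.

Section truncation.
Variables (r : R -> R) (t : R).
Hypotheses (hr_pos : \forall h \near 0^'+, 0 < r h) (hr0 : r h @[h --> 0^'+] --> (0 : R)).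

(** The interface between the dynamics and the truncation: [J] moves only when [N] does, and with
    high probability all increments of [Y] pass the threshold. *)
Definition jump_part (X Y J : R -> Omega -> R) (N : R -> Omega -> nat) : Prop :=
  [/\ P.-negligible [set w | ~ forall s, 0 <= s <= T -> X s w = Y s w + J s w],
      (forall w u v, 0 <= u -> u <= v -> v <= T -> (N u w <= N v w)%N),
      (forall w u v, 0 <= u <= T -> 0 <= v <= T -> N u w = N v w -> J u w = J v w),
      measurable_fun setT (N T) &
      vanishing P (fun n => [set w | exists2 k, (k < n)%N & r (T / n%:R) < incr T n Y k w ^+ 2])].

Lemma truncated_sqr n k (X : R -> Omega -> R) w : 0 <= r (T / n%:R) ->
  truncated_increment T r n k X w ^+ 2 <= r (T / n%:R).
Proof. by move=> r0; rewrite /truncated_increment; case: ifP => // _; rewrite expr0n. Qed.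

(** Instead of counting the intervals with a jump, the error on each interval is bounded by [2 * r]
    times the increment of [N1 + N2]: it is 0 if neither moves, and otherwise two products of size
    at most [r] meet a factor at least 1. The sum telescopes. *)
Lemma truncation_negl (X1 X2 Y1 Y2 J1 J2 : R -> Omega -> R) N1 N2 :
  jump_part X1 Y1 J1 N1 -> jump_part X2 Y2 J2 N2 ->
  negl P (fun n w => IC_hat T r X1 X2 t n w -
    \sum_(k < n) (obs T t n k)%:R * (incr T n Y1 k w * incr T n Y2 k w)).
Proof.
move=> [Z1 mono1 cst1 mN1 small1] [Z2 mono2 cst2 mN2 small2] e e0.
pose NR (N : R -> Omega -> nat) s w : R := (N s w)%:R.
pose V n w := 2 * r (T / n%:R) * (NR N1 T w + NR N2 T w).
have mNR N : measurable_fun setT (N T) -> measurable_fun setT (NR N T).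
  by move=> mN; apply: (measurableT_comp _ mN).
have nV : negl P V.
  apply: negl_pointwise => [n|w].
    by apply: measurable_funM => //; apply: measurable_funD; exact: mNR.
  rewrite -(mul0r (NR N1 T w + NR N2 T w)); apply: cvgM; last exact: cvg_cst.
  rewrite -(mulr0 2); apply: cvgM; [exact: cvg_cst|exact: mesh_threshold0].
have vV := nV e e0.
have v1 := vanishing_null P _ Z1; have v2 := vanishing_null P _ Z2.
apply: vanishing_sub (vanishingU P _ _ (vanishingU P _ _ v1 v2)
  (vanishingU P _ _ (vanishingU P _ _ small1 small2) vV)).
apply: filterS2 (nbhs_infty_gt 0%N) (mesh_threshold_pos T r T0 hr_pos) => n n0 rn w /= h.
have [E1|] := pselect (forall s, 0 <= s <= T -> X1 s w = Y1 s w + J1 s w); last by left; left.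
have [E2|] := pselect (forall s, 0 <= s <= T -> X2 s w = Y2 s w + J2 s w); last by left; right.
have [?|S1] := pselect (exists2 k, (k < n)%N & r (T / n%:R) < incr T n Y1 k w ^+ 2).
  by right; left; left.
have [?|S2] := pselect (exists2 k, (k < n)%N & r (T / n%:R) < incr T n Y2 k w ^+ 2).
  by right; left; right.
right; right; apply: (lt_le_trans h).
have small Y k : ~ (exists2 k, (k < n)%N & r (T / n%:R) < incr T n Y k w ^+ 2) -> (k < n)%N ->
    incr T n Y k w ^+ 2 <= r (T / n%:R).
  by move=> nS kn; rewrite leNgt; apply/negP => hk; apply: nS; exists k.
have nojump (X Y J : R -> Omega -> R) (N : R -> Omega -> nat) k : (forall s, 0 <= s <= T -> X s w = Y s w + J s w) ->
    (forall w u v, 0 <= u <= T -> 0 <= v <= T -> N u w = N v w -> J u w = J v w) ->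
    ~ (exists2 k, (k < n)%N & r (T / n%:R) < incr T n Y k w ^+ 2) -> (k < n)%N ->
    N (tick T n k) w = N (tick T n k.+1) w ->
    truncated_increment T r n k.+1 X w = incr T n Y k w.
  move=> XE cst nS kn NE.
  have tk := tick_itv T n k T0 (ltnW kn); have tk1 := tick_itv T n k.+1 T0 kn.
  have iE : increment T n k.+1 X w = incr T n Y k w.
    transitivity (X (tick T n k.+1) w - X (tick T n k) w) => //.
    by rewrite !XE// (cst _ _ _ tk tk1 NE) /incr; ring.
  by rewrite /truncated_increment iE small.
have jump N k : (forall w u v, 0 <= u -> u <= v -> v <= T -> (N u w <= N v w)%N) -> (k < n)%N ->
    N (tick T n k) w <> N (tick T n k.+1) w -> 1 <= incr T n (NR N) k w.
  move=> mono kn NE; rewrite /incr /NR -natrB; last first.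
    by apply: mono; [exact: tick_ge0|exact: ler_tick|exact: tick_le].
  rewrite ler1n subn_gt0 ltn_neqAle; apply/andP; split; first exact/eqP.
  by apply: mono; [exact: tick_ge0|exact: ler_tick|exact: tick_le].
have incr0 N k : (forall w u v, 0 <= u -> u <= v -> v <= T -> (N u w <= N v w)%N) -> (k < n)%N ->
    0 <= incr T n (NR N) k w.
  move=> mono kn; rewrite subr_ge0 ler_nat.
  by apply: mono; [exact: tick_ge0|exact: ler_tick|exact: tick_le].
rewrite /IC_hat sum_obs -sumrB.
rewrite [leRHS]ger0_norm; last by rewrite !mulr_ge0 ?addr_ge0 ?(ltW rn).
apply: (@le_trans _ _ (\sum_(k < n) 2 * r (T / n%:R) *
    (incr T n (NR N1) k w + incr T n (NR N2) k w))); last first.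
  rewrite -mulr_sumr ler_wpM2l ?mulr_ge0 ?(ltW rn)// big_split /= !sum_incr tick_max//.
  by rewrite lerD// lerBlDr lerDl /NR.
apply: (le_trans (ler_norm_sum _ _ _)); apply: ler_sum => k _.
have kn := ltn_ord k.
rewrite -mulrBr normrM ger0_norm//.
apply: (@le_trans _ _ `|truncated_increment T r n k.+1 X1 w * truncated_increment T r n k.+1 X2 w
    - incr T n Y1 k w * incr T n Y2 k w|).
  by rewrite ler_piMl//; case: (obs T t n k).
have i1 := incr0 N1 k mono1 kn; have i2 := incr0 N2 k mono2 kn.
have bound : 1 <= incr T n (NR N1) k w + incr T n (NR N2) k w ->
    `|truncated_increment T r n k.+1 X1 w * truncated_increment T r n k.+1 X2 w
    - incr T n Y1 k w * incr T n Y2 k w| <=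
    2 * r (T / n%:R) * (incr T n (NR N1) k w + incr T n (NR N2) k w).
  move=> j1; apply: (@le_trans _ _ (2 * r (T / n%:R))); last first.
    by rewrite ler_peMr// mulr_ge0// ltW.
  have y1 := small Y1 k S1 kn; have y2 := small Y2 k S2 kn.
  have t1 := truncated_sqr n k.+1 X1 w (ltW rn).
  have t2 := truncated_sqr n k.+1 X2 w (ltW rn).
  apply: (le_trans (ler_normB _ _)).
  have a1 := young 1 (truncated_increment T r n k.+1 X1 w) (truncated_increment T r n k.+1 X2 w) ltr01.
  have a2 := young 1 (incr T n Y1 k w) (incr T n Y2 k w) ltr01.
  by move: a1 a2; rewrite invr1 !mul1r; move: y1 y2 t1 t2; move: (r _) => ?; lra.
have [NE1|NE1] := pselect (N1 (tick T n k) w = N1 (tick T n k.+1) w); last first.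
  by apply: bound; have := jump N1 k mono1 kn NE1; move: i2; lra.
have [NE2|NE2] := pselect (N2 (tick T n k) w = N2 (tick T n k.+1) w); last first.
  by apply: bound; have := jump N2 k mono2 kn NE2; move: i1; lra.
rewrite (nojump X1 Y1 J1 N1 k E1 cst1 S1 kn NE1) (nojump X2 Y2 J2 N2 k E2 cst2 S2 kn NE2).
rewrite subrr normr0; apply: mulr_ge0; last exact: addr_ge0 i1 i2.
by rewrite mulr_ge0 ?(ltW rn).
Qed.

End truncation.

End jump_diffusions.

(** * Limits of the estimators *)

Section estimators.
Context {d : measure_display} {Omega : measurableType d} {R : realType}.
Variables (P : probability Omega R) (T : R) (F : R -> set (set Omega)).
Hypotheses (T0 : 0 < T) (fF : is_filtration T F).
Variables (r : R -> R) (t : R).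
Hypotheses (hr_pos : \forall h \near 0^'+, 0 < r h) (hr0 : r h @[h --> 0^'+] --> (0 : R))
  (hr_log : h * ln (1 / h) / r h @[h --> 0^'+] --> (0 : R)) (tT : 0 <= t <= T).

Lemma measurable_IC_hat X1 X2 n :
  (forall s, 0 <= s <= T -> measurable_fun setT (X1 s : Omega -> R)) ->
  (forall s, 0 <= s <= T -> measurable_fun setT (X2 s : Omega -> R)) ->
  measurable_fun setT (IC_hat T r X1 X2 t n).
Proof.
move=> m1 m2.
have mt (X : R -> Omega -> R) k : (k < n)%N ->
    (forall s, 0 <= s <= T -> measurable_fun setT (X s)) ->
    measurable_fun setT (truncated_increment T r n k.+1 X).
  move=> kn mX; pose g (x : R) := x * \1_[set x | x ^+ 2 <= r (T / n%:R)] x.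
  have mi : measurable_fun setT (increment T n k.+1 X).
    apply: measurable_funB; apply: mX; first exact: (tick_itv T n k.+1 T0 kn).
    exact: (tick_itv T n k T0 (ltnW kn)).
  have mg : measurable_fun setT g.
    apply: measurable_funM => //; apply: measurable_indic.
    rewrite (_ : mkset _ = ~` [set x | r (T / n%:R) < x ^+ 2]); last first.
      apply/seteqP; split=> x /=; first by move=> h; apply/negP; rewrite -leNgt.
      by move/negP; rewrite -leNgt.
    apply: measurableC; have msq : measurable_fun setT (fun x : R => x ^+ 2) by exact: measurable_funX.
    have := msq measurableT `]r (T / n%:R), +oo[%classic (measurable_itv _).
    by rewrite setTI; congr measurable; apply/seteqP; split=> x /=; rewrite in_itv/= andbT.
  rewrite (_ : truncated_increment _ _ _ _ _ = g \o increment T n k.+1 X).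
    exact: measurableT_comp.
  apply/funext => w; rewrite /truncated_increment /g /= indicE.
  case: ifPn => h; first by rewrite mem_set ?mulr1.
  by rewrite memNset ?mulr0//=; apply/negP.
rewrite (_ : IC_hat _ _ _ _ _ _ = fun w => \sum_(k < n) (obs T t n k)%:R *
  (truncated_increment T r n k.+1 X1 w * truncated_increment T r n k.+1 X2 w)); last first.
  by apply/funext => w; rewrite /IC_hat sum_obs.
by apply: measurable_sum => k; apply: measurable_funM => //; apply: measurable_funM; exact: mt.
Qed.

Lemma IV_hatE (X : R -> Omega -> R) : IV_hat T r X t = IC_hat T r X X t.
Proof.
by apply/funext => n; apply/funext => w; apply: eq_bigr => j _; rewrite expr2.
Qed.

Lemma jump_diffusion_parts W a sigma N gamma X : is_brownian P T F W ->
  jump_diffusion P T F W a sigma N gamma X -> exists Y J,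
  [/\ jump_part P T r X Y J N,
      negl P (fun n w => \sum_(k < n) (incr T n Y k w - sigma (tick T n k) w * incr T n W k w) ^+ 2) &
      tight P (fun n w => \sum_(k < n) (sigma (tick T n k) w * incr T n W k w) ^+ 2)].
Proof.
move=> bW [mX [aa ca] [as_ cs] [I [J [iI fJ indX]]]].
exists (fun s w => time_integral a s w + I s w), J.
have cJ := jumps_counting fJ.
split.
- split.
  + exact: indX.
  + by move=> w u v u0 uv vT; exact: (counting_mono cJ).
  + by move=> w u v uT vT NE; rewrite !(jumps_def fJ)// NE.
  + by apply: (counting_measurable cJ); rewrite lexx ltW.
  + exact: continuous_part_small fF _ _ _ _ bW aa ca as_ cs iI r hr_pos hr_log.
- exact: continuous_part_approx fF _ _ _ _ bW aa ca as_ cs iI.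
- exact: tight_diffusion fF _ _ bW as_ cs.
Qed.

(** Stated for two arbitrary Brownian motions, so that taking both diffusions equal covers the
    integrated variances. The product of the [z + d] is expanded, and each term with a factor [d] is
    negligible by [negl_cross]. *)
Lemma estimator_variation W1 W2 a1 a2 sigma1 sigma2 N1 N2 gamma1 gamma2 X1 X2 :
  is_brownian P T F W1 -> is_brownian P T F W2 ->
  jump_diffusion P T F W1 a1 sigma1 N1 gamma1 X1 ->
  jump_diffusion P T F W2 a2 sigma2 N2 gamma2 X2 ->
  negl P (fun n w => IC_hat T r X1 X2 t n w - \sum_(k < n) (obs T t n k)%:R *
    ((sigma1 (tick T n k) w * incr T n W1 k w) * (sigma2 (tick T n k) w * incr T n W2 k w))).
Proof.
move=> b1 b2 j1 j2.
have [Y1 [J1 [p1 n1 t1]]] := jump_diffusion_parts _ _ _ _ _ _ b1 j1.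
have [Y2 [J2 [p2 n2 t2]]] := jump_diffusion_parts _ _ _ _ _ _ b2 j2.
have tr := truncation_negl P T T0 r t hr_pos hr0 X1 X2 Y1 Y2 J1 J2 N1 N2 p1 p2.
pose z1 n k w := sigma1 (tick T n k) w * incr T n W1 k w.
pose z2 n k w := sigma2 (tick T n k) w * incr T n W2 k w.
pose d1 n k w := incr T n Y1 k w - z1 n k w.
pose d2 n k w := incr T n Y2 k w - z2 n k w.
have c1 := negl_cross P T t d1 z2 n1 t2.
have c2 := negl_cross P T t d2 z1 n2 t1.
have c3 := negl_cross P T t d1 d2 n1 (negl_tight _ _ n2).
have := neglD P _ _ (neglD P _ _ tr c1) (neglD P _ _ c2 c3).
apply: negl_le => n w; apply: le_of_eq; congr (`|_|).
have -> : \sum_(k < n) (obs T t n k)%:R * (incr T n Y1 k w * incr T n Y2 k w) =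
    \sum_(k < n) (obs T t n k)%:R * (z1 n k w * z2 n k w) +
    \sum_(k < n) (obs T t n k)%:R * (d1 n k w * z2 n k w) +
    \sum_(k < n) (obs T t n k)%:R * (d2 n k w * z1 n k w) +
    \sum_(k < n) (obs T t n k)%:R * (d1 n k w * d2 n k w).
  by rewrite -!big_split; apply: eq_bigr => k _; rewrite /d1 /d2 /z1 /z2 /=; ring.
rewrite -/(z1 n _ w) -/(z2 n _ w).
set p := bigop _ _ _; set q := bigop _ _ _; set u := bigop _ _ _; set v := bigop _ _ _.
by ring.
Qed.

Lemma measurable_time_integral c : adapted T F c -> cadlag_paths T c ->
  measurable_fun setT (time_integral c t).
Proof.
move=> ac cc; have [] := riemann_negl P T T0 c t cc _ tT => //.
by move=> s; exact: adapted_measurable fF ac.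
Qed.

Lemma IV_measurable sigma : adapted T F sigma -> cadlag_paths T sigma ->
  measurable_fun setT (IV sigma t).
Proof.
move=> as_ cs; apply: measurable_time_integral.
  exact: (adapted_comp T F _ (fun x => x ^+ 2) (@exprn_continuous R 2)).
exact: (cadlag_paths_comp T _ (fun x => x ^+ 2) (@exprn_continuous R 2)).
Qed.

Lemma IV_hat_negl W a sigma N gamma X : is_brownian P T F W ->
  jump_diffusion P T F W a sigma N gamma X ->
  negl P (fun n w => IV_hat T r X t n w - IV sigma t w).
Proof.
move=> bW jX; have [as_ cs] := jd_diffusion jX.
have sqrc : continuous (fun x : R => x ^+ 2) by exact: exprn_continuous.
have q := quadratic_variation P T F T0 fF W _ t bW (adapted_comp T F _ _ sqrc as_)
  (cadlag_paths_comp T _ _ sqrc cs) tT.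
have := neglD P _ _ (estimator_variation _ _ _ _ _ _ _ _ _ _ _ _ bW bW jX jX) q.
apply: negl_le => n w; apply: le_of_eq; congr (`|_|); rewrite IV_hatE.
rewrite addrA; congr (_ - _); rewrite -addrA -[LHS]addr0; congr (_ + _).
rewrite -sumrN -big_split /= big1// => k _.
by ring.
Qed.

(** Four negligible quantities add up to the claim with term-by-term cancellation: the linearization
    error, the residual [D] of the decomposition of [W2], the orthogonal variation, and the
    quadratic variation of [W1] with weight [rho * sigma1 * sigma2]. *)
Lemma IC_hat_negl W1 W2 rho a1 a2 sigma1 sigma2 N1 N2 gamma1 gamma2 X1 X2 :
  adapted T F rho -> cadlag_paths T rho -> correlated_brownian P T F W1 W2 rho ->
  jump_diffusion P T F W1 a1 sigma1 N1 gamma1 X1 ->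
  jump_diffusion P T F W2 a2 sigma2 N2 gamma2 X2 ->
  negl P (fun n w => IC_hat T r X1 X2 t n w - IC rho sigma1 sigma2 t w).
Proof.
move=> arho crho [b1 b2 _ [W3 [I1 [I3 [b3 i13 ito1 ito3 indW]]]]] j1 j2.
have [as1 cs1] := jd_diffusion j1; have [as2 cs2] := jd_diffusion j2.
have [_ [_ [_ _ t1]]] := jump_diffusion_parts _ _ _ _ _ _ b1 j1.
pose s u w := Num.sqrt (1 - rho u w ^+ 2).
have as_ : adapted T F s by exact: (adapted_comp T F rho _ continuous_sqrt1B).
have cs : cadlag_paths T s by exact: (cadlag_paths_comp T rho _ continuous_sqrt1B).
pose D n k w := incr T n W2 k w - (rho (tick T n k) w * incr T n W1 k w
  + s (tick T n k) w * incr T n W3 k w).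
have nD : negl P (fun n w => \sum_(k < n) D n k w ^+ 2).
  have a1' := ito_increments P T F T0 fF W1 rho I1 b1 arho crho ito1.
  have a3' := ito_increments P T F T0 fF W3 s I3 b3 as_ cs ito3.
  apply: (negl_ae P _ _ _ indW) (neglD P _ _ (neglZ P 2 _ a1') (neglZ P 2 _ a3')).
  move=> n w /contrapT WE; rewrite !ger0_norm; last 2 first.
  - by apply: addr_ge0; rewrite mulr_ge0// sumr_ge0// => k _; exact: sqr_ge0.
  - by apply: sumr_ge0 => k _; exact: sqr_ge0.
  rewrite !mulr_sumr -big_split; apply: ler_sum => k _ /=.
  have kn := ltn_ord k.
  have -> : D n k w = (incr T n I1 k w - rho (tick T n k) w * incr T n W1 k w) +
     (incr T n I3 k w - s (tick T n k) w * incr T n W3 k w).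
    rewrite /D /incr !WE; [ring|exact: (tick_itv T n k T0 (ltnW kn))|exact: tick_itv].
  set x := _ - _; set y := _ - _; by have := sqr_ge0 (x - y); nra.
(* The random factor [sigma2] is bounded by [M] on the localizing event, at the price of a constant
   [M ^+ 2 + 1]. *)
have nD2 : negl P (fun n w => \sum_(k < n) (sigma2 (tick T n k) w * D n k w) ^+ 2).
  apply: (negl_local P (grid_bounded T sigma2)).
  - by move=> M; apply: measurable_grid_bounded => // u; exact: adapted_measurable fF as2.
  - by move=> M; exact: grid_bounded_incr.
  - exact: grid_bounded_all.
  move=> M e e0; have M0 : 0 < M%:R ^+ 2 + 1 :> R by rewrite ltr_wpDl// sqr_ge0.
  have e1 : 0 < e / (M%:R ^+ 2 + 1) by rewrite divr_gt0.
  apply: vanishing_sub (nD _ e1); near=> n => w [/= h Hw].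
  rewrite ltr_pdivrMr//; apply: (lt_le_trans h).
  rewrite !ger0_norm; last 2 first.
  - by apply: sumr_ge0 => k _; exact: sqr_ge0.
  - by apply: sumr_ge0 => k _; exact: sqr_ge0.
  rewrite mulr_suml; apply: ler_sum => k _; rewrite exprMn mulrC ler_wpM2l ?sqr_ge0//.
  have := Hw n k (ltnW (ltn_ord k)) => /(ler_sqr_ge0 _ _ (normr_ge0 _)).
  by rewrite real_normK ?num_real// => /le_trans; apply; rewrite lerDl.
have c1 := negl_cross P T t (fun n k w => sigma2 (tick T n k) w * D n k w)
  (fun n k w => sigma1 (tick T n k) w * incr T n W1 k w) nD2 t1.
have aIC : adapted T F (fun u w => rho u w * sigma1 u w * sigma2 u w).
  by apply: adaptedM => //; exact: adaptedM.
have cIC : cadlag_paths T (fun u w => rho u w * sigma1 u w * sigma2 u w).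
  by apply: cadlag_pathsM => //; exact: cadlag_pathsM.
have aO : adapted T F (fun u w => s u w * sigma1 u w * sigma2 u w).
  by apply: adaptedM => //; exact: adaptedM.
have cO : cadlag_paths T (fun u w => s u w * sigma1 u w * sigma2 u w).
  by apply: cadlag_pathsM => //; exact: cadlag_pathsM.
have q := quadratic_variation P T F T0 fF W1 _ t b1 aIC cIC tT.
have o := orthogonal_variation P T F T0 fF W1 W3 b1 b3 i13 _ t aO cO.
have v := estimator_variation _ _ _ _ _ _ _ _ _ _ _ _ b1 b2 j1 j2.
have := neglD P _ _ (neglD P _ _ v c1) (neglD P _ _ o q).
apply: negl_le => n w; apply: le_of_eq; congr (`|_|).
rewrite !addrA; congr (_ - _); rewrite -!addrA -[LHS]addr0; congr (_ + _).
rewrite -sumrN -!big_split /= big1// => k _.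
by rewrite /D; ring.
Unshelve. all: by end_near. Qed.

End estimators.

Theorem corollary3p5 (d : measure_display) (Omega : measurableType d)
  (R : realType) (P : probability Omega R) (T : R) (hT : 0 < T)
  (F : R -> set (set Omega)) (hF : is_filtration T F)
  (W1 W2 rho : R -> Omega -> R)
  (hrho : adapted T F rho /\ cadlag_paths T rho)
  (hW : correlated_brownian P T F W1 W2 rho)
  (a1 a2 sigma1 sigma2 : R -> Omega -> R)
  (N1 N2 : R -> Omega -> nat) (gamma1 gamma2 : R -> Omega -> R)
  (X1 X2 : R -> Omega -> R)
  (hX1 : jump_diffusion P T F W1 a1 sigma1 N1 gamma1 X1)
  (hX2 : jump_diffusion P T F W2 a2 sigma2 N2 gamma2 X2)
  (r : R -> R)
  (hr_pos : \forall h \near 0^'+, 0 < r h)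
  (hr0 : r h @[h --> 0^'+] --> (0 : R))
  (hr_log : h * ln (1 / h) / r h @[h --> 0^'+] --> (0 : R))
  (t : R) (ht : 0 <= t <= T) :
  [/\ cvg_in_prob P (IC_hat T r X1 X2 t) (IC rho sigma1 sigma2 t),
      ({ae P, forall w, IV sigma2 t w <> 0} ->
        cvg_in_prob P
          (fun n w => IC_hat T r X1 X2 t n w / IV_hat T r X2 t n w)
          (fun w => IC rho sigma1 sigma2 t w / IV sigma2 t w)),
      ({ae P, forall w, IV sigma1 t w <> 0} ->
        cvg_in_prob P
          (fun n w => IC_hat T r X1 X2 t n w / IV_hat T r X1 t n w)
          (fun w => IC rho sigma1 sigma2 t w / IV sigma1 t w)) &
      ({ae P, forall w, IV sigma1 t w * IV sigma2 t w <> 0} ->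
        cvg_in_prob P
          (fun n w => IC_hat T r X1 X2 t n w /
                      Num.sqrt (IV_hat T r X1 t n w * IV_hat T r X2 t n w))
          (fun w => IC rho sigma1 sigma2 t w /
                    Num.sqrt (IV sigma1 t w * IV sigma2 t w)))].
Proof.
have [arho crho] := hrho; have b1 := corr_brownian1 hW; have b2 := corr_brownian2 hW.
have [as1 cs1] := jd_diffusion hX1; have [as2 cs2] := jd_diffusion hX2.
have mX1 := jd_measurable hX1; have mX2 := jd_measurable hX2.
have mICh n := measurable_IC_hat T hT r t X1 X2 n mX1 mX2.
have mIV1h n : measurable_fun setT (IV_hat T r X1 t n).
  by rewrite IV_hatE; exact: measurable_IC_hat.
have mIV2h n : measurable_fun setT (IV_hat T r X2 t n).
  by rewrite IV_hatE; exact: measurable_IC_hat.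
have mIC : measurable_fun setT (IC rho sigma1 sigma2 t).
  apply: (measurable_time_integral P T F hT hF t ht).
    by apply: (adaptedM T F hF) => //; exact: (adaptedM T F hF).
  by apply: cadlag_pathsM => //; exact: cadlag_pathsM.
have mIV1 := IV_measurable P T F hT hF t ht sigma1 as1 cs1.
have mIV2 := IV_measurable P T F hT hF t ht sigma2 as2 cs2.
have nIC := IC_hat_negl P T F hT hF r t hr_pos hr0 hr_log ht _ _ _ _ _ _ _ _ _ _ _ _ _
  arho crho hW hX1 hX2.
have nIV1 := IV_hat_negl P T F hT hF r t hr_pos hr0 hr_log ht _ _ _ _ _ _ b1 hX1.
have nIV2 := IV_hat_negl P T F hT hF r t hr_pos hr0 hr_log ht _ _ _ _ _ _ b2 hX2.
have mdiv (U V : Omega -> R) : measurable_fun setT U -> measurable_fun setT V ->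
    measurable_fun setT (fun w => U w / V w).
  by move=> mU mV; apply: measurable_funM => //; exact: (measurableT_comp measurable_inv).
have msqrt (U : Omega -> R) : measurable_fun setT U -> measurable_fun setT (fun w => Num.sqrt (U w)).
  move=> mU; apply: (measurableT_comp _ mU).
  by apply: continuous_measurable_fun; exact: sqrt_continuous.
split.
- exact: cvg_in_probP.
- move=> v0; apply: cvg_in_probP; [by move=> n; exact: mdiv|exact: mdiv|].
  exact: negl_div.
- move=> v0; apply: cvg_in_probP; [by move=> n; exact: mdiv|exact: mdiv|].
  exact: negl_div.
- move=> v0; have mV := msqrt _ (measurable_funM mIV1 mIV2).
  apply: cvg_in_probP; [|exact: mdiv|].
    by move=> n; apply: mdiv => //; apply: msqrt; exact: measurable_funM.
  apply: negl_div => //; last exact/negl_sqrt/neglM.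
  (* A vanishing square root only makes the product nonpositive; both integrals being nonnegative,
     the product is then 0. *)
  apply: filterS v0 => w vw /eqP; rewrite sqrtr_eq0 => vle.
  have IV0 sigma : 0 <= IV sigma t w by apply: Rintegral_ge0 => s _; exact: sqr_ge0.
  by apply: vw; apply/eqP; rewrite eq_le vle mulr_ge0.
Qed.
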